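(* Let $n\ge 5$ be an integer, $2^{**}=\frac{2n}{n-4}$, and $\lambda>0$. There exist $\overline{\alpha}>0$ and $\overline{q}\in(2,2^{**})$, both depending on $\lambda$, such that for every $q\in(\overline{q},2^{**}]$ and every $\alpha\in(4-n,n)$ with $|\alpha|<\overline{\alpha}$ one has $$S_{\alpha,q}(\lambda)<S_{\alpha,q}^{\mathrm{rad}}(\lambda).$$ In particular, if $q\in(\overline{q},2^{**})$ and $|\alpha|<\overline{\alpha}$ then the ground states of $$(P)\qquad \Delta(|x|^{\alpha}\Delta u)-\lambda\,\mathrm{div}(|x|^{\alpha-2}\nabla u)=|x|^{-\beta}|u|^{q-2}u\ \text{ in }\mathbb{R}^{n},\qquad \int_{\mathbb{R}^{n}}|x|^{\alpha}|\Delta u|^{2}\,dx<\infty,$$ with $\beta=n-\frac{q(n-4+\alpha)}{2}$, are not radially symmetric.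
   Context: For $n\ge5$ and $\alpha\in(4-n,n)$, $D^{2,2}(\mathbb{R}^{n};|x|^{\alpha})$ is the completion of $C^{\infty}_{c}(\mathbb{R}^{n}\setminus\{0\})$ with respect to the Hilbertian norm $\|u\|_{2,\alpha}^{2}=\int_{\mathbb{R}^{n}}|x|^{\alpha}|\Delta u|^{2}\,dx$ (a space of functions, by the weighted Rellich inequality), and $D^{2,2}_{\mathrm{rad}}(\mathbb{R}^{n};|x|^{\alpha})$ is its subspace of radial functions. For $q\in(2,2^{**}]$, with $\beta=n-\frac{q(n-4+\alpha)}{2}$, set $$Q(u)=\frac{\int_{\mathbb{R}^{n}}|x|^{\alpha}|\Delta u|^{2}\,dx+\lambda\int_{\mathbb{R}^{n}}|x|^{\alpha-2}|\nabla u|^{2}\,dx}{\left(\int_{\mathbb{R}^{n}}|x|^{-\beta}|u|^{q}\,dx\right)^{2/q}},$$ $$S_{\alpha,q}(\lambda):=\inf_{u\in D^{2,2}(\mathbb{R}^{n};|x|^{\alpha}),\,u\ne0}Q(u),\qquad S_{\alpha,q}^{\mathrm{rad}}(\lambda):=\inf_{u\in D^{2,2}_{\mathrm{rad}}(\mathbb{R}^{n};|x|^{\alpha}),\,u\ne0}Q(u).$$ A (global) ground state of $(P)$ is a nontrivial $u\in D^{2,2}(\mathbb{R}^{n};|x|^{\alpha})$ that is a weak solution of $(P)$, i.e. $\int|x|^{\alpha}\Delta u\,\Delta\varphi\,dx+\lambda\int|x|^{\alpha-2}\nabla u\cdot\nabla\varphi\,dx=\int|x|^{-\beta}|u|^{q-2}u\,\varphi\,dx$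 for all $\varphi\in C^\infty_c(\mathbb{R}^n)$, and that attains the infimum $S_{\alpha,q}(\lambda)$. *)

(* Defs.v *)
From HB Require Import structures.
From mathcomp Require Import all_boot all_order all_algebra.
From mathcomp Require Import all_classical all_reals all_analysis.

Set Implicit Arguments.
Unset Strict Implicit.
Unset Printing Implicit Defensive.

Import Order.TTheory GRing.Theory Num.Theory.
Import numFieldNormedType.Exports.

Local Open Scope classical_set_scope.
Local Open Scope ring_scope.

(* R^n is 'rV[R]_n (which carries the library's topology and derivatives) with
   the product sigma-algebra, as the library does for n.-tuple. *)
Definition measure_rV_display : measure_display -> measure_display.
Proof. exact. Qed.

Section measurable_rV.
Context {R : realType} {n : nat}.

Let coors : 'I_n -> 'rV[R]_n -> measurableTypeR R := fun i x => x 0 i.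

Let rV_set0 : g_sigma_preimage coors set0.
Proof. exact: sigma_algebra0. Qed.

Let rV_setC A : g_sigma_preimage coors A -> g_sigma_preimage coors (~` A).
Proof. exact: sigma_algebraC. Qed.

Let rV_bigcup (F : _^nat) : (forall i, g_sigma_preimage coors (F i)) ->
  g_sigma_preimage coors (\bigcup_i (F i)).
Proof. exact: sigma_algebra_bigcup. Qed.

HB.instance Definition _ :=
  @isMeasurable.Build (measure_rV_display default_measure_display)
    'rV[R]_n (g_sigma_preimage coors) rV_set0 rV_setC rV_bigcup.

Lemma measurable_coord (i : 'I_n) :
  measurable_fun [set: 'rV[R]_n] (fun x : 'rV[R]_n => x 0 i : measurableTypeR R).
Proof.
move=> _ Y mY; rewrite setTI; apply: sub_sigma_algebra => /=.
rewrite -bigcup_seq/=; exists i => /=; first by rewrite mem_index_enum.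
by exists Y => //; rewrite setTI.
Qed.

Lemma measurable_fun_rVP d (T : measurableType d) (f : T -> 'rV[R]_n) :
  (forall i, measurable_fun [set: T] (fun t => f t 0 i : measurableTypeR R)) ->
  measurable_fun [set: T] f.
Proof.
move=> mf _ A mA; rewrite setTI.
suff : g_sigma_preimage (fun i => coors i \o f) `<=` measurable.
  by apply; rewrite g_sigma_preimage_comp; exists A => //; rewrite setTI.
apply: smallest_sub; first exact: sigma_algebra_measurable.
move=> B; rewrite -bigcup_seq => -[i _ [C mC <-]].
exact: mf.
Qed.

End measurable_rV.

Section consv.
Context {R : realType} {n : nat}.

Definition consv (p : measurableTypeR R * 'rV[R]_n) : 'rV[R]_n.+1 :=
  row_mx p.1%:M p.2.

Definition headv (x : 'rV[R]_n.+1) : measurableTypeR R * 'rV[R]_n :=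
  (x 0 0, \row_j x 0 (lift 0 j)).

Lemma consv0 p : consv p 0 0 = p.1.
Proof.
rewrite /consv (_ : 0 = @lshift 1 n ord0); last exact/val_inj.
by rewrite (@row_mxEl _ 1 1 n) mxE eqxx mulr1n.
Qed.

Lemma consv_lift p j : consv p 0 (lift 0 j) = p.2 0 j.
Proof.
rewrite /consv (_ : lift 0 j = @rshift 1 n j); last exact/val_inj.
by rewrite (@row_mxEr _ 1 1 n).
Qed.

Lemma consvK : cancel consv headv.
Proof.
move=> [a v]; rewrite /headv consv0; congr pair.
by apply/rowP => j; rewrite mxE consv_lift.
Qed.

Lemma measurable_consv : measurable_fun setT consv.
Proof.
apply: measurable_fun_rVP => i; case: (unliftP 0 i) => [j ->|->].
  apply: (eq_measurable_fun
    (fun p : measurableTypeR R * 'rV[R]_n => p.2 0 j)).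
    by move=> p _; rewrite consv_lift.
  exact: (measurableT_comp (measurable_coord j)).
by apply: (eq_measurable_fun fst) => // p _; rewrite consv0.
Qed.

Lemma measurable_headv : measurable_fun setT headv.
Proof.
apply/measurable_fun_pairP; split; first exact: measurable_coord.
apply: measurable_fun_rVP => i.
apply: (eq_measurable_fun (fun x : 'rV[R]_n.+1 => x 0 (lift 0 i))).
  by move=> x _; rewrite /= mxE.
exact: measurable_coord.
Qed.

End consv.

Section lebesgue_consv.
Context {R : realType} {n : nat}.
Variable mu : {sigma_finite_measure set 'rV[R]_n -> \bar R}.

Definition lebesgue_consv : set 'rV[R]_n.+1 -> \bar R :=
  pushforward (@lebesgue_measure R \x mu)%E consv.

Let lebesgue_consv0 : lebesgue_consv set0 = 0%E.
Proof. by rewrite /lebesgue_consv /pushforward preimage_set0 measure0. Qed.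

Let lebesgue_consv_ge0 A : (0 <= lebesgue_consv A)%E.
Proof. exact: (measure_ge0 (@lebesgue_measure R \x mu)%E). Qed.

Let lebesgue_consv_sigma_additive : semi_sigma_additive lebesgue_consv.
Proof.
move=> F mF tF mUF; rewrite /lebesgue_consv /pushforward preimage_bigcup.
apply: measure_semi_sigma_additive.
- by move=> k; rewrite -[X in measurable X]setTI; exact: measurable_consv.
- apply/trivIsetP => /= i j _ _ ij; rewrite -preimage_setI.
  by move/trivIsetP : tF => /(_ _ _ _ _ ij) ->//; rewrite preimage_set0.
- rewrite -preimage_bigcup -[X in measurable X]setTI.
  exact: measurable_consv.
Qed.

HB.instance Definition _ := isMeasure.Build _ _ _ lebesgue_consv
  lebesgue_consv0 lebesgue_consv_ge0 lebesgue_consv_sigma_additive.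
Let lebesgue_consv_sigma_finite : sigma_finite setT lebesgue_consv.
Proof.
have /sigma_finiteP[F [TF ndF Foo]] := sigma_finiteT (@lebesgue_measure R).
have /sigma_finiteP[G [TG ndG Goo]] := sigma_finiteT mu.
exists (fun k => headv @^-1` (F k `*` G k)).
  rewrite -preimage_bigcup -(preimage_setT headv); congr (_ @^-1` _).
  rewrite -setXTT TF TG predeqE => -[x y]; split.
    move=> [/= [k _ Fkx] [l _ Gly]]; exists (maxn k l) => //; split.
    - by move: x Fkx; exact/subsetPset/ndF/leq_maxl.
    - by move: y Gly; exact/subsetPset/ndG/leq_maxr.
  by move=> [k _ []/= ? ?]; split; exists k.
move=> k; have [mF Fk] := Foo k; have [mG Gk] := Goo k; split.
  rewrite -[X in measurable X]setTI.
  by apply: measurable_headv => //; exact: measurableX.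
rewrite /lebesgue_consv /pushforward -comp_preimage.
rewrite (_ : headv \o consv = id) ?preimage_id; last first.
  by apply/funext => p; exact: consvK.
by rewrite product_measure1E// lte_mul_pinfty// ge0_fin_numE.
Qed.

HB.instance Definition _ := Measure_isSigmaFinite.Build _ _ _
  lebesgue_consv lebesgue_consv_sigma_finite.

End lebesgue_consv.

(* n-fold product of the Lebesgue measure of R, along R * R^k ~ R^(k+1). *)
Fixpoint lebesgue_rV (R : realType) (n : nat) :
    {sigma_finite_measure set 'rV[R]_n -> \bar R} :=
  if n is k.+1 then lebesgue_consv (lebesgue_rV R k)
  else @dirac _ 'rV[R]_0 0 R.

Section calculus.
Context {R : realType} {n : nat}.
Implicit Types (u f g : 'rV[R]_n -> R) (x : 'rV[R]_n) (i : 'I_n).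

(* The library norm on 'rV[R]_n is the sup norm, hence this definition. *)
Definition enorm x : R := Num.sqrt (\sum_i x 0 i ^+ 2).

Definition partial i f : 'rV[R]_n -> R := 'D_(delta_mx 0 i) f.

Definition laplacian f : 'rV[R]_n -> R :=
  fun x => \sum_i partial i (partial i f) x.

Definition smooth f : Prop :=
  forall (s : seq 'I_n) x, differentiable (foldr partial f s) x.

Definition support_closure f : set 'rV[R]_n := closure [set x | f x != 0].

(* C_c^oo(R^n) *)
Definition test_fun f : Prop := smooth f /\ compact (support_closure f).

(* C_c^oo(R^n \ {0}) *)
Definition test_fun0 f : Prop := test_fun f /\ ~ support_closure f 0.

Definition locally_integrable0 f : Prop := forall K : set 'rV[R]_n,
  compact K -> ~ K 0 -> (lebesgue_rV R n).-integrable K (EFin \o f).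

(* Weak derivatives are taken in the sense of distributions on R^n \ {0};
   they are determined up to a null set. *)
Definition is_weak_partial i u g : Prop :=
  locally_integrable0 g /\
  forall phi, test_fun0 phi ->
    \int[lebesgue_rV R n]_x (u x * partial i phi x) =
    - \int[lebesgue_rV R n]_x (g x * phi x).

Definition is_weak_laplacian u g : Prop :=
  locally_integrable0 g /\
  forall phi, test_fun0 phi ->
    \int[lebesgue_rV R n]_x (u x * laplacian phi x) =
    \int[lebesgue_rV R n]_x (g x * phi x).

Definition weak_partial i u : 'rV[R]_n -> R :=
  xget (fun=> 0) [set g | is_weak_partial i u g].

Definition weak_laplacian u : 'rV[R]_n -> R :=
  xget (fun=> 0) [set g | is_weak_laplacian u g].

(* Functions are classes modulo null sets, so u is nonzero when it is not a.e. 0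
   and radial when it agrees a.e. with a function of |x|. *)
Definition nontrivial u : Prop :=
  ~ {ae lebesgue_rV R n, forall x, u x = 0}.

Definition radial u : Prop := exists g : R -> R,
  {ae lebesgue_rV R n, forall x, u x = g (enorm x)}.

(* Square of the norm of f in L^2(R^n; |x|^a dx). *)
Definition wL2_sq (a : R) f : \bar R :=
  (\int[lebesgue_rV R n]_x (enorm x `^ a * f x ^+ 2)%:E)%E.

End calculus.

Section variational_problem.
Context {R : realType} {n : nat}.
Variable alpha : R.
Implicit Types u : 'rV[R]_n -> R.

(* D^{2,2}(R^n; |x|^alpha): the completion of C_c^oo(R^n \ {0}) for the norm
   (wL2_sq alpha (laplacian phi))^(1/2). By the weighted Rellich inequality this
   norm controls the norm of L^2(R^n; |x|^(alpha - 4) dx), so the class of a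
   Cauchy sequence is identified with its limit u in that space. *)
Definition D22 u : Prop :=
  measurable_fun setT u /\
  exists phi : nat -> 'rV[R]_n -> R,
    [/\ forall k, test_fun0 (phi k),
        forall e : R, 0 < e -> exists N : nat, forall k l : nat,
          (N <= k)%N -> (N <= l)%N ->
          (wL2_sq alpha (laplacian (phi k \- phi l)%R) < e%:E)%E
      & (fun k => wL2_sq (alpha - 4) (phi k \- u)) @ \oo --> 0%E].

Definition D22_rad u : Prop := D22 u /\ radial u.

Variables q lambda : R.

Definition beta : R := n%:R - q * (n%:R - 4 + alpha) / 2.

Definition energy u : \bar R :=
  (wL2_sq alpha (weak_laplacian u) +
   lambda%:E * \int[lebesgue_rV R n]_x
     (enorm x `^ (alpha - 2) * \sum_i weak_partial i u x ^+ 2)%:E)%E.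

Definition Q u : \bar R :=
  (energy u /
   (\int[lebesgue_rV R n]_x (enorm x `^ (- beta) * `|u x| `^ q)%:E) `^ (2 / q))%E.

Definition S_inf : \bar R :=
  ereal_inf [set Q u | u in [set u | D22 u /\ nontrivial u]].

Definition S_rad : \bar R :=
  ereal_inf [set Q u | u in [set u | D22_rad u /\ nontrivial u]].

Definition weak_solution u : Prop := forall phi, test_fun phi ->
  \int[lebesgue_rV R n]_x
    (enorm x `^ alpha * (weak_laplacian u x * laplacian phi x)) +
  lambda * \int[lebesgue_rV R n]_x
    (enorm x `^ (alpha - 2) * \sum_i weak_partial i u x * partial i phi x) =
  \int[lebesgue_rV R n]_x
    (enorm x `^ (- beta) * (`|u x| `^ (q - 2) * u x) * phi x).

Definition ground_state u : Prop :=
  [/\ D22 u, nontrivial u, weak_solution u & Q u = S_inf].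

End variational_problem.
Arguments S_inf R n alpha q lambda : clear implicits.
Arguments S_rad R n alpha q lambda : clear implicits.

(* Main.v *)
Require Import Defs.
From HB Require Import structures.
From mathcomp Require Import all_boot all_order all_algebra.
From mathcomp Require Import all_classical all_reals all_analysis.
From mathcomp Require Import measurable_realfun ring lra.

Set Implicit Arguments.
Unset Strict Implicit.
Unset Printing Implicit Defensive.

Import Order.TTheory GRing.Theory Num.Theory.
Import numFieldNormedType.Exports.

Local Open Scope classical_set_scope.
Local Open Scope ring_scope.

(* Let p = 2n/(n-4) and let S be the infimum of the unweighted quotient
   int (Delta u)^2 / (int |u|^p)^(2/p) over test functions. By translating a nearly
   optimal test function far away from the origin, where the weight |x|^-2 is small,
   the gradient term becomes negligible: S_inf is at most S + eps at alpha = 0, q = p,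
   and, with the trial function fixed, also for (alpha, q) near (0, p).

   For radial u the gradient term cannot be neglected. Integrating by parts on shells
   bounds |x|^(n-4+alpha) u^2 by a multiple of B = int |x|^(alpha-2) |grad u|^2, so that
   Hardy's inequality gives (int |x|^-beta |u|^q)^(2/q) <= C B with C uniform near (0, p).
   On the other hand, with v = |x|^(alpha/2) u, Rellich's inequality and the interpolation
   of |x|^-beta |u|^q between |x|^-4 v^2 and |v|^p give
   int |x|^alpha (Delta u)^2 >= (S - eps) (int |x|^-beta |u|^q)^(2/q).
   Adding up, S_rad >= S - eps + lambda / C. No Sobolev inequality is needed: S may be 0
   in this argument. *)

(** * Smooth functions on open sets *)

(** The obstacle in the radial bound is that the approximating test functions of a radial u need not
    be radial, and that u itself agrees with a profile only almost everywhere. The integration by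
    parts is therefore carried out for arbitrary test functions, over slabs in the variable |x|^n
    weighted by a smooth bump: the mass of |x|^(n-4+alpha) phi^2 in a slab of width L is O(L) times
    the gradient term. This passes to u by Fatou. Radiality enters only then: the limit density is a
    function of |x|^n, and in that variable dx becomes a constant multiple of Lebesgue measure, so
    that a bound on the mass of all slabs is a pointwise bound. The Hardy and Rellich constants are
    gamma^2 with 2 gamma = n - 4 + alpha; for n >= 5 and |alpha| <= 1/2 one has gamma >= 1/4, and
    this makes all constants depend on n only. Weak derivatives are picked by choice among functions
    equal almost everywhere. The energy of u can be computed only after the fundamental lemma has
    identified them with the L^2 limits of the derivatives of the approximants. *)

Lemma near_eq_differentiable (R : numFieldType) (V W : normedModType R)
    (f g : V -> W) (x : V) :
  {near x, f =1 g} -> differentiable f x -> differentiable g x.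
Proof.
move=> fg df.
have gE : g \o shift x = cst (g x) + 'd f x +o_ 0 id.
  apply/eqaddoP => e e0.
  have /eqaddoP/(_ e e0) := diff_locally df.
  have fgx : f x = g x := nbhs_singleton fg.
  have fg0 : \forall h \near (0 : V), f (h + x) = g (h + x).
    have : \forall y \near x, f y = g y by exact: fg.
    by rewrite (near_shift 0) subr0; apply: filterS => h.
  apply: filterS2 fg0 => h /= fgh.
  by rewrite !fctE /= fgh fgx.
have dc : continuous ('d f x) by exact: diff_continuous.
by apply/diff_locallyP; rewrite (diff_unique dc gE).
Qed.

Section smooth_on.
Context {R : realType} {n : nat}.
Implicit Types (f g : 'rV[R]_n -> R) (D : set 'rV[R]_n).

(** The order is a number instead of a list of indices, so that products and compositions can be
    treated by induction on it. Level k asks for differentiability on D of all partial derivatives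
    of order at most k. *)
Fixpoint Ck D k f : Prop :=
  (forall x, D x -> differentiable f x) /\
  (if k is k'.+1 then forall i, Ck D k' (partial i f) else True).

Definition smooth_on D f := forall k, Ck D k f.

Lemma Ck_diff D k f x : Ck D k f -> D x -> differentiable f x.
Proof. by case: k => [|k] [h _]; exact: h. Qed.

Lemma CkW D k f : Ck D k.+1 f -> Ck D k f.
Proof.
elim: k f => [|k IH] f /=; first by case.
by move=> [df pf]; split => // i; apply: IH; have /= := pf i.
Qed.

Lemma Ck_sub D E k f : D `<=` E -> Ck E k f -> Ck D k f.
Proof.
move=> DE; elim: k f => [|k IH] f /= [df pf]; split => //.
- by move=> x /DE/df.
- by move=> x /DE/df.
- by move=> i; exact/IH/pf.
Qed.

Lemma smooth_onP D f :
  smooth_on D f <-> forall s x, D x -> differentiable (foldr partial f s) x.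
Proof.
split=> [h s x Dx|h k].
(* [Ck] peels off the derivative that is taken first, which is the last entry of [s]. *)
- elim/last_ind: s f h => [|s i IH] f h /=; first exact: (Ck_diff (h 0%N)).
  rewrite -cats1 foldr_cat /=; apply: IH => k.
  by have [_] := h k.+1; exact.
- elim: k f h => [|k IH] f h /=; split => //; try exact: (h [::]).
  move=> i; apply: IH => s x Dx.
  by have := h (rcons s i) x Dx; rewrite -cats1 foldr_cat.
Qed.

Lemma smooth_smooth_on D f : smooth f -> smooth_on D f.
Proof. by move=> sf; apply/smooth_onP => s x _; exact: sf. Qed.

Lemma smooth_onT f : smooth_on setT f -> smooth f.
Proof. by move=> /smooth_onP sf s x; exact: sf. Qed.

Lemma partial_near i f g x : {near x, f =1 g} -> partial i f x = partial i g x.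
Proof. exact: near_eq_derive. Qed.

Lemma open_near_eq D f g x : open D -> D x -> (forall y, D y -> f y = g y) ->
  {near x, f =1 g}.
Proof. by move=> oD Dx fg; apply: filterS (open_nbhs_nbhs (conj oD Dx)). Qed.

Lemma Ck_ext D k f g : open D -> (forall x, D x -> f x = g x) ->
  Ck D k f -> Ck D k g.
Proof.
move=> oD; elim: k f g => [|k IH] f g fg /= [df pf]; split => //.
- by move=> x Dx; apply: near_eq_differentiable (df _ Dx); exact: open_near_eq fg.
- by move=> x Dx; apply: near_eq_differentiable (df _ Dx); exact: open_near_eq fg.
- move=> i; apply: IH (pf i) => x Dx.
  by apply: partial_near; exact: open_near_eq fg.
Qed.

Lemma partial_cst i c : partial i (fun _ : 'rV[R]_n => c) = fun=> 0.
Proof. by apply/funext => x; exact: derive_cst. Qed.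

Lemma partialD i f g x : differentiable f x -> differentiable g x ->
  partial i (fun y => f y + g y) x = partial i f x + partial i g x.
Proof. by move=> df dg; apply: deriveD; exact: diff_derivable. Qed.

Lemma partialB i f g x : differentiable f x -> differentiable g x ->
  partial i (fun y => f y - g y) x = partial i f x - partial i g x.
Proof. by move=> df dg; apply: deriveB; exact: diff_derivable. Qed.

Lemma partialM i f g x : differentiable f x -> differentiable g x ->
  partial i (fun y => f y * g y) x = partial i f x * g x + f x * partial i g x.
Proof.
move=> df dg; rewrite /partial deriveM; try exact: diff_derivable.
by rewrite addrC [X in X + _]mulrC.
Qed.

Lemma derive_affine f (x v : 'rV[R]_n) c :
  (forall h, f (h *: v + x) = f x + h * c) -> 'D_v f x = c.
Proof.
move=> fE; apply: cvg_lim => //.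
apply: (@cvg_trans _ (cst c @ (0:R)^')); last exact: cvg_cst.
apply: near_eq_cvg; apply: filterS (nbhs_dnbhs_neq (0:R)) => h h0 /=.
by rewrite fE addrC addKr /GRing.scale/= mulKf.
Qed.

Lemma partial_coord i j x :
  partial i (fun y : 'rV[R]_n => y 0 j) x = (i == j)%:R.
Proof.
by apply: derive_affine => h; rewrite !mxE eqxx addrC eq_sym.
Qed.

Lemma partial_comp i (h : R -> R) f x dh : differentiable f x ->
  is_derive (f x) 1 h dh -> partial i (fun y => h (f y)) x = dh * partial i f x.
Proof.
move=> df hd.
have dif : differentiable h (f x) by apply/derivable1_diffP; case: hd.
have dhf : differentiable (fun y => h (f y)) x by exact: differentiable_comp.
rewrite /partial (deriveE _ dhf) (deriveE _ df).
rewrite (_ : (fun y => h (f y)) = h \o f)// diff_comp//=.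
set v : R := 'd f x _.
rewrite -[v in LHS]mulr1 -[v * 1]/(v *: 1) linearZ -deriveE// derive_val.
by rewrite /GRing.scale/= mulrC.
Qed.

Lemma differentiable_comp1 (h : R -> R) f x dh : differentiable f x ->
  is_derive (f x) 1 h dh -> differentiable (fun y => h (f y)) x.
Proof.
move=> df [hd _]; apply: (@differentiable_comp _ _ _ _ f h) => //.
exact/derivable1_diffP.
Qed.

Variable D : set 'rV[R]_n.
Hypothesis oD : open D.

Lemma Ck_cst k c : Ck D k (fun=> c).
Proof.
elim: k c => [|k IH] c /=; split => // i.
by rewrite partial_cst.
Qed.

Lemma CkD k f g : Ck D k f -> Ck D k g -> Ck D k (fun x => f x + g x).
Proof.
elim: k f g => [|k IH] f g /= [df pf] [dg pg]; split => //.
- by move=> x Dx; apply: differentiableD; [exact: df|exact: dg].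
- by move=> x Dx; apply: differentiableD; [exact: df|exact: dg].
- move=> i; apply: (Ck_ext oD _ (IH _ _ (pf i) (pg i))) => x Dx.
  by rewrite partialD//; [exact: df|exact: dg].
Qed.

Lemma CkM k f g : Ck D k f -> Ck D k g -> Ck D k (fun x => f x * g x).
Proof.
elim: k f g => [|k IH] f g Cf Cg /=; split => //.
- by move=> x Dx; apply: differentiableM; [exact: Ck_diff Cf Dx|exact: Ck_diff Cg Dx].
- by move=> x Dx; apply: differentiableM; [exact: Ck_diff Cf Dx|exact: Ck_diff Cg Dx].
- move=> i; have /= [df pf] := Cf; have /= [dg pg] := Cg.
  apply: (Ck_ext oD _ (CkD (IH _ _ (pf i) (CkW Cg)) (IH _ _ (CkW Cf) (pg i)))).
  by move=> x Dx; rewrite partialM//; [exact: df|exact: dg].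
Qed.

Lemma smooth_on_cst c : smooth_on D (fun=> c).
Proof. by move=> k; exact: Ck_cst. Qed.

Lemma smooth_onD f g : smooth_on D f -> smooth_on D g ->
  smooth_on D (fun x => f x + g x).
Proof. by move=> sf sg k; exact: CkD. Qed.

Lemma smooth_onM f g : smooth_on D f -> smooth_on D g ->
  smooth_on D (fun x => f x * g x).
Proof. by move=> sf sg k; exact: CkM. Qed.

Lemma smooth_on_ext f g : (forall x, D x -> f x = g x) ->
  smooth_on D f -> smooth_on D g.
Proof. by move=> fg sf k; exact: Ck_ext (sf k). Qed.

Lemma smooth_onZ c f : smooth_on D f -> smooth_on D (fun x => c * f x).
Proof. by apply: smooth_onM; exact: smooth_on_cst. Qed.

Lemma smooth_onN f : smooth_on D f -> smooth_on D (fun x => - f x).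
Proof.
by move=> /(smooth_onZ (-1)); apply: smooth_on_ext => x _; rewrite mulN1r.
Qed.

Lemma smooth_onB f g : smooth_on D f -> smooth_on D g ->
  smooth_on D (fun x => f x - g x).
Proof. by move=> sf sg; apply: smooth_onD => //; exact: smooth_onN. Qed.

Lemma smooth_on_sum (I : Type) (r : seq I) (P : pred I) (F : I -> 'rV[R]_n -> R) :
  (forall i, P i -> smooth_on D (F i)) ->
  smooth_on D (fun x => \sum_(i <- r | P i) F i x).
Proof.
move=> sF; elim: r => [|i r IH].
  by apply: (smooth_on_ext _ (smooth_on_cst 0)) => x _; rewrite big_nil.
have [Pi|Pi] := boolP (P i).
  apply: (smooth_on_ext _ (smooth_onD (sF i Pi) IH)) => x _.
  by rewrite big_cons Pi.
by apply: (smooth_on_ext _ IH) => x _; rewrite big_cons (negbTE Pi).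
Qed.

Lemma smooth_on_prod (I : Type) (r : seq I) (P : pred I) (F : I -> 'rV[R]_n -> R) :
  (forall i, P i -> smooth_on D (F i)) ->
  smooth_on D (fun x => \prod_(i <- r | P i) F i x).
Proof.
move=> sF; elim: r => [|i r IH].
  by apply: (smooth_on_ext _ (smooth_on_cst 1)) => x _; rewrite big_nil.
have [Pi|Pi] := boolP (P i).
  apply: (smooth_on_ext _ (smooth_onM (sF i Pi) IH)) => x _.
  by rewrite big_cons Pi.
by apply: (smooth_on_ext _ IH) => x _; rewrite big_cons (negbTE Pi).
Qed.

Lemma smooth_on_coord j : smooth_on D (fun x => x 0 j).
Proof.
case=> [|k] /=; split => //; do ?by move=> x _; exact: differentiable_coord.
move=> i.
by apply: (Ck_ext oD _ (Ck_cst k (i == j)%:R)) => x _; rewrite partial_coord.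
Qed.

Lemma smooth_on_partial i f : smooth_on D f -> smooth_on D (partial i f).
Proof. by move=> sf k; have [_] := sf k.+1; exact. Qed.

Lemma smooth_on_intro f (g : 'I_n -> 'rV[R]_n -> R) :
  (forall x, D x -> differentiable f x) ->
  (forall i x, D x -> partial i f x = g i x) ->
  (forall i, smooth_on D (g i)) -> smooth_on D f.
Proof.
move=> df pf sg [|k] /=; split => // i.
by apply: (Ck_ext oD _ (sg i k)) => x Dx; rewrite pf.
Qed.

(* Two such families of outer functions are used: the powers t^a, and the products
   t^(-k) exp(-1/t). Closure under derivation makes the induction on the order work. *)
Lemma smooth_on_comp (I : Type) (E : set R) (h : I -> R -> R)
    (r : I -> seq (R * I)) f :
  (forall j t, E t ->
     is_derive t 1 (h j) (\sum_(p <- r j) p.1 * h p.2 t)) ->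
  (forall x, D x -> E (f x)) -> smooth_on D f ->
  forall j, smooth_on D (fun x => h j (f x)).
Proof.
move=> hd DE sf j k; elim: k j => [|k IH] j /=; split => //.
- move=> x Dx; exact: differentiable_comp1 (Ck_diff (sf 0%N) Dx) (hd j _ (DE _ Dx)).
- move=> x Dx; exact: differentiable_comp1 (Ck_diff (sf 0%N) Dx) (hd j _ (DE _ Dx)).
move=> i.
have C1 : Ck D k (fun x => \sum_(p <- r j) p.1 * h p.2 (f x)).
  elim: (r j) => [|p s IHs].
    by apply: (Ck_ext oD _ (Ck_cst k 0)) => x _; rewrite big_nil.
  apply: (Ck_ext oD _ (CkD (CkM (Ck_cst k p.1) (IH p.2)) IHs)) => x _.
  by rewrite big_cons.
apply: (Ck_ext oD _ (CkM C1 (smooth_on_partial i sf k))) => x Dx.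
by rewrite (partial_comp _ (Ck_diff (sf 0%N) Dx) (hd j _ (DE _ Dx))).
Qed.

Lemma smooth_on_powR f a : (forall x, D x -> 0 < f x) -> smooth_on D f ->
  smooth_on D (fun x => f x `^ a).
Proof.
move=> f0 sf.
apply: (@smooth_on_comp R [set t | 0 < t] (fun a t => t `^ a)
  (fun a => [:: (a, a - 1)]) f _ _ sf) => // b t t0.
by rewrite big_seq1; exact: is_derive1_powR.
Qed.

End smooth_on.

(** * Test functions vanishing near the origin *)

Section test_functions.
Context {R : realType} {n : nat}.
Implicit Types (f g F : 'rV[R]_n -> R) (x : 'rV[R]_n) (i j : 'I_n).

Definition sqn x : R := \sum_i x 0 i ^+ 2.
(** At the origin this is the default value of [powR], 1 for a = 0 and 0 otherwise; hence the case x
    = 0 is split off in the pointwise identities below. *)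
Definition W (a : R) x : R := enorm x `^ a.
Definition D0 : set 'rV[R]_n := [set x | x != 0].

Lemma sqn_ge0 x : 0 <= sqn x.
Proof. by apply: sumr_ge0 => i _; exact: sqr_ge0. Qed.

Lemma sqn_gt0 x : x != 0 -> 0 < sqn x.
Proof.
move=> x0; rewrite lt_neqAle sqn_ge0 andbT eq_sym; apply: contra x0.
rewrite psumr_eq0 => [/allP h|i _]; last exact: sqr_ge0.
apply/eqP/rowP => i; rewrite mxE; apply/eqP.
by have := h i (mem_index_enum i); rewrite /= sqrf_eq0.
Qed.

Lemma enorm_ge0 x : 0 <= enorm x.
Proof. exact: sqrtr_ge0. Qed.

Lemma enorm_gt0 x : x != 0 -> 0 < enorm x.
Proof. by move=> x0; rewrite sqrtr_gt0; exact: sqn_gt0. Qed.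

Lemma enorm0 : enorm (0 : 'rV[R]_n) = 0.
Proof.
by rewrite /enorm big1 ?sqrtr0// => i _; rewrite mxE expr0n.
Qed.

Lemma sqr_enorm x : enorm x ^+ 2 = sqn x.
Proof. by rewrite sqr_sqrtr// sqn_ge0. Qed.

Lemma ler_coord_enorm x i : `|x 0 i| <= enorm x.
Proof.
rewrite -sqrtr_sqr ler_sqrt ?sqr_ge0//; last exact: sqn_ge0.
rewrite (bigD1 i)//= lerDl; apply: sumr_ge0 => k _; exact: sqr_ge0.
Qed.

Lemma ler_coord_norm x i : `|x 0 i| <= `|x|.
Proof.
by rewrite [leRHS]mx_normrE; apply: (le_bigmax _ _ (0, i)).
Qed.

Lemma norm_le_enorm x : `|x| <= enorm x.
Proof.
rewrite [leLHS]mx_normrE; apply: bigmax_le; first exact: enorm_ge0.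
by move=> [i j] _ /=; rewrite ord1; exact: ler_coord_enorm.
Qed.

Lemma W_ge0 a x : 0 <= W a x. Proof. exact: powR_ge0. Qed.

Lemma W_gt0 a x : x != 0 -> 0 < W a x.
Proof. by move=> x0; apply: powR_gt0; exact: enorm_gt0. Qed.

Lemma W_sqn a x : W a x = sqn x `^ (a / 2).
Proof.
by rewrite /W /enorm -powR12_sqrt ?sqn_ge0// -powRrM mulrC.
Qed.

Lemma WD a b x : x != 0 -> W (a + b) x = W a x * W b x.
Proof.
by move=> x0; rewrite /W powRD//; apply/implyP => _; rewrite gt_eqF// enorm_gt0.
Qed.

Lemma W2 x : W 2 x = sqn x.
Proof. by rewrite -sqr_enorm /W -powR_mulrn ?enorm_ge0. Qed.

Lemma W0 x : W 0 x = 1. Proof. exact: powRr0. Qed.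

Lemma open_D0 : open D0.
Proof.
rewrite (_ : D0 = ~` [set 0]); last by apply/seteqP; split => x /eqP.
by apply: closed_openC; apply: compact_closed; [exact: norm_hausdorff|exact: compact_set1].
Qed.

Lemma sqn_smooth D : open D -> smooth_on D sqn.
Proof.
move=> oD; apply: smooth_on_sum => // i _.
by apply: smooth_onM => //; exact: smooth_on_coord.
Qed.

Lemma sqn_differentiable x : differentiable sqn x.
Proof. exact: (Ck_diff (sqn_smooth openT 0%N)). Qed.

Lemma partial_sqn i x : partial i sqn x = 2 * x 0 i.
Proof.
have -> : sqn = \sum_i (fun x => x 0 i * x 0 i).
  by apply/funext => y; rewrite fct_sumE.
rewrite /partial derive_sum => [|j]; last first.
  by apply: diff_derivable; apply: differentiableM; exact: differentiable_coord.
rewrite (bigD1 i)//= big1 ?addr0 => [|j ji].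
  rewrite -[LHS]/(partial i _ x) partialM ?partial_coord ?eqxx;
    try exact: differentiable_coord.
  by rewrite mul1r mulr1 mulr2n mulrDl mul1r.
rewrite -[LHS]/(partial i _ x) partialM ?partial_coord ?eqxx;
  try exact: differentiable_coord.
by rewrite eq_sym (negbTE ji) mul0r mulr0 addr0.
Qed.

Lemma W_smooth a : smooth_on D0 (W a).
Proof.
apply: (@smooth_on_ext _ _ _ open_D0 (fun x => sqn x `^ (a / 2))).
  by move=> x _; rewrite W_sqn.
apply: smooth_on_powR; first exact: open_D0.
  by move=> x; exact: sqn_gt0.
exact/sqn_smooth/open_D0.
Qed.

Lemma partial_W i a x : x != 0 -> partial i (W a) x = a * x 0 i * W (a - 2) x.
Proof.
move=> x0.
rewrite (_ : W a = fun x => sqn x `^ (a / 2)); last first.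
  by apply/funext => y; rewrite W_sqn.
have hd : is_derive (sqn x) 1 (fun t : R => t `^ (a / 2)) (a / 2 * sqn x `^ (a / 2 - 1)).
  exact/is_derive1_powR/sqn_gt0.
rewrite (partial_comp _ (sqn_differentiable x) hd) partial_sqn W_sqn.
rewrite (_ : (a - 2) / 2 = a / 2 - 1); last by field.
by field.
Qed.

Lemma continuous_sqn : continuous sqn.
Proof. by move=> x; exact/differentiable_continuous/sqn_differentiable. Qed.

Lemma continuous_enorm : continuous (@enorm R n).
Proof.
move=> x; apply: (@continuous_comp _ _ _ sqn Num.sqrt); first exact: continuous_sqn.
exact: sqrt_continuous.
Qed.

Definition annulus (a b : R) : set 'rV[R]_n := [set x | a <= enorm x <= b].

Lemma compact_annulus a b : compact (annulus a b).
Proof.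
apply: bounded_closed_compact.
  exists b; split; first exact: num_real.
  move=> M bM x /andP[_ xb]; apply: le_trans (norm_le_enorm x) _.
  exact: le_trans xb (ltW bM).
rewrite (_ : annulus a b = enorm @^-1` `[a, b]%classic); last first.
  by apply/seteqP; split => x; rewrite /annulus/= in_itv.
apply: closed_comp; last exact: interval_closed.
by move=> x _; exact: continuous_enorm.
Qed.

Lemma closed_annulus a b : closed (annulus a b).
Proof.
by apply: compact_closed; [exact: norm_hausdorff|exact: compact_annulus].
Qed.

Lemma annulus_not0 a b : 0 < a -> ~ annulus a b 0.
Proof. by move=> a0; rewrite /annulus /= enorm0 leNgt a0. Qed.

Lemma annulus_D0 a b x : 0 < a -> annulus a b x -> x != 0.
Proof. by move=> a0; apply: contraPneq => ->; exact: annulus_not0. Qed.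

Lemma compact_sub_annulus (K : set 'rV[R]_n) : compact K -> ~ K 0 ->
  exists a b : R, [/\ 0 < a, a < b & K `<=` annulus a b].
Proof.
move=> cK K0; have [->|/set0P Kn0] := eqVneq K set0.
  by exists 1, 2; split => //; lra.
have ec : {within K, continuous (@enorm R n)}.
  by apply: continuous_subspaceT => x; exact: continuous_enorm.
have [x Kx xmin] := compact_EVT_min Kn0 cK ec.
have [y Ky ymax] := compact_EVT_max Kn0 cK ec.
exists (enorm x), (enorm y + 1); split.
- apply: enorm_gt0; apply: contra_notN K0 => /eqP <-.
  by move: Kx; rewrite inE.
- by rewrite (le_lt_trans (ymax _ Kx))// ltrDl.
- move=> z Kz; rewrite /annulus /= xmin ?inE//=.
  by rewrite (le_trans (ymax z _)) ?inE// lerDl.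
Qed.

(** Smoothness has to be checked only on [D0], where the weights are smooth too: outside the
    annulus, in particular near the origin, f is zero, and [D0] together with the complement of the
    annulus covers the whole space. *)
Lemma test_fun0P f : test_fun0 f <->
  smooth_on D0 f /\
  exists a b : R, [/\ 0 < a, a < b & forall x, f x != 0 -> annulus a b x].
Proof.
split=> [[[sf cf] f0]|[sf [a [b [a0 ab fab]]]]].
  split; first exact: smooth_smooth_on.
  have [a [b [a0 ab sub]]] := compact_sub_annulus cf f0.
  by exists a, b; split => // x fx; apply: sub; exact: subset_closure.
have sub : support_closure f `<=` annulus a b.
  rewrite /support_closure closureE; apply: smallest_sub => //.
  exact: closed_annulus.
split; last by move=> /sub; exact: annulus_not0.
split; last first.
  apply: subclosed_compact sub; last exact: compact_annulus.
  exact: closed_closure.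
apply: smooth_onT.
have oA : open (~` annulus a b).
  exact/closed_openC/closed_annulus.
have sA : smooth_on (~` annulus a b) f.
  apply: (@smooth_on_ext _ _ _ oA (fun=> 0)); last exact: smooth_on_cst.
  by move=> x nx; apply/esym/eqP; apply: contra_notT nx; exact: fab.
move=> k; have := sf k; have := sA k; clear sf fab sA sub; elim: k f => [|k IH] f /= [dA pA] [d0 p0].
  split => // x _; have [->|x0] := eqVneq x 0; last exact: d0.
  by apply: dA; exact: annulus_not0.
split => [x _|i]; last exact: IH.
have [->|x0] := eqVneq x 0; last exact: d0.
by apply: dA; exact: annulus_not0.
Qed.

Lemma test_fun0_smooth f : test_fun0 f -> smooth_on D0 f.
Proof. by move=> /test_fun0P[]. Qed.

Lemma test_fun0_diff f x : test_fun0 f -> differentiable f x.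
Proof. by move=> [[sf _] _]; exact: (sf [::] x). Qed.

Lemma test_fun0_at0 f : test_fun0 f -> \forall x \near (0 : 'rV[R]_n), f x = 0.
Proof.
move=> [_ f0]; have : open (~` support_closure f).
  by apply: closed_openC; exact: closed_closure.
move=> /(open_near_eq (g := fun=> 0) (f := f))/(_ f0); apply.
by move=> x nx; apply/eqP; apply: contra_notT nx => fx; apply: subset_closure.
Qed.

Lemma test_fun0_vanish0 f : test_fun0 f -> f 0 = 0.
Proof. by move=> /test_fun0_at0 /nbhs_singleton. Qed.

Lemma test_fun0M F f : smooth_on D0 F -> test_fun0 f ->
  test_fun0 (fun x => F x * f x).
Proof.
move=> sF /test_fun0P[sf [a [b [a0 ab fab]]]]; apply/test_fun0P; split.
  by apply: smooth_onM => //; exact: open_D0.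
exists a, b; split => // x; rewrite mulf_eq0 negb_or => /andP[_]; exact: fab.
Qed.

Lemma test_fun0D f g : test_fun0 f -> test_fun0 g ->
  test_fun0 (fun x => f x + g x).
Proof.
move=> /test_fun0P[sf [a [b [a0 ab fab]]]] /test_fun0P[sg [c [d [c0 cd gcd]]]].
apply/test_fun0P; split; first by apply: smooth_onD => //; exact: open_D0.
exists (Num.min a c), (Num.max b d); split.
- by rewrite lt_min a0.
- by rewrite gt_min !lt_max ab.
move=> x fg; have : (f x != 0) || (g x != 0).
  by apply: contraNT fg; rewrite negb_or !negbK => /andP[/eqP-> /eqP->]; rewrite addr0.
rewrite /annulus /= ge_min le_max => /orP[/fab|/gcd] /andP[-> ->] //.
by rewrite !orbT.
Qed.

Lemma test_fun0Z c f : test_fun0 f -> test_fun0 (fun x => c * f x).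
Proof. by apply: test_fun0M; apply: smooth_on_cst; exact: open_D0. Qed.

Lemma test_fun0N f : test_fun0 f -> test_fun0 (fun x => - f x).
Proof.
move=> /(test_fun0Z (-1)); congr test_fun0.
by apply/funext => x; rewrite mulN1r.
Qed.

Lemma test_fun0B f g : test_fun0 f -> test_fun0 g ->
  test_fun0 (fun x => f x - g x).
Proof. by move=> tf /test_fun0N; exact: test_fun0D. Qed.

Lemma test_fun0_cst0 : test_fun0 (fun _ : 'rV[R]_n => 0).
Proof.
apply/test_fun0P; split; first by apply: smooth_on_cst; exact: open_D0.
by exists 1, 2; split; [lra|lra|move=> x; rewrite eqxx].
Qed.

Lemma test_fun0_sum (I : Type) (r : seq I) (P : pred I) (G : I -> 'rV[R]_n -> R) :
  (forall k, P k -> test_fun0 (G k)) ->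
  test_fun0 (fun x => \sum_(k <- r | P k) G k x).
Proof.
move=> sG; elim: r => [|k r IH].
  have := test_fun0_cst0; congr test_fun0.
  by apply/funext => x; rewrite big_nil.
have [Pi|Pi] := boolP (P k).
  have := test_fun0D (sG k Pi) IH; congr test_fun0.
  by apply/funext => x; rewrite big_cons Pi.
move: IH; congr test_fun0.
by apply/funext => x; rewrite big_cons (negbTE Pi).
Qed.

Lemma partial_support f a b i : 0 < a ->
  (forall x, f x != 0 -> annulus a b x) ->
  (forall x, partial i f x != 0 -> annulus a b x).
Proof.
move=> a0 fab x; apply: contra_neqP => nx.
rewrite (@partial_near _ _ _ _ (fun=> 0)) ?partial_cst//.
apply: (@open_near_eq _ _ (~` annulus a b)) => //.
  exact/closed_openC/closed_annulus.
by move=> y ny; apply/eqP; apply: contra_notT ny; exact: fab.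
Qed.

Lemma test_fun0_partial i f : test_fun0 f -> test_fun0 (partial i f).
Proof.
move=> /test_fun0P[sf [a [b [a0 ab fab]]]]; apply/test_fun0P; split.
  by apply: smooth_on_partial => //; exact: open_D0.
by exists a, b; split => //; exact: partial_support.
Qed.

Lemma test_fun0_laplacian f : test_fun0 f -> test_fun0 (laplacian f).
Proof.
by move=> tf; apply: test_fun0_sum => i _; do 2 apply: test_fun0_partial.
Qed.

(** The rule holds at the origin as well, where F may be singular: the test function, the product
    and their derivatives all vanish there. *)
Lemma partialM0 i F f x : smooth_on D0 F -> test_fun0 f ->
  partial i (fun y => F y * f y) x = partial i F x * f x + F x * partial i f x.
Proof.
move=> sF tf; have [->|x0] := eqVneq x 0; last first.
  by rewrite partialM//; [exact: (Ck_diff (sF 0%N))|exact: test_fun0_diff].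
have p0 := test_fun0_vanish0 (test_fun0_partial i tf).
have P0 := test_fun0_vanish0 (test_fun0_partial i (test_fun0M sF tf)).
by rewrite P0 p0 (test_fun0_vanish0 tf) !mulr0 addr0.
Qed.

Lemma laplacianM0 F f x : smooth_on D0 F -> test_fun0 f ->
  laplacian (fun y => F y * f y) x =
  laplacian F x * f x + 2 * (\sum_i partial i F x * partial i f x) +
  F x * laplacian f x.
Proof.
move=> sF tf.
have dE i : partial i (partial i (fun y => F y * f y)) x =
  partial i (partial i F) x * f x + 2 * (partial i F x * partial i f x) +
  F x * partial i (partial i f) x.
  have -> : partial i (fun y => F y * f y) =
      fun y => partial i F y * f y + F y * partial i f y.
    by apply/funext => y; exact: partialM0.
  have sp := smooth_on_partial i sF; have tp := test_fun0_partial i tf.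
  have d1 : differentiable (fun y => partial i F y * f y) x.
    by apply: test_fun0_diff; exact: test_fun0M.
  have d2 : differentiable (fun y => F y * partial i f y) x.
    by apply: test_fun0_diff; exact: test_fun0M.
  rewrite (partialD i d1 d2) (partialM0 i x sp tf) (partialM0 i x sF tp).
  by ring.
transitivity (\sum_i (partial i (partial i F) x * f x +
    2 * (partial i F x * partial i f x) + F x * partial i (partial i f) x)).
  by apply: eq_bigr => i _; exact: dE.
by rewrite !big_split/= /laplacian !mulr_suml !mulr_sumr.
Qed.

Lemma laplacianB0 f g x : test_fun0 f -> test_fun0 g ->
  laplacian (f \- g) x = laplacian f x - laplacian g x.
Proof.
move=> tf tg; rewrite /laplacian -sumrB; apply: eq_bigr => i _.
have -> : partial i (f \- g) = fun y => partial i f y - partial i g y.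
  by apply/funext => y; rewrite partialB//; exact: test_fun0_diff.
by rewrite partialB//; apply: test_fun0_diff; exact: test_fun0_partial.
Qed.

End test_functions.

(** * Lebesgue measure and integration by parts *)

Section borel_rV.
Context {R : realType} {n : nat}.
Implicit Types (U : set 'rV[R]_n).

(** Cubes with rational centre and half-side 1/(k+1). They form a countable base, which links the
    topology to the product sigma-algebra and later lets almost everywhere statements be glued. *)
Definition rbox (p : 'rV[rat]_n * nat) : set 'rV[R]_n :=
  [set y | forall i, `|y 0 i - ratr (p.1 0 i)| < p.2.+1%:R^-1].

Lemma measurable_rbox p : measurable (rbox p).
Proof.
rewrite (_ : rbox p = \bigcap_(i in [set: 'I_n])
    ((fun y : 'rV[R]_n => y 0 i : measurableTypeR R) @^-1`
      `](ratr (p.1 0 i) - p.2.+1%:R^-1), (ratr (p.1 0 i) + p.2.+1%:R^-1)[%classic)).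
  apply: fin_bigcap_measurable => [|i _]; first exact: finite_finset.
  rewrite -[X in measurable X]setTI.
  by apply: measurable_coord => //; exact: measurable_itv.
apply/seteqP; split => y /= h i.
  by move=> _; rewrite /= in_itv/=; have := h i; rewrite ltr_distl.
by have := h i I; rewrite /= in_itv/= ltr_distl.
Qed.

Lemma ball_rV (x y : 'rV[R]_n) (e : R) : 0 < e ->
  (forall i, `|x 0 i - y 0 i| < e) -> ball x e y.
Proof.
move=> e0 h; split => // i j; rewrite ord1; exact: h.
Qed.

Lemma rbox_basis U x : open U -> U x -> exists p, rbox p x /\ rbox p `<=` U.
Proof.
move=> oU Ux.
have /nbhs_ballP[e/= e0 eU] : nbhs x U by exact: open_nbhs_nbhs.
have [k ke] : exists k, k.+1%:R^-1 < e / 2.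
  exists (Num.bound (e / 2)^-1); rewrite invf_plt ?posrE ?divr_gt0//.
  rewrite (lt_le_trans (archi_boundP _))// ?ler_nat// invr_ge0 ltW// divr_gt0 //.
have k0 : 0 < k.+1%:R^-1 :> R by rewrite invr_gt0.
have [q qx] : exists q : 'rV[rat]_n, forall i, `|x 0 i - ratr (q 0 i)| < k.+1%:R^-1.
  have /choice[f fP] : forall i, exists q, `|x 0 i - ratr q| < k.+1%:R^-1 :> R.
    move=> i; have /rat_in_itvoo[q] : x 0 i - k.+1%:R^-1 < x 0 i + k.+1%:R^-1.
      by rewrite ltrBlDr -addrA ltrDl addr_gt0.
    by rewrite in_itv/= => qi; exists q; rewrite distrC ltr_distl.
  by exists (\row_i f i) => i; rewrite mxE.
exists (q, k); split; first exact: qx.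
move=> y yq; apply: eU; apply: ball_rV => // i.
rewrite (_ : x 0 i - y 0 i = (x 0 i - ratr (q 0 i)) - (y 0 i - ratr (q 0 i))); last by ring.
rewrite (le_lt_trans (ler_normB _ _))//.
by move: (yq i) (qx i) => /= h1 h2; rewrite (splitr e); apply: ltrD; exact: lt_trans ke.
Qed.

Lemma open_measurable_rV U : open U -> measurable U.
Proof.
move=> oU.
rewrite (_ : U = \bigcup_(p in [set: 'rV[rat]_n * nat])
    (if `[< rbox p `<=` U >] then rbox p else set0)).
  apply: countable_bigcupT_measurable; first exact: countableP.
  by move=> p; case: ifP => _ //; exact: measurable_rbox.
apply/seteqP; split => [x Ux|x [p _]]; last by case: asboolP => // h; exact: h.
by have [p [px pU]] := rbox_basis oU Ux; exists p => //; case: asboolP.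
Qed.

Lemma closed_measurable_rV U : closed U -> measurable U.
Proof.
move=> cU; rewrite -[U]setCK; apply: measurableC; apply: open_measurable_rV.
exact: closed_openC.
Qed.

Lemma continuous_measurable_rV (f : 'rV[R]_n -> R) :
  continuous f -> measurable_fun setT f.
Proof.
move=> cf; apply: (measurability _ (RGenOpens.measurableE R)).
move=> _ [_ [a [b ->] <-]]; rewrite setTI; apply: open_measurable_rV.
by have /continuousP := cf; apply; exact: interval_open.
Qed.

End borel_rV.

(** * Lebesgue measure under dilations and translations *)

Section affine.
Context {R : realType}.
Local Open Scope ereal_scope.
Notation leb := (@lebesgue_measure R).

Lemma measurable_affine1 (s b : R) :
  measurable_fun setT (fun x : measurableTypeR R => (s * x + b)%R : measurableTypeR R).
Proof.
by apply: measurable_funD => //; exact: measurable_funM.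
Qed.

(** As a function of A the right side is a measure that agrees with Lebesgue measure on the
    intervals ]a, c], and these determine it. *)
Lemma lebesgue_affine1 (s b : R) (A : set (measurableTypeR R)) : (0 < s)%R ->
  measurable A ->
  leb A = s%:E * leb ((fun x : measurableTypeR R => (s * x + b)%R) @^-1` A).
Proof.
move=> s0 mA.
pose f : measurableTypeR R -> measurableTypeR R := fun x => (s * x + b)%R.
have mf : measurable_fun setT f by exact: measurable_affine1.
pose fp : {mfun measurableTypeR R >-> measurableTypeR R} :=
  HB.pack f (isMeasurableFun.Build _ _ _ _ f mf).
pose nu : {measure set (measurableTypeR R) -> \bar R} :=
  mscale (NngNum (ltW s0)) (pushforward leb fp).
suff -> : leb A = nu mf A by [].
apply: lebesgue_measure_unique mA => _ [[a c] _ <-] /=.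
transitivity (s%:E * leb `]((a - b) / s)%R, ((c - b) / s)%R]%classic).
  rewrite !lebesgue_measure_itv/= !lte_fin ltr_pM2r ?invr_gt0// ltrD2r.
  case: ifPn => _; last by rewrite mule0.
  by rewrite -!EFinB -EFinM; congr EFin; field; rewrite gt_eqF.
congr (_ * leb _); apply/seteqP; split => x /=; rewrite /f !in_itv/=.
  by rewrite ltr_pdivrMr// ler_pdivlMr// ltrBlDr lerBrDr mulrC.
by rewrite ltr_pdivrMr// ler_pdivlMr// ltrBlDr lerBrDr mulrC.
Qed.

Lemma measurable_affine n (s : R) (b : 'rV[R]_n) :
  measurable_fun setT (fun x : 'rV[R]_n => (s *: x + b)%R).
Proof.
apply: measurable_fun_rVP => i.
apply: (eq_measurable_fun (fun x : 'rV[R]_n => (s * x 0 i + b 0 i)%R)).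
  by move=> x _; rewrite !mxE.
by apply: measurable_funD => //; apply: measurable_funM => //; exact: measurable_coord.
Qed.

Lemma measurable_preim d1 d2 (T1 : measurableType d1) (T2 : measurableType d2)
    (f : T1 -> T2) A : measurable_fun setT f -> measurable A -> measurable (f @^-1` A).
Proof. by move=> mf mA; rewrite -[X in measurable X]setTI; exact: mf. Qed.

(** Induction on the dimension: the map acts separately on the first coordinate and on the others,
    so the sections are handled by the induction hypothesis and the outer integral by the
    one-dimensional case. *)
Lemma lebesgue_affine n (s : R) (b : 'rV[R]_n) A : (0 < s)%R -> measurable A ->
  lebesgue_rV R n A =
  (s ^+ n)%:E * lebesgue_rV R n ((fun x : 'rV[R]_n => (s *: x + b)%R) @^-1` A).
Proof.
move=> s0; elim: n b A => [|n IH] b A mA.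
  rewrite mul1e /= !diracE; congr (_%:R%:E)%R.
  rewrite (_ : _ @^-1` A = A)//; apply/seteqP; split => x /=.
    by rewrite (_ : (s *: x + b)%R = x)//; apply/rowP => -[].
  by rewrite (_ : (s *: x + b)%R = x)//; apply/rowP => -[].
set phi := fun x : 'rV[R]_n.+1 => _.
have mphiA : measurable (phi @^-1` A).
  by apply: measurable_preim => //; exact: measurable_affine.
have mS (B : set 'rV[R]_n.+1) : measurable B -> measurable (consv @^-1` B).
  by apply: measurable_preim; exact: measurable_consv.
pose b' := (\row_j b 0 (lift 0 j))%R : 'rV[R]_n.
pose G (x : measurableTypeR R) := lebesgue_rV R n (xsection (consv @^-1` A) x).
have mG : measurable_fun setT G by apply: measurable_fun_xsection; exact: mS.
have lhs : lebesgue_rV R n.+1 A = \int[leb]_x G x by [].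
have rhs : lebesgue_rV R n.+1 (phi @^-1` A) =
  \int[leb]_x lebesgue_rV R n (xsection (consv @^-1` (phi @^-1` A)) x) by [].
rewrite lhs rhs.
have cE x y : (s *: consv (x, y) + b)%R =
    consv ((s * x + b 0 0)%R, (s *: y + b')%R).
  apply/rowP => i; rewrite [LHS]mxE [X in (X + _)%R]mxE.
  by case: (unliftP 0%R i) => [j ->|->]; rewrite ?consv0// !consv_lift /= !mxE.
have secE x : G (s * x + b 0 0)%R =
    (s ^+ n)%:E * lebesgue_rV R n (xsection (consv @^-1` (phi @^-1` A)) x).
  rewrite /G (IH b'); last by apply: measurable_xsection; exact: mS.
  congr (_ * lebesgue_rV R n _); apply/funext => y; apply/propext.
  by rewrite /xsection /= !inE /= /phi cE.
have mG' : measurable_fun setT (fun x : measurableTypeR R => G (s * x + b 0 0)%R).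
  by apply: measurableT_comp => //; exact: measurable_affine1.
have sn0 : (0 <= s ^+ n)%R by rewrite exprn_ge0// ltW.
rewrite exprS EFinM -muleA -ge0_integralZl//; last first.
  exact: (measurable_fun_xsection _ (mS _ mphiA)).
under [in RHS]eq_integral do rewrite -secE.
pose f : measurableTypeR R -> measurableTypeR R := fun x => (s * x + b 0 0)%R.
have mf : measurable_fun setT f by exact: measurable_affine1.
pose pf : {measure set (measurableTypeR R) -> \bar R} := pushforward leb f.
transitivity (\int[mscale (NngNum (ltW s0)) (pf mf)]_x G x).
  by apply: eq_measure_integral => B mB _; exact: (lebesgue_affine1 (b 0 0)%R s0 mB).
rewrite (ge0_integral_mscale (pf mf) measurableT (NngNum (ltW s0)) mG)//.
by congr (_ * _); rewrite ge0_integral_pushforward.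
Qed.

End affine.
Section cubes.
Context {R : realType}.
Local Open Scope ereal_scope.

Definition cube n (M : R) : set 'rV[R]_n := [set x | forall i, (`|x 0%R i| <= M)%R].

Lemma measurable_cube n (M : R) : measurable (@cube n M).
Proof.
rewrite (_ : @cube n M = \bigcap_(i in [set: 'I_n])
    ((fun y : 'rV[R]_n => y 0%R i : measurableTypeR R) @^-1` `[(- M)%R, M]%classic)).
  apply: fin_bigcap_measurable => [|i _]; first exact: finite_finset.
  by apply: measurable_preim; [exact: measurable_coord|exact: measurable_itv].
apply/seteqP; split => y /= h i.
  by move=> _; rewrite /= in_itv/= -ler_norml; exact: h.
by have := h i I; rewrite /= in_itv/= -ler_norml.
Qed.

Lemma lebesgue_cube n (M : R) : (0 <= M)%R ->
  lebesgue_rV R n (@cube n M) = ((M *+ 2) ^+ n)%:E.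
Proof.
move=> M0; elim: n => [|n IH].
  by rewrite /= diracE mem_set// => -[].
transitivity ((lebesgue_measure \x lebesgue_rV R n) (`[(- M)%R, M]%classic `*` @cube n M)).
  rewrite /= /lebesgue_consv /pushforward; congr (_ _).
  apply/seteqP; split => -[x y] /=.
    move=> h; split; first by have := h 0%R; rewrite consv0 /= in_itv/= -ler_norml.
    by move=> i; have := h (lift 0%R i); rewrite consv_lift.
  move=> [/=]; rewrite in_itv/= -ler_norml => xM yM i.
  by case: (unliftP 0%R i) => [j ->|->]; rewrite ?consv_lift ?consv0// yM.
rewrite product_measure1E//; last exact: measurable_cube.
rewrite [X in X * _](lebesgue_measure_itv `[(- M)%R, M]) /= lte_fin IH exprS -EFinB opprK -mulr2n.
case: ltP => [_|]; first by rewrite -EFinM.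
rewrite -subr_le0 opprK => M2.
by rewrite (_ : M = 0%R) ?mul0rn ?mul0r ?mul0e//; lra.
Qed.

End cubes.

(** * Translation invariance and the integral of a partial derivative *)

Section integration_rV.
Context {R : realType} {n : nat}.
Notation mu := (lebesgue_rV R n).
Implicit Types (f g : 'rV[R]_n -> R) (b : 'rV[R]_n).

Lemma lebesgue_translate b A : measurable A ->
  mu ((fun x => x + b) @^-1` A) = mu A.
Proof.
move=> mA; rewrite [RHS](lebesgue_affine b (@ltr01 R) mA) expr1n mul1e.
by congr (mu _); apply/funext => x; rewrite /preimage/= scale1r.
Qed.

Lemma measurable_translate b : measurable_fun setT (fun x : 'rV[R]_n => x + b).
Proof.
apply: (eq_measurable_fun (fun x : 'rV[R]_n => 1 *: x + b)).
  by move=> x _; rewrite scale1r.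
exact: measurable_affine.
Qed.

Lemma integrable_translate b f : mu.-integrable setT (EFin \o f) ->
  mu.-integrable setT (EFin \o (fun x => f (x + b))).
Proof.
move=> intf; have mt := measurable_translate b.
have mf : measurable_fun setT f by apply/measurable_EFinP; exact: measurable_int intf.
apply/integrableP; split.
  by apply/measurable_EFinP; apply: (measurableT_comp mf).
have /integrableP[_] := intf; apply: le_lt_trans.
rewrite -(@ge0_integral_pushforward _ _ _ _ _ _ mt mu setT (fun x => `|(f x)%:E|%E))//.
  rewrite le_eqVlt; apply/orP; left; apply/eqP.
  by apply: eq_measure_integral => A mA _; first [exact: lebesgue_translate|exact/esym/lebesgue_translate].
by apply/measurable_EFinP; apply: measurableT_comp.
Qed.

Lemma Rintegral_translate b f : mu.-integrable setT (EFin \o f) ->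
  \int[mu]_x f (x + b) = \int[mu]_x f x.
Proof.
move=> intf; rewrite /Rintegral; congr fine.
have mt := measurable_translate b.
have mf : measurable_fun setT f by apply/measurable_EFinP; exact: measurable_int intf.
have intf' := integrable_translate b intf.
rewrite -(@integral_pushforward _ _ _ _ _ _ mt mu setT (EFin \o f))//;
  last exact: measurableT_comp.
by apply: eq_measure_integral => A mA _; first [exact: lebesgue_translate|exact/esym/lebesgue_translate].
Qed.

Lemma bounded_support_integrable f (M C : R) : measurable_fun setT f ->
  (forall x, `|f x| <= C) -> (forall x, f x != 0 -> cube M x) ->
  mu.-integrable setT (EFin \o f).
Proof.
move=> mf fC fM.
have -> : EFin \o f = (EFin \o f) \_ (cube M).
  apply/funext => x; rewrite patchE; case: ifPn => // /negP; rewrite inE => nx.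
  by congr EFin; apply/eqP; apply: contra_notT nx; exact: fM.
have mc : measurable (@cube R n M) by exact: measurable_cube.
apply/(integrable_mkcond _ mc).
apply: measurable_bounded_integrable; first exact: measurable_cube.
- apply: (@le_lt_trans _ _ (mu (cube `|M|))).
    apply: le_measure; rewrite ?inE; [exact: measurable_cube..|].
    by move=> x h i; exact: le_trans (h i) (ler_norm _).
  by rewrite (lebesgue_cube _ (normr_ge0 M)) ltry.
- exact: measurable_funTS.
- exists C; split; first exact: num_real.
  by move=> y Cy x _; exact: le_trans (fC x) (ltW Cy).
Qed.

Lemma test_fun0_continuous f : test_fun0 f -> continuous f.
Proof. by move=> tf x; apply: differentiable_continuous; exact: test_fun0_diff. Qed.

Lemma test_fun0_measurable f : test_fun0 f -> measurable_fun setT f.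
Proof. by move=> tf; apply: continuous_measurable_rV; exact: test_fun0_continuous. Qed.

Lemma test_fun0_bounded f : test_fun0 f -> exists2 C : R, 0 < C & forall x, `|f x| <= C.
Proof.
move=> tf; have /test_fun0P[_ [a [b [a0 ab fab]]]] := tf.
have [A0|/set0P An0] := eqVneq (@annulus R n a b) set0.
  exists 1 => // x; rewrite (_ : f x = 0) ?normr0//.
  by apply/eqP; apply/negPn/negP => /fab; rewrite A0.
have fc : {within annulus a b, continuous (fun x => `|f x|)}.
  apply: continuous_subspaceT => x.
  by apply: continuous_comp; [exact: test_fun0_continuous|exact: norm_continuous].
have [c _ cmax] := compact_EVT_max An0 (@compact_annulus R n a b) fc.
exists (`|f c| + 1) => [|x]; first by rewrite ltr_wpDl.
have [->|/fab fx] := eqVneq (f x) 0; first by rewrite normr0 addr_ge0.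
by rewrite (le_trans (cmax x _)) ?inE// lerDl.
Qed.

Lemma annulus_cube (a M : R) : annulus a M `<=` @cube R n M.
Proof. by move=> x /andP[_ xb] i; exact: le_trans (ler_coord_enorm _ _) xb. Qed.

Lemma test_fun0_cube f : test_fun0 f -> exists M : R, forall x, f x != 0 -> cube M x.
Proof.
by move=> /test_fun0P[_ [a [b [_ _ fab]]]]; exists b => x /fab; exact: annulus_cube.
Qed.

Lemma test_fun0_integrable f : test_fun0 f -> mu.-integrable setT (EFin \o f).
Proof.
move=> tf; have [C _ fC] := test_fun0_bounded tf; have [M fM] := test_fun0_cube tf.
by apply: bounded_support_integrable fC fM; exact: test_fun0_measurable.
Qed.

Lemma test_fun0_lipschitz i f (C h : R) (x : 'rV[R]_n) : test_fun0 f ->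
  (forall y, `|partial i f y| <= C) -> 0 < h ->
  `|f (h *: delta_mx 0 i + x) - f x| <= C * h.
Proof.
move=> tf fC h0; pose e : 'rV[R]_n := delta_mx 0 i.
pose F (t : R) := f (t *: e + x).
have dF (t : R) : is_derive t (1 : R) (F : R -> R) (partial i f (t *: e + x)).
  have df := test_fun0_diff (t *: e + x) tf.
  have da : differentiable (fun t : R => t *: e + x) t.
    by apply: differentiableD => //; apply: differentiableZl.
  split; first by apply/derivable1_diffP; exact: differentiable_comp.
  rewrite /partial /derive.
  suff -> : (fun s : R => s^-1 *: ((F \o shift t) (s *: 1) - F t)) =
    (fun s : R => s^-1 *: ((f \o shift (t *: e + x)) (s *: e) - f (t *: e + x))) by [].
  apply/funext => s.
  by rewrite /F /= -/e [s%:A]mulr1 scalerDl addrA.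
have [|c _] := MVT h0 (fun t _ => dF t).
  apply: continuous_subspaceT => t.
  by apply/differentiable_continuous/derivable1_diffP; case: (dF t).
rewrite /F scale0r add0r subr0 => ->.
by rewrite normrM (gtr0_norm h0) ler_wpM2r// ltW.
Qed.

Lemma test_fun0_quotient_cvg i f (x : 'rV[R]_n) : test_fun0 f ->
  (fun k : nat => k.+1%:R * (f (k.+1%:R^-1 *: delta_mx 0 i + x) - f x)) @ \oo -->
  partial i f x.
Proof.
move=> tf; have df : derivable f x (delta_mx 0 i).
  by apply: diff_derivable; exact: test_fun0_diff.
pose h (k : nat) : R := k.+1%:R^-1.
have h0 : h @ \oo --> 0^'.
  move=> A; rewrite /dnbhs /within /= => A0.
  have hc : h @ \oo --> (0 : R) by exact: cvg_harmonic.
  have hA : \forall k \near \oo, h k != 0 -> A (h k) by exact: (hc _ A0).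
  suff : \forall k \near \oo, A (h k) by [].
  by apply: filterS hA => k; apply; apply: invr_neq0; rewrite pnatr_eq0.
have := @cvg_comp _ _ _ h (fun s : R => s^-1 *: (f (s *: delta_mx 0 i + x) - f x))
  _ _ _ h0 df.
by apply: cvg_trans; apply: near_eq_cvg; apply: nearW => k /=; rewrite /h invrK.
Qed.

(** By translation invariance every difference quotient has integral zero. The quotients converge to
    the derivative, dominated by its bound C on a cube that exceeds the support by 1, the largest
    increment used. Every integration by parts below rests on this. *)
Lemma Rintegral_partial i f : test_fun0 f -> \int[mu]_x partial i f x = 0.
Proof.
move=> tf.
pose e : 'rV[R]_n := delta_mx 0 i.
pose q (k : nat) (x : 'rV[R]_n) : R := k.+1%:R * (f (x + k.+1%:R^-1 *: e) - f x).
have [C C0 fC] := test_fun0_bounded (test_fun0_partial i tf).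
have [M fM] := test_fun0_cube tf.
have mf := test_fun0_measurable tf.
have mft (k : nat) : measurable_fun setT (fun x : 'rV[R]_n => f (x + k.+1%:R^-1 *: e)).
  by apply: (measurableT_comp mf); exact: measurable_translate.
have mq k : measurable_fun setT (q k).
  by apply: measurable_funM => //; exact: measurable_funB.
pose G (x : 'rV[R]_n) : R := C * \1_(cube (M + 1)) x.
have mc : measurable (@cube R n (M + 1)) by exact: measurable_cube.
have iG : mu.-integrable setT (EFin \o G).
  apply: (@bounded_support_integrable _ (M + 1) C).
  - by apply: measurable_funM => //; apply: measurable_indic; exact: mc.
  - move=> x; rewrite normrM gtr0_norm// indicE.
    by case: (x \in _); rewrite ?normr1 ?normr0 ?mulr1 ?mulr0// ltW.
  - move=> x; rewrite /G indicE; case: (pselect (cube (M + 1) x)) => // nx.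
    by rewrite memNset// mulr0 eqxx.
have qG k x : `|q k x| <= G x.
  rewrite /G indicE; case: (pselect (cube (M + 1) x)) => [cx|nx].
    rewrite mem_set// mulr1 /q normrM ger0_norm//.
    have k0 : 0 < k.+1%:R^-1 :> R by rewrite invr_gt0.
    have h := test_fun0_lipschitz x tf fC k0.
    by rewrite mulrC -ler_pdivlMr// [x + _]addrC.
  rewrite memNset// mulr0 normr_le0; apply/eqP.
  have f0 (y : 'rV[R]_n) : (forall j, `|x 0 j - y 0 j| <= 1) -> f y = 0.
    move=> xy; apply/eqP; apply: contra_notT nx => /fM fy j.
    rewrite -[x 0 j](subrK (y 0 j)) (le_trans (ler_normD _ _))// addrC.
    by apply: lerD.
  rewrite /q !f0 ?subrr ?mulr0//.
    by move=> j; rewrite subrr normr0.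
  move=> j; rewrite !mxE opprD addNKr normrN eqxx /=.
  rewrite normrM gtr0_norm ?invr_gt0//.
  apply: mulr_ile1; rewrite ?invr_ge0// ?invf_le1 ?ler1n//.
  by case: (j == i); rewrite ?normr1 ?normr0.
have [||//|//|_ _ h] := @dominated_convergence _ _ _ mu setT measurableT
  (fun k x => (q k x)%:E) (fun x => (partial i f x)%:E) (EFin \o G)
  (fun k => (measurable_EFinP _ _).2 (mq k)).
- by apply/measurable_EFinP; apply: test_fun0_measurable; exact: test_fun0_partial.
- apply: aeW => x _; apply/fine_cvgP; split; first exact: nearW.
  have := @test_fun0_quotient_cvg i f x tf.
  by apply: cvg_trans; apply: near_eq_cvg; apply: nearW => k /=; rewrite /q [in RHS](addrC x).
- by apply: aeW => x k _ /=; rewrite lee_fin.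
have intf := test_fun0_integrable tf.
have q0 k : (\int[mu]_x (q k x)%:E = 0)%E.
  have it := integrable_translate (k.+1%:R^-1 *: e) intf.
  have id : mu.-integrable setT
      (EFin \o (fun x : 'rV[R]_n => f (x + k.+1%:R^-1 *: e) - f x)).
    by have := integrableB measurableT it intf; apply: eq_integrable.
  have iq : mu.-integrable setT (EFin \o q k).
    by have := integrableZl measurableT k.+1%:R id; apply: eq_integrable.
  rewrite -[LHS]fineK; last exact: integrable_fin_num.
  rewrite -/(Rintegral _ _ _) /q RintegralZl//.
  by rewrite RintegralB// Rintegral_translate// subrr mulr0.
move: h; rewrite (_ : [sequence _]_k = cst 0%E); last first.
  by apply/funext => k; exact: q0.
by move=> h; rewrite /Rintegral -(cvg_lim _ h)// lim_cst.
Qed.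

End integration_rV.

(** * Hardy and Rellich inequalities *)

Section hardy_rellich.
Context {R : realType} {n : nat}.
Notation mu := (lebesgue_rV R n).
Implicit Types (f g F phi : 'rV[R]_n -> R) (x : 'rV[R]_n) (a : R).

Definition Int f : R := \int[mu]_x f x.

Definition xgrad f x : R := \sum_i x 0 i * partial i f x.
Definition grad2 f x : R := \sum_i partial i f x ^+ 2.

Lemma test_fun0_mul f g : test_fun0 f -> test_fun0 g ->
  test_fun0 (fun x => f x * g x).
Proof. by move=> tf; apply: test_fun0M; exact: test_fun0_smooth. Qed.

Lemma test_fun0_sqr f : test_fun0 f -> test_fun0 (fun x => f x ^+ 2).
Proof. by move=> tf; exact: (test_fun0_mul tf tf). Qed.

Lemma test_fun0_xgrad f : test_fun0 f -> test_fun0 (xgrad f).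
Proof.
move=> tf; apply: test_fun0_sum => i _; apply: test_fun0M.
  by apply: smooth_on_coord; exact: open_D0.
exact: test_fun0_partial.
Qed.

Lemma test_fun0_grad2 f : test_fun0 f -> test_fun0 (grad2 f).
Proof.
by move=> tf; apply: test_fun0_sum => i _; apply: test_fun0_sqr; exact: test_fun0_partial.
Qed.

Lemma test_fun0_W a f : test_fun0 f -> test_fun0 (fun x => W a x * f x).
Proof. by apply: test_fun0M; exact: W_smooth. Qed.

Lemma IntD f g : test_fun0 f -> test_fun0 g ->
  Int (fun x => f x + g x) = Int f + Int g.
Proof. by move=> tf tg; rewrite /Int RintegralD//; exact: test_fun0_integrable. Qed.

Lemma IntZ (c : R) f : test_fun0 f -> Int (fun x => c * f x) = c * Int f.
Proof. by move=> tf; rewrite /Int RintegralZl//; exact: test_fun0_integrable. Qed.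

Lemma Int_le f g : test_fun0 f -> test_fun0 g -> (forall x, f x <= g x) ->
  Int f <= Int g.
Proof. by move=> tf tg fg; apply: le_Rintegral => //; exact: test_fun0_integrable. Qed.

Lemma Int_ge0 f : (forall x, 0 <= f x) -> 0 <= Int f.
Proof. by move=> f0; apply: Rintegral_ge0 => x _; exact: f0. Qed.

Lemma eq_Int f g : (forall x, f x = g x) -> Int f = Int g.
Proof. by move=> fg; congr Int; exact/funext. Qed.

Lemma Int0 : Int (fun=> 0) = 0.
Proof. by rewrite /Int /Rintegral integral0. Qed.

Lemma Int_sum (I : Type) (r : seq I) (G : I -> 'rV[R]_n -> R) :
  (forall i, test_fun0 (G i)) ->
  Int (fun x => \sum_(i <- r) G i x) = \sum_(i <- r) Int (G i).
Proof.
move=> tG; elim: r => [|i r IH].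
  by rewrite big_nil -[RHS]Int0; apply: eq_Int => x; rewrite big_nil.
rewrite big_cons -IH -IntD//; last exact: test_fun0_sum.
by apply: eq_Int => x; rewrite big_cons.
Qed.

Lemma Int_div (G : 'I_n -> 'rV[R]_n -> R) : (forall i, test_fun0 (G i)) ->
  Int (fun x => \sum_i partial i (G i) x) = 0.
Proof.
move=> tG; rewrite Int_sum => [|i]; last exact: test_fun0_partial.
by rewrite big1// => i _; exact: Rintegral_partial.
Qed.

Lemma sum_partialM0 F (G : 'I_n -> 'rV[R]_n -> R) x : smooth_on D0 F ->
  (forall i, test_fun0 (G i)) ->
  \sum_i partial i (fun y => F y * G i y) x =
  \sum_i partial i F x * G i x + F x * \sum_i partial i (G i) x.
Proof.
move=> sF tG; rewrite mulr_sumr -big_split/=.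
by apply: eq_bigr => i _; exact: partialM0.
Qed.

(** The integral of the divergence of the field F f grad g is zero. *)
Lemma Int_green F f g : smooth_on D0 F -> test_fun0 f -> test_fun0 g ->
  Int (fun x => F x * (f x * laplacian g x)) =
  - Int (fun x => \sum_i partial i F x * (f x * partial i g x))
  - Int (fun x => F x * \sum_i partial i f x * partial i g x).
Proof.
move=> sF tf tg.
have tfp i : test_fun0 (fun x => f x * partial i g x).
  by apply: test_fun0_mul => //; exact: test_fun0_partial.
have := Int_div (fun i => test_fun0M sF (tfp i)).
have t1 : test_fun0 (fun x => \sum_i partial i F x * (f x * partial i g x)).
  apply: test_fun0_sum => i _; apply: test_fun0M => //.
  by apply: smooth_on_partial => //; exact: open_D0.
have t2 : test_fun0 (fun x => F x * \sum_i partial i f x * partial i g x).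
  apply: test_fun0M => //; apply: test_fun0_sum => i _.
  by apply: test_fun0_mul; exact: test_fun0_partial.
have t3 : test_fun0 (fun x => F x * (f x * laplacian g x)).
  by apply: test_fun0M => //; apply: test_fun0_mul => //; exact: test_fun0_laplacian.
have -> : Int (fun x => \sum_i partial i (fun y => F y * (f y * partial i g y)) x) =
  Int (fun x => \sum_i partial i F x * (f x * partial i g x) +
    (F x * (\sum_i partial i f x * partial i g x) + F x * (f x * laplacian g x))).
  apply: eq_Int => x; rewrite sum_partialM0//; congr (_ + _).
  rewrite -mulrDr; congr (_ * _); rewrite /laplacian mulr_sumr -big_split/=.
  apply: eq_bigr => i _; apply: partialM0; last exact: test_fun0_partial.
  exact: test_fun0_smooth.
rewrite IntD//; last exact: test_fun0D.
by rewrite IntD// => h; lra.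
Qed.

Lemma Int_green1 f g : test_fun0 f -> test_fun0 g ->
  Int (fun x => f x * laplacian g x) = - Int (fun x => \sum_i partial i f x * partial i g x).
Proof.
move=> tf tg; have s1 : smooth_on D0 (fun _ : 'rV[R]_n => 1).
  by apply: smooth_on_cst; exact: open_D0.
have := Int_green s1 tf tg.
under [X in Int X = _]funext do rewrite mul1r.
move=> ->; under [X in _ - Int X = _]funext do rewrite mul1r.
under [X in - Int X - _ = _]funext do
  (rewrite big1; last by move=> i _; rewrite partial_cst mul0r).
by rewrite Int0 oppr0 add0r.
Qed.

Lemma Int_laplacian_sym f g : test_fun0 f -> test_fun0 g ->
  Int (fun x => f x * laplacian g x) = Int (fun x => laplacian f x * g x).
Proof.
move=> tf tg; rewrite Int_green1//.
transitivity (Int (fun x => g x * laplacian f x)); last first.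
  by apply: eq_Int => x; rewrite mulrC.
transitivity (- Int (fun x => \sum_i partial i g x * partial i f x)); last first.
  exact/esym/Int_green1.
by congr (- _); apply: eq_Int => x; apply: eq_bigr => i _; rewrite mulrC.
Qed.

Lemma Int_partial_byparts i f g : test_fun0 f -> test_fun0 g ->
  Int (fun x => f x * partial i g x) = - Int (fun x => partial i f x * g x).
Proof.
move=> tf tg.
have := Rintegral_partial i (test_fun0_mul tf tg).
rewrite -/(Int _).
have -> : Int (partial i (fun x => f x * g x)) =
  Int (fun x => partial i f x * g x + f x * partial i g x).
  by apply: eq_Int => x; apply: partialM0 => //; exact: test_fun0_smooth.
rewrite IntD; first last.
- by apply: test_fun0_mul => //; exact: test_fun0_partial.
- by apply: test_fun0_mul => //; exact: test_fun0_partial.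
by move=> h; lra.
Qed.

Lemma xgrad_W a x : x != 0 -> xgrad (W a) x = a * W a x.
Proof.
move=> x0; rewrite /xgrad.
transitivity (a * W (a - 2) x * sqn x).
  rewrite /sqn mulr_sumr; apply: eq_bigr => i _; rewrite partial_W// expr2; ring.
by rewrite -W2 -mulrA -WD// subrK.
Qed.

(** The integrand is the divergence of the field F f^2 x. *)
Lemma Int_xgrad F f : smooth_on D0 F -> test_fun0 f ->
  Int (fun x => (n%:R * F x + xgrad F x) * f x ^+ 2 + 2 * (F x * (f x * xgrad f x))) = 0.
Proof.
move=> sF tf; have oD := @open_D0 R n; have t2 := test_fun0_sqr tf.
have tG i : test_fun0 (fun x => (x 0 i * F x) * f x ^+ 2).
  by apply: test_fun0M => //; apply: smooth_onM => //; exact: smooth_on_coord.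
rewrite -(Int_div tG); apply: eq_Int => x.
have [x0|x0] := eqVneq x 0.
  rewrite x0 (test_fun0_vanish0 tf) expr0n mulr0 mul0r !mulr0 addr0 big1// => i _.
  by apply: test_fun0_vanish0; exact: test_fun0_partial.
rewrite mulrDl -mulrA -[n in n%:R]card_ord -sumr_const mulr_suml !mulr_suml.
rewrite /xgrad !mulr_sumr -!big_split/=; apply: eq_bigr => i _.
have sx : smooth_on D0 (fun y => y 0 i * F y).
  by apply: smooth_onM => //; exact: smooth_on_coord.
have df := test_fun0_diff x tf.
rewrite partialM0// partialM ?partial_coord ?eqxx//; first last.
- exact: (Ck_diff (sF 0%N)).
- exact: differentiable_coord.
rewrite (_ : partial i (fun y => f y ^+ 2) x = 2 * f x * partial i f x); first by rewrite -[true%:R]/(1 : R); ring.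
by rewrite -[LHS]/(partial i (fun y => f y * f y) x) partialM//; ring.
Qed.

End hardy_rellich.

Section hardy_rellich_inequalities.
Context {R : realType} {n : nat}.
Variables (a gamma : R).
Hypotheses (gammaE : gamma * 2 = n%:R - 4 + a) (gamma0 : 0 < gamma).
Implicit Types (phi : 'rV[R]_n -> R) (x : 'rV[R]_n).

(** Quadratic forms in the derivatives of order 0, 1 and 2. The weights are matched so that all
    three scale alike under dilations, which is why Hardy and Rellich can compare them. *)
Definition wA phi : R := Int (fun x => W (a - 4) x * phi x ^+ 2).
Definition wB phi : R := Int (fun x => W (a - 2) x * grad2 phi x).
Definition wD phi : R := Int (fun x => W a x * laplacian phi x ^+ 2).
Let J phi : R := Int (fun x => W (a - 4) x * (phi x * xgrad phi x)).

Lemma wA_ge0 phi : 0 <= wA phi.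
Proof. by apply: Int_ge0 => x; rewrite mulr_ge0 ?W_ge0 ?sqr_ge0. Qed.

Lemma grad2_ge0 phi x : 0 <= grad2 phi x.
Proof. by apply: sumr_ge0 => i _; exact: sqr_ge0. Qed.

Lemma wB_ge0 phi : 0 <= wB phi.
Proof. by apply: Int_ge0 => x; rewrite mulr_ge0 ?W_ge0 ?grad2_ge0. Qed.

Lemma wD_ge0 phi : 0 <= wD phi.
Proof. by apply: Int_ge0 => x; rewrite mulr_ge0 ?W_ge0 ?sqr_ge0. Qed.

(** Cauchy-Schwarz for x and grad phi, from expanding the square of the vector |x|^2 grad phi - (x .
    grad phi) x. *)
Lemma xgrad_sqr phi x : x != 0 -> xgrad phi x ^+ 2 <= sqn x * grad2 phi x.
Proof.
move=> x0; have s0 := sqn_gt0 x0.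
set X := xgrad phi x; set s := sqn x; set g := grad2 phi x.
have : 0 <= \sum_i (s * partial i phi x - X * x 0 i) ^+ 2.
  by apply: sumr_ge0 => i _; exact: sqr_ge0.
have -> : \sum_i (s * partial i phi x - X * x 0 i) ^+ 2 = s * (s * g - X ^+ 2).
  rewrite (eq_bigr (fun i => s ^+ 2 * partial i phi x ^+ 2 -
    2 * s * X * (x 0 i * partial i phi x) + X ^+ 2 * x 0 i ^+ 2)); last first.
    by move=> i _; ring.
  rewrite big_split/= sumrB -!mulr_sumr -/(grad2 phi x) -/(xgrad phi x) -/(sqn x).
  by rewrite -/s -/g -/X; ring.
by rewrite pmulr_rge0// subr_ge0.
Qed.

Lemma W2E x : x != 0 -> W (a - 2) x = W (a - 4) x * sqn x.
Proof. by move=> x0; rewrite -W2 -WD//; congr (W _ x); ring. Qed.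

Lemma W4E x : x != 0 -> W a x = W (a - 4) x * sqn x ^+ 2.
Proof. by move=> x0; rewrite expr2 mulrA -W2E// -W2 -WD//; congr (W _ x); ring. Qed.

Lemma test_fun0_wA phi : test_fun0 phi -> test_fun0 (fun x => W (a - 4) x * phi x ^+ 2).
Proof. by move=> tf; apply: test_fun0_W; exact: test_fun0_sqr. Qed.

Lemma test_fun0_wB phi : test_fun0 phi -> test_fun0 (fun x => W (a - 2) x * grad2 phi x).
Proof. by move=> tf; apply: test_fun0_W; exact: test_fun0_grad2. Qed.

Lemma test_fun0_wD phi : test_fun0 phi ->
  test_fun0 (fun x => W a x * laplacian phi x ^+ 2).
Proof.
by move=> tf; apply: test_fun0_W; apply: test_fun0_sqr; exact: test_fun0_laplacian.
Qed.

Let tJ phi : test_fun0 phi -> test_fun0 (fun x => W (a - 4) x * (phi x * xgrad phi x)).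
Proof.
by move=> tf; apply: test_fun0_W; apply: test_fun0_mul => //; exact: test_fun0_xgrad.
Qed.

(** This is [Int_xgrad] for F = |x|^(a-4), homogeneous of degree a - 4, with n + (a - 4) = 2
    gamma. *)
Let JE phi : test_fun0 phi -> J phi = - (gamma * wA phi).
Proof.
move=> tf.
have tA := test_fun0_wA tf; have tj := tJ tf.
have : Int (fun x => (gamma * 2) * (W (a - 4) x * phi x ^+ 2) +
                     2 * (W (a - 4) x * (phi x * xgrad phi x))) = 0.
  rewrite -(Int_xgrad (@W_smooth R n (a - 4)) tf); apply: eq_Int => x.
  have [->|x0] := eqVneq x 0; last by rewrite xgrad_W// gammaE; ring.
  by rewrite (test_fun0_vanish0 tf) expr0n/= mul0r !mulr0.
rewrite IntD; [|exact: test_fun0Z|exact: test_fun0Z].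
by rewrite !IntZ// -/(wA phi) -/(J phi); lra.
Qed.

(** Expand the nonnegative integral of |x|^(a-4) (x . grad phi + gamma phi)^2: its first term is at
    most [wB], and by [JE] the cross term equals -2 gamma^2 [wA]. *)
Lemma hardy phi : test_fun0 phi -> gamma ^+ 2 * wA phi <= wB phi.
Proof.
move=> tf; have tA := test_fun0_wA tf; have tB := test_fun0_wB tf; have tj := tJ tf.
have : 0 <= Int (fun x => W (a - 2) x * grad2 phi x +
   ((2 * gamma) * (W (a - 4) x * (phi x * xgrad phi x)) +
    gamma ^+ 2 * (W (a - 4) x * phi x ^+ 2))).
  apply: Int_ge0 => x; have [->|x0] := eqVneq x 0.
    by rewrite (test_fun0_vanish0 tf) expr0n/= mul0r !mulr0 !addr0
      mulr_ge0 ?W_ge0 ?grad2_ge0.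
  rewrite W2E// (_ : _ + _ = W (a - 4) x * (sqn x * grad2 phi x +
    2 * gamma * phi x * xgrad phi x + gamma ^+ 2 * phi x ^+ 2)); last ring.
  apply: mulr_ge0; first exact: W_ge0.
  have := xgrad_sqr phi x0; have := sqr_ge0 (xgrad phi x + gamma * phi x); nra.
have tz1 := test_fun0Z (2 * gamma) tj; have tz2 := test_fun0Z (gamma ^+ 2) tA.
rewrite IntD//; last exact: test_fun0D.
rewrite IntD// !IntZ// -/(wA phi) -/(wB phi) -/(J phi) JE//.
by rewrite expr2; nra.
Qed.

(** By Green's formula and [JE] the integral of -|x|^(a-2) phi Delta phi is [wB] + (2 - a) gamma
    [wA], whose second term is nonnegative for a <= 2. Young's inequality bounds that integral by
    (gamma^2 [wA] + gamma^-2 [wD]) / 2, and Hardy absorbs the first half into [wB]. *)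
Lemma rellich phi : a <= 2 -> test_fun0 phi -> gamma ^+ 2 * wB phi <= wD phi.
Proof.
move=> a2 tf; have tA := test_fun0_wA tf; have tB := test_fun0_wB tf.
have tD := test_fun0_wD tf; have tj := tJ tf.
have tl := test_fun0_laplacian tf.
have tK : test_fun0 (fun x => W (a - 2) x * (phi x * laplacian phi x)).
  by apply: test_fun0_W; exact: test_fun0_mul.
have K : Int (fun x => W (a - 2) x * (phi x * laplacian phi x)) =
    - ((a - 2) * J phi) - wB phi.
  rewrite Int_green//; last exact: W_smooth.
  congr (- _ - _); rewrite -IntZ//; apply: eq_Int => x.
  have [->|x0] := eqVneq x 0.
    rewrite (test_fun0_vanish0 tf) big1 ?mul0r ?mulr0// => i _.
    by rewrite mul0r mulr0.
  rewrite /xgrad !mulr_sumr; apply: eq_bigr => i _; rewrite partial_W//.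
  by rewrite (_ : a - 2 - 2 = a - 4); ring.
have g2 : 0 < gamma ^+ 2 by rewrite exprn_gt0.
have : - Int (fun x => W (a - 2) x * (phi x * laplacian phi x)) <=
   (gamma ^+ 2 / 2) * wA phi + (gamma ^- 2 / 2) * wD phi.
  rewrite -!IntZ// -IntD//; [|exact: test_fun0Z|exact: test_fun0Z].
  rewrite -[leLHS]mulN1r -IntZ//; apply: Int_le.
  - exact: test_fun0Z.
  - by apply: test_fun0D; exact: test_fun0Z.
  move=> x; have [->|x0] := eqVneq x 0.
    rewrite (test_fun0_vanish0 tf) (test_fun0_vanish0 tl) mul0r expr0n/=.
    by rewrite !mulr0 addr0.
  rewrite W2E// W4E//.
  set w := W _ x; set s := sqn x; set p := phi x; set l := laplacian phi x.
  have w0 : 0 <= w by exact: W_ge0.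
  rewrite -subr_ge0 (_ : _ - _ = w / 2 * (gamma * p + s * l / gamma) ^+ 2).
    by rewrite mulr_ge0 ?sqr_ge0// divr_ge0.
  by field; rewrite gt_eqF.
rewrite K JE// => h.
have hA := hardy tf; have A0 := wA_ge0 phi.
have h1 : wB phi <= gamma ^- 2 * wD phi.
  have : 0 <= (2 - a) * (gamma * wA phi) by rewrite !mulr_ge0 ?subr_ge0// ltW.
  rewrite (mulrAC (gamma ^- 2)) in h; move: h hA.
  by set u := gamma ^- 2 * wD phi; set v := gamma * wA phi; lra.
by rewrite -ler_pdivlMl.
Qed.

(** L times the derivative of atan((t - m)/L) at t = |x|^n: a weight concentrated where |x|^n is
    within distance of order L from m. *)
Definition bump (m L : R) x : R := (1 + ((W n%:R x - m) / L) ^+ 2)^-1.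
Let P (m L : R) x : R := atan ((W n%:R x - m) / L).

Let arg_smooth m L : smooth_on D0 (fun x : 'rV[R]_n => (W n%:R x - m) / L).
Proof.
have oD := @open_D0 R n.
apply: smooth_onM => //; last exact: smooth_on_cst.
apply: smooth_onB => //; first exact: W_smooth.
exact: smooth_on_cst.
Qed.

Let partial_P m L i x : x != 0 ->
  partial i (P m L) x = bump m L x * (n%:R * x 0 i * W (n%:R - 2) x / L).
Proof.
move=> x0; have oD := @open_D0 R n.
rewrite /P (partial_comp _ (Ck_diff (arg_smooth m L 0%N) x0) (is_derive1_atan _)).
congr (_ * _).
have dW : differentiable (W n%:R) x by exact: (Ck_diff (W_smooth n%:R 0%N) x0).
have dWm : differentiable (fun y => W n%:R y - m) x by exact: differentiableB.
rewrite (partialM _ dWm (differentiable_cst _ _)).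
rewrite (partialB _ dW (differentiable_cst _ _)) partial_W//.
by rewrite !partial_cst mulr0 subr0 addr0.
Qed.

Let bump_smooth m L : smooth_on D0 (bump m L).
Proof.
have oD := @open_D0 R n; have sa := arg_smooth m L.
apply: (@smooth_on_ext _ _ _ oD (fun x => (1 + ((W n%:R x - m) / L) ^+ 2) `^ (- 1))).
  by move=> x x0; rewrite powRN powRr1// addr_ge0// sqr_ge0.
apply: smooth_on_powR => //.
  by move=> x _; rewrite ltr_pwDl// sqr_ge0.
by apply: smooth_onD => //; [exact: smooth_on_cst|exact: smooth_onM].
Qed.

Let P_smooth m L : smooth_on D0 (P m L).
Proof.
have oD := @open_D0 R n.
apply: (@smooth_on_intro _ _ _ oD _
  (fun i x => bump m L x * (n%:R * x 0 i * W (n%:R - 2) x / L))).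
- move=> x x0.
  exact: differentiable_comp1 (Ck_diff (arg_smooth m L 0%N) x0) (is_derive1_atan _).
- by move=> i x x0; exact: partial_P.
- move=> i; apply: smooth_onM => //; apply: smooth_onM => //; last exact: smooth_on_cst.
  apply: smooth_onM => //; last exact: W_smooth.
  by apply: smooth_onM => //; [exact: smooth_on_cst|exact: smooth_on_coord].
Qed.

Lemma bump_ge0 m L x : 0 <= bump m L x.
Proof. by rewrite invr_ge0 addr_ge0// sqr_ge0. Qed.

Lemma test_fun0_bump m L phi : test_fun0 phi ->
  test_fun0 (fun x => W (a - 4 + n%:R) x * bump m L x * phi x ^+ 2).
Proof.
move=> tf; apply: test_fun0M; last exact: test_fun0_sqr.
by apply: smooth_onM; [exact: open_D0|exact: W_smooth|].
Qed.

(* Integrate by parts against the field |x|^(a-4) atan((|x|^n - m)/L) x. *)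
Lemma radial_slab m L phi : (0 < n)%N -> 0 < L -> test_fun0 phi ->
  Int (fun x => W (a - 4 + n%:R) x * bump m L x * phi x ^+ 2) <=
  2 * pi * L / (n%:R * gamma) * wB phi.
Proof.
move=> n0 L0 tf; have oD := @open_D0 R n.
have nR : 0 < n%:R :> R by rewrite ltr0n.
have tA := test_fun0_wA tf; have tB := test_fun0_wB tf; have tj := tJ tf.
have tb := test_fun0_bump m L tf; have sP := P_smooth m L.
have tp : test_fun0 (fun x => P m L x * (2 * gamma * (W (a - 4) x * phi x ^+ 2) +
                     2 * (W (a - 4) x * (phi x * xgrad phi x)))).
  by apply: test_fun0M => //; apply: test_fun0D; exact: test_fun0Z.
have sF : smooth_on D0 (fun x => P m L x * W (a - 4) x).
  by apply: smooth_onM => //; exact: W_smooth.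
have : Int (fun x => n%:R / L * (W (a - 4 + n%:R) x * bump m L x * phi x ^+ 2) +
    P m L x * (2 * gamma * (W (a - 4) x * phi x ^+ 2) +
                     2 * (W (a - 4) x * (phi x * xgrad phi x)))) = 0.
  rewrite -(Int_xgrad sF tf); apply: eq_Int => x.
  have [->|x0] := eqVneq x 0.
    by rewrite (test_fun0_vanish0 tf) expr0n/= !(mul0r, mulr0, addr0).
  have -> : xgrad (fun x => P m L x * W (a - 4) x) x =
      n%:R / L * (W n%:R x * bump m L x) * W (a - 4) x +
      P m L x * ((a - 4) * W (a - 4) x).
    rewrite -xgrad_W// /xgrad.
    rewrite (eq_bigr (fun i => (x 0 i * partial i (P m L) x) * W (a - 4) x +
        P m L x * (x 0 i * partial i (W (a - 4)) x))); last first.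
      move=> i _; rewrite partialM; [ring|exact: (Ck_diff (sP 0%N))|].
      exact: (Ck_diff (W_smooth (a - 4) 0%N)).
    rewrite big_split/= -mulr_suml -mulr_sumr; congr (_ * _ + _).
    transitivity (n%:R / L * (W (n%:R - 2) x * sqn x * bump m L x)); last first.
      by rewrite -W2 -WD// subrK.
    rewrite /sqn mulr_sumr mulr_suml mulr_sumr.
    by apply: eq_bigr => i _; rewrite partial_P//; ring.
  rewrite WD//; move: gammaE => gE.
  have -> : n%:R * (P m L x * W (a - 4) x) = P m L x * ((gamma * 2 - (a - 4)) * W (a - 4) x).
    by rewrite gE; ring.
  by ring.
rewrite IntD//; last exact: test_fun0Z.
rewrite IntZ// => h.
have pi0 := pi_gt0 R.
(* The arctangent is bounded by pi/2, and with X = x . grad phi Young's inequality gives |2 gamma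
   phi^2 + 2 phi X| <= 3 gamma phi^2 + X^2 / gamma. *)
have : - Int (fun x => P m L x * (2 * gamma * (W (a - 4) x * phi x ^+ 2) +
                     2 * (W (a - 4) x * (phi x * xgrad phi x)))) <=
  pi / 2 * (3 * gamma * wA phi + gamma^-1 * wB phi).
  rewrite -!IntZ// -IntD//; [|exact: test_fun0Z|exact: test_fun0Z].
  rewrite -[leLHS]mulN1r -!IntZ//; last by apply: test_fun0D; exact: test_fun0Z.
  apply: Int_le.
  - exact: test_fun0Z.
  - by apply: test_fun0Z; apply: test_fun0D; exact: test_fun0Z.
  move=> x; have [->|x0] := eqVneq x 0.
    rewrite (test_fun0_vanish0 tf) mul0r expr0n/= !mulr0 addr0 !mulr0 add0r.
    by rewrite !mulr_ge0 ?W_ge0 ?grad2_ge0// ?invr_ge0 ltW//.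
  rewrite mulN1r; apply: (le_trans (ler_norm _)); rewrite normrN normrM.
  apply: ler_pM => //.
    by rewrite ler_norml !ltW// ?atan_ltpi2// atan_gtNpi2.
  rewrite W2E//.
  set w := W _ x; set s := sqn x; set p := phi x; set X := xgrad phi x.
  have w0 : 0 <= w by exact: W_ge0.
  have XE : X ^+ 2 <= s * grad2 phi x by exact: xgrad_sqr.
  have -> : 2 * gamma * (w * p ^+ 2) + 2 * (w * (p * X)) =
    w * (2 * gamma * p ^+ 2 + 2 * p * X) by ring.
  rewrite normrM (ger0_norm w0).
  have -> : 3 * gamma * (w * p ^+ 2) + gamma^-1 * (w * s * grad2 phi x) =
    w * (3 * gamma * p ^+ 2 + gamma^-1 * (s * grad2 phi x)) by ring.
  apply: ler_wpM2l => //.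
  have Xg : gamma^-1 * X ^+ 2 <= gamma^-1 * (s * grad2 phi x).
    by rewrite ler_pM2l// invr_gt0.
  have sq (c : R) : gamma * p ^+ 2 + 2 * c * p * X + c ^+ 2 * (gamma^-1 * X ^+ 2) =
    gamma^-1 * (gamma * p + c * X) ^+ 2 by field; rewrite gt_eqF.
  have sq0 (c : R) : 0 <= gamma * p ^+ 2 + 2 * c * p * X + c ^+ 2 * (gamma^-1 * X ^+ 2).
    by rewrite sq mulr_ge0 ?sqr_ge0// invr_ge0 ltW.
  have := sq0 1; have := sq0 (-1); have : 0 <= gamma * p ^+ 2.
    by rewrite mulr_ge0 ?sqr_ge0// ltW.
  rewrite ler_norml sqrrN expr1n.
  move: Xg; set v := gamma^-1 * (s * _); set q := gamma^-1 * X ^+ 2.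
  by move=> h1 h2 h3 h4; apply/andP; split; lra.
move=> h2; have hA := hardy tf.
have hA' : gamma * wA phi <= gamma^-1 * wB phi.
  by rewrite ler_pdivlMl// mulrA -expr2.
set X := Int _ in h *.
(* Hardy turns 3 gamma [wA] into 3 [wB] / gamma; with the remaining term this makes the factor 4. *)
have h3 : n%:R / L * X <= pi / 2 * (4 * (gamma^-1 * wB phi)).
  apply: (@le_trans _ _ (pi / 2 * (3 * gamma * wA phi + gamma^-1 * wB phi))); first lra.
  by apply: ler_wpM2l; [rewrite divr_ge0// ltW|rewrite -mulrA; lra].
have -> : 2 * pi * L / (n%:R * gamma) * wB phi =
   (n%:R / L)^-1 * (pi / 2 * (4 * (gamma^-1 * wB phi))).
  by field; rewrite !gt_eqF.
by rewrite ler_pdivlMl// divr_gt0.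
Qed.

End hardy_rellich_inequalities.

(** * Fatou and Riesz-Fischer lemmas *)

Section L2_completeness.
Local Open Scope ereal_scope.
Context d (T : measurableType d) (R : realType) (mu : {measure set T -> \bar R}).

Lemma limn_einf_le (u : (\bar R)^nat) c :
  (\forall k \near \oo, u k <= c) -> limn_einf u <= c.
Proof.
move=> uc; rewrite limn_einf_lim; apply: lime_le; first exact: is_cvg_einfs.
apply: filterS uc => k; apply: le_trans.
by apply: ereal_inf_lbound; exists k => /=.
Qed.

Lemma fatou_ae (f_ : (T -> \bar R)^nat) (f : T -> \bar R) c :
  (forall k, measurable_fun setT (f_ k)) -> measurable_fun setT f ->
  (forall k x, 0 <= f_ k x) -> (forall x, 0 <= f x) ->
  {ae mu, forall x, f_ ^~ x @ \oo --> f x} ->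
  (\forall k \near \oo, \int[mu]_x f_ k x <= c) -> \int[mu]_x f x <= c.
Proof.
move=> mf_ mf f_0 f0 [N [mN N0 NP]] fc.
rewrite (ge0_negligible_integral mN)// setTD.
have mCN : measurable (~` N) by exact: measurableC.
rewrite (eq_integral (fun x => limn_einf (f_ ^~ x))); last first.
  move=> x; rewrite inE => Nx.
  have fx : f_ ^~ x @ \oo --> f x by apply: contrapT => /NP.
  by rewrite (is_cvg_limn_einfE (cvgP _ fx)) (cvg_lim _ fx).
apply: le_trans (fatou _ _ _ _) _ => //; first by move=> k; exact: measurable_funTS.
apply: limn_einf_le; apply: filterS fc => k; apply: le_trans.
exact: ge0_subset_integral.
Qed.

(** Along the subsequence s the increments d_j have squared norm below 4^-j, so the sum of 2^j d_j^2
    is integrable and hence finite almost everywhere. There |d_j| <= (2^-j + 2^j d_j^2) / 2 makes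
    the increments summable. The subsequence is part of the conclusion because its pointwise
    convergence feeds Fatou's lemma later. *)
Lemma L2_complete (F : nat -> T -> R) :
  (forall k, measurable_fun setT (F k)) ->
  (forall e : R, (0 < e)%R -> exists N : nat, forall k l : nat,
     (N <= k)%N -> (N <= l)%N -> \int[mu]_x ((F k x - F l x) ^+ 2)%:E < e%:E) ->
  exists (G : T -> R) (s : nat -> nat),
    [/\ measurable_fun setT G, forall j, (j <= s j)%N,
        {ae mu, forall x, (fun j => F (s j) x) @ \oo --> G x} &
        (fun k => \int[mu]_x ((F k x - G x) ^+ 2)%:E) @ \oo --> 0].
Proof.
move=> mF cF.
have mF2 k l : measurable_fun setT (fun x => ((F k x - F l x) ^+ 2)%:E).
  by apply/measurable_EFinP; apply: measurable_funX; exact: measurable_funB.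
have /choice[N NP] : forall j : nat, exists N : nat, forall k l : nat,
     (N <= k)%N -> (N <= l)%N ->
     \int[mu]_x ((F k x - F l x) ^+ 2)%:E < ((1 / 2 ^+ j) ^+ 2)%:E.
  by move=> j; apply: cF; rewrite exprn_gt0// divr_gt0.
pose s j := (\sum_(i < j.+1) N i + j)%N.
have sN i j : (i <= j)%N -> (N i <= s j)%N.
  move=> ij; rewrite /s (bigD1 (Ordinal (ltnSE ij : (i < j.+1)%N)))//=.
  by rewrite -addnA leq_addr.
pose dd j x := (F (s j.+1) x - F (s j) x)%R.
pose h j x := ((2 ^+ j) * dd j x ^+ 2)%:E.
have h0 j x : 0 <= h j x by rewrite lee_fin mulr_ge0 ?sqr_ge0.
have mh j : measurable_fun setT (h j).
  apply/measurable_EFinP; apply: measurable_funM => //.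
  by apply: measurable_funX; exact: measurable_funB.
pose S x := \sum_(j <oo) h j x.
have iS : \int[mu]_x S x < +oo.
  rewrite /S integral_nneseries//.
  apply: (@le_lt_trans _ _ (\sum_(j <oo) (2 / (2 ^ j.+1)%:R)%:E)); last first.
    by apply: le_lt_trans (epsilon_trick0 xpredT (_ : (0 <= 2)%R)) _; rewrite ?ltry.
  apply: lee_nneseries => [j _ _|j _].
    by apply: integral_ge0.
  rewrite /h; under eq_integral do rewrite EFinM.
  rewrite ge0_integralZl//; last 2 first.
    by apply/measurable_EFinP; apply: measurable_funX; exact: measurable_funB.
    by move=> x _; rewrite lee_fin sqr_ge0.
  apply: (@le_trans _ _ ((2 ^+ j)%:E * ((1 / 2 ^+ j) ^+ 2)%:E)).
    apply: lee_wpmul2l; first by rewrite lee_fin exprn_ge0.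
    by apply/ltW/NP; apply: sN.
  rewrite -EFinM lee_fin natrX (exprS _ j).
  have : (2 ^+ j != 0 :> R)%R by rewrite expf_neq0.
  move: (2 ^+ j)%R => y y0.
  by rewrite le_eqVlt; apply/orP; left; apply/eqP; field.
have S0 x : 0 <= S x by apply: nneseries_ge0.
have mS : measurable_fun setT S by apply: ge0_emeasurable_sum.
pose E := [set x | S x < +oo].
have mE : measurable E.
  rewrite /E -[X in measurable X]setTI; apply: emeasurable_fun_infty_o => //.
have nE : {ae mu, forall x, E x}.
  have intS : mu.-integrable setT S.
    apply/integrableP; split => //.
    by under eq_integral do rewrite gee0_abs//.
  apply: filterS (integrable_ae measurableT intS) => x /(_ I).
  by rewrite /E /= ge0_fin_numE.
have cvgE x : E x -> cvgn (fun j => F (s j) x).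
  move=> Ex.
  have cs : cvgn (series (dd ^~ x)).
    apply: normed_cvg; apply: nondecreasing_is_cvgn.
      apply: nondecreasing_series => j _ _; exact: normr_ge0.
    exists (1 + fine (S x))%R => _ [m _ <-].
    have pS : (\sum_(0 <= j < m) (2 ^+ j * dd j x ^+ 2) <= fine (S x))%R.
      rewrite -lee_fin fineK ?ge0_fin_numE// -sumEFin.
      exact: (@nneseries_lim_ge R (h ^~ x) xpredT 0 m (fun k _ _ => h0 k x)).
    have p2 : (\sum_(0 <= j < m) (2 ^+ j)^-1 <= 2 :> R)%R.
      suff -> : (\sum_(0 <= j < m) (2 ^+ j)^-1 = 2 - 2 / 2 ^+ m :> R)%R.
        by rewrite gerBl divr_ge0// exprn_ge0.
      elim: m {pS} => [|m IH]; first by rewrite big_nil expr0 divr1 subrr.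
      rewrite big_nat_recr//= IH exprS; field.
      by rewrite expf_neq0.
    apply: (@le_trans _ _ (\sum_(0 <= j < m)
        (2^-1 * (2 ^+ j)^-1 + 2^-1 * (2 ^+ j * dd j x ^+ 2)))%R).
      apply: ler_sum => j _.
      have y0 : (0 < 2 ^+ j :> R)%R by rewrite exprn_gt0.
      rewrite /= -(real_normK (num_real (dd j x))).
      set y := (2 ^+ j)%R in y0 *; set v := `|_|%R.
      rewrite -subr_ge0 (_ : (_ - _ = (2 * y)^-1 * (1 - y * v) ^+ 2)%R).
        by rewrite mulr_ge0 ?sqr_ge0// invr_ge0 mulr_ge0 ?ltW.
      by field; rewrite gt_eqF.
    have fS : (0 <= fine (S x))%R by rewrite fine_ge0.
    by rewrite big_split/= -!mulr_sumr; lra.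
  have -> : (fun j => F (s j) x) = (fun j => F (s 0%N) x + series (dd ^~ x) j)%R.
    apply/funext => j; rewrite /series/= /dd telescope_sumr//.
    by rewrite addrC subrK.
  by apply: is_cvgD => //; exact: is_cvg_cst.
(* Cut off outside the set of convergence, the sequence converges everywhere, so its pointwise limit
   is measurable. *)
pose F' j x := (F (s j) x * \1_E x)%R.
pose G x := lim (F' ^~ x @ \oo).
have cF' x : F' ^~ x @ \oo --> G x.
  suff : cvgn (F' ^~ x) by [].
  have [Ex|nEx] := pselect (E x).
    rewrite (_ : F' ^~ x = fun j => F (s j) x); first exact: cvgE.
    by apply/funext => j; rewrite /F' indicE mem_set// mulr1.
  rewrite (_ : F' ^~ x = cst 0%R); first exact: is_cvg_cst.
  by apply/funext => j; rewrite /F' indicE memNset// mulr0.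
have mG : measurable_fun setT G.
  apply: (@measurable_fun_cvg _ _ _ setT F') => // j.
  by apply: measurable_funM => //; exact: measurable_indic.
have aeG : {ae mu, forall x, (fun j => F (s j) x) @ \oo --> G x}.
  apply: filterS nE => x Ex; have := cF' x.
  suff -> : F' ^~ x = fun j => F (s j) x by [].
  by apply/funext => j; rewrite /F' indicE mem_set// mulr1.
exists G, s; split => //.
  by move=> j; exact: leq_addl.
(* Fatou along the subsequence bounds the distance of the whole sequence to G. *)
have key i k : (N i <= k)%N ->
    \int[mu]_x ((F k x - G x) ^+ 2)%:E <= ((1 / 2 ^+ i) ^+ 2)%:E.
  move=> Nk; apply: (@fatou_ae (fun j x => ((F k x - F (s j) x) ^+ 2)%:E)).
  - by move=> j; exact: mF2.
  - by apply/measurable_EFinP; apply: measurable_funX; exact: measurable_funB.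
  - by move=> j x; rewrite lee_fin sqr_ge0.
  - by move=> x; rewrite lee_fin sqr_ge0.
  - apply: filterS aeG => x Gx.
    have c : (fun j => F k x - F (s j) x)%R @ \oo --> (F k x - G x)%R.
      by apply: cvgB; [exact: cvg_cst|exact: Gx].
    apply/fine_cvgP; split; first exact: nearW.
    exact: (cvgM c c).
  - exists i => // j /= ij; apply/ltW/NP => //; exact: sN.
apply/fine_cvgP; split.
  exists (N 0%N) => // k /= Nk; rewrite ge0_fin_numE; last first.
    by apply: integral_ge0 => x _; rewrite lee_fin sqr_ge0.
  by apply: le_lt_trans (key _ _ Nk) _; rewrite ltry.
apply/cvgr0Pnorm_lt => e e0.
have [i ie] : exists i : nat, ((1 / 2 ^+ i) ^+ 2 < e)%R.
  exists (Num.bound e^-1); set b := Num.bound _.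
  have b0 : (0 < 2 ^+ b :> R)%R by rewrite exprn_gt0.
  have b1 : (1 <= 2 ^+ b :> R)%R by rewrite exprn_ege1// ler1n.
  apply: (@le_lt_trans _ _ (1 / 2 ^+ b)%R).
    rewrite expr2; apply: ler_piMl; first by rewrite divr_ge0// ltW.
    by rewrite ler_pdivrMr// mul1r.
  rewrite ltr_pdivrMr// mulrC -ltr_pdivrMr// mul1r.
  apply: lt_trans (archi_boundP _) _; first by rewrite invr_ge0 ltW.
  by rewrite -natrX ltr_nat ltn_expl.
exists (N i) => // k /= Nk.
have kk := key i k Nk.
have f0 : 0 <= \int[mu]_x ((F k x - G x) ^+ 2)%:E.
  by apply: integral_ge0 => x _; rewrite lee_fin sqr_ge0.
rewrite ger0_norm ?fine_ge0//; apply: le_lt_trans ie.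
rewrite -lee_fin fineK// ge0_fin_numE//.
by apply: le_lt_trans kk _; rewrite ltry.
Qed.

End L2_completeness.

(** * The fundamental lemma of the calculus of variations *)

Section flat_function.
Context {R : realType}.
Implicit Types (t : R) (j : nat).

(* flat 0 is the smooth function exp(-1/t) extended by 0; the other members of
   the family express its derivatives. *)
Definition flat j t : R := if 0 < t then t^-1 ^+ j * expR (- t^-1) else 0.

Lemma flat_ge0 j t : 0 <= flat j t.
Proof.
rewrite /flat; case: ifP => // t0.
by rewrite mulr_ge0 ?expR_ge0// exprn_ge0// invr_ge0 ltW.
Qed.

Lemma flat0_le1 t : flat 0 t <= 1.
Proof.
rewrite /flat; case: ifP => // t0.
by rewrite expr0 mul1r -expR0 ler_expR oppr_le0 invr_ge0 ltW.
Qed.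

(** From exp(y) >= y^(j+2) / (j+2)! at y = 1/t. A quadratic bound is what gives each member of the
    family derivative 0 at the origin. *)
Lemma flat_le j t : flat j t <= (j.+2)`!%:R * t ^+ 2.
Proof.
have f0 : 0 < (j.+2)`!%:R :> R by rewrite ltr0n fact_gt0.
rewrite /flat; case: ifP => [t0|_]; last by rewrite mulr_ge0 ?sqr_ge0// ltW.
have y0 : 0 < t^-1 by rewrite invr_gt0.
have := expR_ge1Dxn j.+1 (ltW y0).
rewrite expRN => h.
rewrite ler_pdivrMr ?expR_gt0//.
have {h} : t^-1 ^+ j.+2 <= (j.+2)`!%:R * expR t^-1.
  rewrite mulrC -ler_pdivrMr//; apply: le_trans h; by rewrite lerDr.
move=> h; rewrite mulrAC -ler_pdivrMr ?exprn_gt0//.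
apply: le_trans h; rewrite -exprVn -exprD addn2//.
Qed.

Lemma is_derive_flat j t :
  is_derive t 1 (flat j) (- j%:R * flat j.+1 t + flat j.+2 t).
Proof.
have [t0|t0|t0] := ltgtP 0 t.
- have tn0 : t != 0 by rewrite gt_eqF.
  have dV : is_derive t (1 : R) (fun s : R => s^-1) (- t ^- 2).
    have := @is_deriveV R id t 1 1 tn0 (is_derive_id _ _).
    by rewrite [_ *: _]mulr1.
  have dX : is_derive t^-1 (1 : R) (fun y : R => y ^+ j) (j%:R * t^-1 ^+ j.-1).
    have := @is_deriveX R R id j t^-1 1 1 (is_derive_id _ _).
    rewrite (_ : id ^+ j = fun y : R => y ^+ j); last by apply/funext => y; rewrite exprfctE.
    by rewrite /GRing.scale/= mulr1.
  have dN : is_derive t^-1 (1 : R) (fun y : R => expR (- y)) (expR (- t^-1) * - 1).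
    have := @is_derive1_comp R expR (fun y => - y) t^-1 _ _ (is_derive_expR _)
      (is_deriveNid _ _).
    exact.
  have dG := is_deriveM dX dN.
  have dF := @is_derive1_comp R _ _ t _ _ dG dV.
  apply: (near_eq_is_derive (f := (fun s : R => s^-1 ^+ j * expR (- s^-1)))).
    near=> s; rewrite /flat ifT//; near: s; exact: lt_nbhsr.
  apply: is_derive_eq dF _; rewrite /GRing.scale/= /flat t0.
  case: j {dX dG} => [|j] /=.
    by rewrite !mul0r mulr0 addr0 expr0 !mul1r oppr0 mul0r add0r exprVn; ring.
  by rewrite -!exprVn !exprS expr0; ring.
- have -> : - j%:R * flat j.+1 t + flat j.+2 t = 0.
    by rewrite /flat ltNge (ltW t0)/= mulr0 addr0.
  apply: (near_eq_is_derive (f := (fun _ : R => 0 : R))).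
    by near=> s; rewrite /flat ifF//; apply/negbTE; rewrite -leNgt; apply/ltW;
      near: s; exact: lt_nbhsl.
- rewrite -t0.
  have -> : - j%:R * flat j.+1 0 + flat j.+2 0 = 0.
    by rewrite /flat ltxx mulr0 addr0.
  have cv : (fun h => h^-1 *: ((flat j \o shift 0) (h *: 1) - flat j 0)) @ 0^' --> (0 : R).
    apply/cvgr0Pnorm_le => e e0.
    have c0 : 0 < e / (j.+2)`!%:R by rewrite divr_gt0// ltr0n fact_gt0.
    have : \forall h \near (0 : R)^', `|h| <= e / (j.+2)`!%:R.
      apply: dnbhs0_le => //.
    apply: filterS => h hle /=.
    rewrite addr0 /GRing.scale/= mulr1 {2}/flat ltxx subr0.
    rewrite normrM normfV (ger0_norm (flat_ge0 _ _)).
    have [->|h0] := eqVneq h 0; first by rewrite normr0 invr0 mul0r ltW.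
    rewrite ler_pdivrMl ?normr_gt0//.
    apply: le_trans (flat_le _ _) _.
    rewrite -(real_normK (num_real h)) expr2 mulrCA.
    by rewrite ler_pM2l ?normr_gt0// mulrC -ler_pdivlMr// ltr0n fact_gt0.
  by split; [apply/cvg_ex; exists 0|apply: cvg_lim].
Unshelve. all: by end_near. Qed.

End flat_function.

Section box_bumps.
Context {R : realType} {n : nat}.
Implicit Types (a b x : 'rV[R]_n).

Definition obox a b : set 'rV[R]_n := [set x | forall i, a 0 i < x 0 i < b 0 i].

(** For m > 0 this is smooth, bounded by 1 and zero off the open box; as m grows it tends pointwise
    to the indicator of the box, because exp(-1/(m t)) tends to 1 for t > 0. *)
Definition boxbump a b (m : R) x : R :=
  \prod_i (flat 0 (m * (x 0 i - a 0 i)) * flat 0 (m * (b 0 i - x 0 i))).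

Lemma flat_smooth (D : set 'rV[R]_n) f : open D -> smooth_on D f ->
  smooth_on D (fun x => flat 0 (f x)).
Proof.
move=> oD sf.
apply: (@smooth_on_comp R n D oD nat setT (@flat R)
  (fun j => [:: (- j%:R, j.+1); (1, j.+2)])) => // j t _.
by rewrite big_cons big_seq1 /= mul1r; exact: is_derive_flat.
Qed.

Lemma boxbump_smooth a b m : smooth_on D0 (boxbump a b m).
Proof.
have oD := @open_D0 R n.
apply: smooth_on_prod => // i _; apply: smooth_onM => //; apply: flat_smooth => //;
  apply: smooth_onZ => //; apply: smooth_onB => //; try exact: smooth_on_coord;
  exact: smooth_on_cst.
Qed.

Lemma boxbump_ge0 a b m x : 0 <= boxbump a b m x.
Proof. by apply: prodr_ge0 => i _; rewrite mulr_ge0// flat_ge0. Qed.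

Lemma boxbump_le1 a b m x : boxbump a b m x <= 1.
Proof.
by apply: prodr_ile1 => i _; rewrite mulr_ge0 ?flat_ge0//= mulr_ile1 ?flat_ge0// flat0_le1.
Qed.

Lemma flat_eq0 j (t : R) : t <= 0 -> flat j t = 0.
Proof. by rewrite /flat leNgt => /negbTE ->. Qed.

Lemma boxbump_out a b m x : 0 < m -> ~ obox a b x -> boxbump a b m x = 0.
Proof.
move=> m0; apply: contra_notP => /eqP/prodf_neq0 h i.
have := h i isT; apply: contraNT; rewrite negb_and -!leNgt => /orP[|] xi.
  by rewrite flat_eq0 ?mul0r// pmulr_rle0// subr_le0.
by rewrite mulrC flat_eq0 ?mul0r// pmulr_rle0// subr_le0.
Qed.

Lemma cvg_flat (t : R) : 0 < t -> (fun k : nat => flat 0 (k.+1%:R * t)) @ \oo --> (1 : R).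
Proof.
move=> t0.
rewrite (_ : (fun k : nat => _) = fun k : nat => expR (- (t^-1 * k.+1%:R^-1))); last first.
  by apply/funext => k; rewrite /flat mulr_gt0// expr0 mul1r invfM mulrC.
rewrite -[X in _ --> X]expR0.
apply: continuous_cvg; first exact: continuous_expR.
rewrite -oppr0; apply: cvgN; rewrite -[X in _ --> X](mulr0 t^-1).
by apply: cvgMr; exact: cvg_harmonic.
Qed.

Lemma cvg_boxbump a b x :
  (fun k : nat => boxbump a b k.+1%:R x) @ \oo --> (\1_(obox a b) x : R).
Proof.
have [bx|bx] := pselect (obox a b x); last first.
  rewrite indicE memNset// (_ : (fun _ => _) = cst 0); first exact: cvg_cst.
  by apply/funext => k; rewrite boxbump_out.
rewrite indicE mem_set//.
rewrite -[X in _ --> X](@big1_eq _ 1 *%R _ (index_enum 'I_n) xpredT).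
rewrite /boxbump; elim: (index_enum _) => [|i r IH].
  rewrite big_nil (_ : (fun _ => _) = cst 1); first exact: cvg_cst.
  by apply/funext => k; rewrite big_nil.
rewrite big_cons.
rewrite [X in X @ _](_ : _ = fun k : nat =>
  (flat 0 (k.+1%:R * (x 0 i - a 0 i)) * flat 0 (k.+1%:R * (b 0 i - x 0 i))) *
  \prod_(j <- r) (flat 0 (k.+1%:R * (x 0 j - a 0 j)) *
   flat 0 (k.+1%:R * (b 0 j - x 0 j)))); last first.
  by apply/funext => k; rewrite big_cons.
have /andP[h1 h2] := bx i.
apply: cvgM => //; rewrite -[X in _ --> X]mulr1.
by apply: cvgM; apply: cvg_flat; rewrite subr_gt0.
Qed.

Lemma boxbump_test a b m (r s : R) : 0 < m -> 0 < r -> r < s ->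
  (obox a b `<=` annulus r s) -> test_fun0 (boxbump a b m).
Proof.
move=> m0 r0 rs sub; apply/test_fun0P; split; first exact: boxbump_smooth.
exists r, s; split => // x bx; apply: sub.
by apply: contrapT => /(boxbump_out m0)/eqP; rewrite (negbTE bx).
Qed.

End box_bumps.

Section density.
Local Open Scope ereal_scope.
Context d (T : measurableType d) (R : realType) (mu : {measure set T -> \bar R}).
Variables (f : T -> \bar R) (mf : measurable_fun setT f) (f0 : forall x, 0 <= f x).

Definition density (A : set T) : \bar R := \int[mu]_(x in A) f x.

Let density0 : density set0 = 0.
Proof. exact: integral_set0. Qed.

Let density_ge0 A : 0 <= density A.
Proof. by apply: integral_ge0. Qed.

Let density_sigma_additive : semi_sigma_additive density.
Proof. exact: semi_sigma_additive_nng_induced. Qed.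

HB.instance Definition _ := isMeasure.Build _ _ _ density
  density0 density_ge0 density_sigma_additive.

Definition density_measure : {measure set T -> \bar R} := density.

End density.

Section oboxes.
Context {R : realType} {n : nat}.
Implicit Types (a b x : 'rV[R]_n).

Definition oboxes : set (set 'rV[R]_n) := [set A | exists a b, A = obox a b].

Lemma oboxE a b : obox a b = \bigcap_(i in [set: 'I_n])
  ((fun y : 'rV[R]_n => y 0 i : measurableTypeR R) @^-1` `](a 0 i), (b 0 i)[%classic).
Proof.
apply/seteqP; split => y /= h i; first by move=> _; rewrite /= in_itv/=; exact: h.
by have := h i I; rewrite /= in_itv/=.
Qed.

Lemma measurable_obox a b : measurable (obox a b).
Proof.
rewrite oboxE; apply: fin_bigcap_measurable => [|i _]; first exact: finite_finset.
by apply: measurable_preim; [exact: measurable_coord|exact: measurable_itv].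
Qed.

Lemma oboxI a b c d : obox a b `&` obox c d =
  obox (\row_i Num.max (a 0 i) (c 0 i)) (\row_i Num.min (b 0 i) (d 0 i)).
Proof.
apply/seteqP; split => x /=.
  move=> [h1 h2] i; rewrite !mxE gt_max lt_min.
  by have /andP[-> ->] := h1 i; have /andP[-> ->] := h2 i.
move=> h; split => i; have := h i; rewrite !mxE gt_max lt_min.
  by move=> /andP[/andP[-> _] /andP[-> _]].
by move=> /andP[/andP[_ ->] /andP[_ ->]].
Qed.

Lemma oboxes_setI : setI_closed oboxes.
Proof. by move=> _ _ [a [b ->]] [c [d ->]]; rewrite oboxI; do 2 eexists. Qed.

Definition obox_nat (k : nat) : set 'rV[R]_n := obox (const_mx (- k%:R)) (const_mx k%:R).

Lemma obox_nat_cover : \bigcup_k obox_nat k = setT.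
Proof.
apply/seteqP; split => // x _.
exists (Num.bound `|x|) => // i; rewrite !mxE -ltr_norml.
apply: le_lt_trans (ler_coord_norm _ _) _; exact: archi_boundP.
Qed.

Lemma measurable_oboxesE : @measurable _ 'rV[R]_n = <<s oboxes >>.
Proof.
apply/seteqP; split; last first.
  apply: smallest_sub; first exact: sigma_algebra_measurable.
  by move=> _ [a [b ->]]; exact: measurable_obox.
apply: smallest_sub; first exact: smallest_sigma_algebra.
move=> A; rewrite -bigcup_seq => -[i _ [B mB <-]].
suff : measurable_fun setT
    (fun x : g_sigma_algebraType oboxes => (x : 'rV[R]_n) 0 i : measurableTypeR R).
  by move=> /(_ measurableT B mB).
apply: (measurability _ (RGenOpens.measurableE R)).
move=> _ [_ [c [d ->] <-]]; rewrite setTI.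
rewrite (_ : _ @^-1` _ = \bigcup_k
   obox (\row_j if j == i then c else - k%:R) (\row_j if j == i then d else k%:R)).
  apply: bigcupT_measurable => k; apply: sub_sigma_algebra.
  by do 2 eexists.
apply/seteqP; split => x /=.
  rewrite in_itv/= => xcd; exists (Num.bound `|x|) => // j; rewrite !mxE.
  case: eqP => [->//|_]; rewrite -ltr_norml.
  apply: le_lt_trans (ler_coord_norm _ _) _; exact: archi_boundP.
by move=> [k _ /(_ i)]; rewrite !mxE eqxx in_itv.
Qed.

End oboxes.

(** The origin lies in a cube of side min(e, 1), whose measure is at most e. In dimension 0 the
    origin carries unit mass. *)
Lemma ae_neq0 (R : realType) (n : nat) : (0 < n)%N ->
  {ae lebesgue_rV R n, forall x, x != 0}.
Proof.
move=> n0.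
exists (~` D0); split => //.
  by apply: measurableC; apply: open_measurable_rV; exact: open_D0.
apply/eqP; rewrite -measure_le0; apply/lee_addgt0Pr => e e0; rewrite add0e.
pose M : R := Num.min e 1 / 2.
have M0 : 0 < M by rewrite divr_gt0// lt_min e0 ltr01.
apply: (@le_trans _ _ (lebesgue_rV R n (cube M))).
  apply: le_measure; rewrite ?inE; last 1 first.
  - move=> x /negP; rewrite negbK => /eqP -> i; rewrite mxE normr0; exact: ltW.
  - by apply: measurableC; apply: open_measurable_rV; exact: open_D0.
  - exact: measurable_cube.
rewrite (lebesgue_cube _ (ltW M0)) lee_fin.
have -> : M *+ 2 = Num.min e 1 by rewrite -[LHS]mulr_natr /M divfK.
have m1 : Num.min e 1 <= 1 by rewrite ge_min lexx orbT.
have m0 : 0 <= Num.min e 1 by rewrite le_min ltW//=.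
apply: (@le_trans _ _ (Num.min e 1)); last by rewrite ge_min lexx.
case: n n0 => // k _; rewrite exprS ler_piMr// exprn_ile1//.
Qed.

Section fundamental_lemma.
Context {R : realType} {n : nat}.
Notation mu := (lebesgue_rV R n).
Implicit Types (a b x : 'rV[R]_n).
Variable g : 'rV[R]_n -> R.
Hypothesis lg : locally_integrable0 g.
Hypothesis g0 : forall phi, test_fun0 phi -> Int (fun x => g x * phi x) = 0.

Let G : 'rV[R]_n -> \bar R := EFin \o g.

Lemma measurable_annulus (r s : R) : measurable (@annulus R n r s).
Proof. by apply: closed_measurable_rV; exact: closed_annulus. Qed.

Let intK (r s : R) : 0 < r -> mu.-integrable (annulus r s) G.
Proof. by move=> r0; apply: lg; [exact: compact_annulus|exact: annulus_not0]. Qed.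

(** Dominated convergence for the bumps of the box, which are test functions since the box stays in
    an annulus; |g| is the dominating function there. *)
Let box_integral0 a b (r s : R) : 0 < r -> r < s -> obox a b `<=` annulus r s ->
  (\int[mu]_(x in obox a b) G x = 0)%E.
Proof.
move=> r0 rs sub.
have mK := measurable_annulus r s; have iK := intK s r0.
pose f_ (k : nat) x : \bar R := (g x * boxbump a b k.+1%:R x)%:E.
have tb (k : nat) : test_fun0 (boxbump a b k.+1%:R) by exact: boxbump_test sub.
have mf_ k : measurable_fun (annulus r s) (f_ k).
  apply/measurable_EFinP; apply: measurable_funM.
    by apply/measurable_EFinP; exact: measurable_int iK.
  by apply: measurable_funTS; exact: test_fun0_measurable.
pose f x : \bar R := (g x * \1_(obox a b) x)%:E.
have h1 : measurable_fun (annulus r s) f.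
  apply/measurable_EFinP; apply: measurable_funM.
    by apply/measurable_EFinP; exact: measurable_int iK.
  by apply: measurable_indic; exact: measurable_obox.
have h2 : {ae mu, forall x, annulus r s x -> f_ ^~ x @ \oo --> f x}.
  apply: aeW => x _; apply/fine_cvgP; split; first exact: nearW.
  by apply: cvgM; [exact: cvg_cst|exact: cvg_boxbump].
have h3 : mu.-integrable (annulus r s) (abse \o G) by exact: integrable_abse.
have h4 : {ae mu, forall x k, annulus r s x -> (`|f_ k x| <= (abse \o G) x)%E}.
  apply: aeW => x k _; rewrite lee_fin normrM ler_piMr//.
  by rewrite ger0_norm ?boxbump_ge0// boxbump_le1.
have [_ _ h] := dominated_convergence mK mf_ h1 h2 h3 h4.
have z k : (\int[mu]_(x in annulus r s) f_ k x = 0)%E.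
  have fE : f_ k = f_ k \_ (annulus r s).
    apply/funext => x; rewrite patchE; case: ifPn => // /negP; rewrite inE => nx.
    by rewrite /f_ boxbump_out ?mulr0// => /sub.
  have i1 : mu.-integrable (annulus r s) (f_ k).
    apply: (le_integrable mK (mf_ k) _ iK) => x _.
    rewrite lee_fin normrM ler_piMr//.
    by rewrite ger0_norm ?boxbump_ge0// boxbump_le1.
  have i2 : mu.-integrable setT (f_ k) by rewrite fE; exact: (integrable_mkcond (f_ k) mK).1 i1.
  rewrite integral_mkcond -fE -[LHS]fineK; last exact: integrable_fin_num.
  by congr EFin; exact: g0 (tb k).
have hf : (\int[mu]_(x in annulus r s) f x = 0)%E.
  move: h; rewrite (_ : [sequence _]_k = cst 0%E); last by apply/funext => k; exact: z.
  by move=> h; rewrite -(cvg_lim _ h)// lim_cst.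
rewrite -(setIidr sub) integral_mkcondr -hf; apply: eq_integral => x _.
by rewrite patchE /f indicE; case: ifPn => xo; rewrite ?mulr1 ?mulr0.
Qed.

(** The positive and the negative part of g on the box are densities of two measures that agree and
    are finite on all boxes. Boxes are stable under intersection and generate, so the measures
    coincide, and so do the densities almost everywhere. *)
Let box_ae0 a b (r s : R) : 0 < r -> r < s -> obox a b `<=` annulus r s ->
  {ae mu, forall x, obox a b x -> g x = 0}.
Proof.
move=> r0 rs sub; have mP := measurable_obox a b.
have iP : mu.-integrable (obox a b) G.
  by apply: integrableS (intK s r0) => //; exact: measurable_annulus.
have iG : mu.-integrable setT (G \_ (obox a b)) by exact: (integrable_mkcond G mP).1.
have mGP : measurable_fun setT (G \_ (obox a b)) by exact: measurable_int iG.
pose p := (G \_ (obox a b))^\+%E; pose q := (G \_ (obox a b))^\-%E.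
have mp : measurable_fun setT p by exact: measurable_funepos.
have mq : measurable_fun setT q by exact: measurable_funeneg.
have p0 x : (0 <= p x)%E by exact: funepos_ge0.
have q0 x : (0 <= q x)%E by exact: funeneg_ge0.
have ip : mu.-integrable setT p by exact: integrable_funepos.
have iq : mu.-integrable setT q by exact: integrable_funeneg.
have fin (h : 'rV[R]_n -> \bar R) A : measurable A -> mu.-integrable setT h ->
    (\int[mu]_(x in A) h x)%E \is a fin_num.
  by move=> mA ih; apply: integrable_fin_num => //; exact: integrableS ih.
have boxeq A : oboxes A -> (\int[mu]_(x in A) p x = \int[mu]_(x in A) q x)%E.
  move=> [c [d ->]]; have mB := measurable_obox c d.
  have e0 : (\int[mu]_(x in obox c d) (G \_ (obox a b)) x = 0)%E.
    rewrite -integral_mkcondr oboxI; apply: box_integral0 r0 rs _.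
    by rewrite -oboxI; exact: subset_trans (@subIsetr _ _ _) sub.
  move: e0; rewrite integralE -/p -/q -(fineK (fin _ _ mB ip)) -(fineK (fin _ _ mB iq)).
  by rewrite -EFinB => -[] /subr0_eq ->.
pose mP' := density_measure mu mp p0; pose mQ' := density_measure mu mq q0.
have meq A : measurable A -> mP' A = mQ' A.
  move=> mA; apply: (measure_unique oboxes obox_nat) => //.
  - exact: measurable_oboxesE.
  - exact: oboxes_setI.
  - by move=> k; do 2 eexists.
  - exact: obox_nat_cover.
  - move=> k; have mk : measurable (@obox_nat R n k) by exact: measurable_obox.
    have := fin _ _ mk ip; rewrite ge0_fin_numE//.
    by apply: integral_ge0.
have : ae_eq mu setT p q.
  apply: integral_ae_eq => // E _ mE; exact: meq.
apply: filterS => x /(_ I) pq xP.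
move: pq; rewrite /p /q funeposE funenegE patchE mem_set//= -!EFin_max => -[].
by rewrite !maxEle; case: ifPn; case: ifPn; rewrite -?ltNge; lra.
Qed.

(** Every point other than the origin lies in a rational cube contained in an annulus. There are
    countably many such cubes, so the null sets of [box_ae0] add up to a null set. *)
Lemma fundamental_lemma : (0 < n)%N -> {ae mu, forall x, g x = 0}.
Proof.
move=> n0.
have h0 := @ae_neq0 R n n0.
have hk : {ae mu, forall x, forall k : nat,
    if unpickle k is Some p then
      (exists r s : R, [/\ 0 < r, r < s & @rbox R n p `<=` annulus r s]) ->
      rbox p x -> g x = 0
    else True}.
  apply: ae_foralln => k; case: unpickle => [p|]; last exact: aeW.
  have [[r [s [r0 rs sub]]]|no] :=
    pselect (exists r s : R, [/\ 0 < r, r < s & @rbox R n p `<=` annulus r s]); last first.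
    exact: aeW.
  have rE : @rbox R n p = obox (\row_i (ratr (p.1 0 i) - p.2.+1%:R^-1))
      (\row_i (ratr (p.1 0 i) + p.2.+1%:R^-1)).
    by apply/seteqP; split => x h i; have := h i; rewrite /= !mxE ltr_distl.
  rewrite rE in sub; have := box_ae0 r0 rs sub.
  by apply: filterS => x hx _; rewrite rE; exact: hx.
apply: filterS2 h0 hk => x x0 hx.
pose U := [set y : 'rV[R]_n | enorm x / 2 < enorm y < enorm x * 2].
have e0 := enorm_gt0 x0.
have oU : open U.
  rewrite (_ : U = enorm @^-1` `](enorm x / 2), (enorm x * 2)[%classic).
    by apply: open_comp; [move=> y _; exact: continuous_enorm|exact: interval_open].
  by apply/seteqP; split => y; rewrite /U /= in_itv.
have Ux : U x by rewrite /U /=; apply/andP; split; lra.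
have [p [px pU]] := rbox_basis oU Ux.
have := hx (pickle p); rewrite pickleK; apply => //.
exists (enorm x / 2), (enorm x * 2); split; [by rewrite divr_gt0|lra|].
by move=> y /pU /andP[h1 h2]; rewrite /annulus/= !ltW.
Qed.

End fundamental_lemma.

(** * Weak derivatives and energy of functions of D22 *)

Section weighted_L2.
Context {R : realType} {n : nat}.
Hypothesis n0 : (0 < n)%N.
Notation mu := (lebesgue_rV R n).
Implicit Types (f g h u : 'rV[R]_n -> R) (b : R).

Lemma measurable_W b : measurable_fun setT (W b : 'rV[R]_n -> R).
Proof.
apply: (measurableT_comp (measurable_powR b)).
by apply: continuous_measurable_rV; exact: continuous_enorm.
Qed.

Lemma W_half b (x : 'rV[R]_n) : W (b / 2) x ^+ 2 = W b x.
Proof. by rewrite /W -powR_mulrn ?powR_ge0// -powRrM divfK. Qed.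

Lemma measurable_wsq b f : measurable_fun setT f ->
  measurable_fun setT (fun x => (W b x * f x ^+ 2)%:E).
Proof.
move=> mf; apply/measurable_EFinP; apply: measurable_funM; first exact: measurable_W.
exact: measurable_funX.
Qed.

Lemma wsq_ge0 b f x : (0 <= (W b x * f x ^+ 2)%:E)%E.
Proof. by rewrite lee_fin mulr_ge0 ?W_ge0 ?sqr_ge0. Qed.

Lemma wL2_sq_ge0 b f : (0 <= wL2_sq b f)%E.
Proof. by apply: integral_ge0 => x _; exact: wsq_ge0. Qed.

Lemma wL2_sq_test b f : test_fun0 f ->
  wL2_sq b f = (Int (fun x => W b x * f x ^+ 2))%:E.
Proof.
move=> tf; rewrite /Int /Rintegral fineK//.
have it : mu.-integrable setT (EFin \o (fun x => W b x * f x ^+ 2)).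
  by apply: test_fun0_integrable; apply: test_fun0_W; exact: test_fun0_sqr.
exact: integrable_fin_num it.
Qed.

Lemma wL2_sq_le b f g h (c d : R) : 0 <= c -> 0 <= d ->
  measurable_fun setT f -> measurable_fun setT g -> measurable_fun setT h ->
  (forall x, f x ^+ 2 <= c * g x ^+ 2 + d * h x ^+ 2) ->
  (wL2_sq b f <= c%:E * wL2_sq b g + d%:E * wL2_sq b h)%E.
Proof.
move=> c0 d0 mf mg mh fgh.
have Z (e : R) (k : 'rV[R]_n -> R) : 0 <= e -> measurable_fun setT k ->
    (e%:E * wL2_sq b k = \int[mu]_x (e%:E * (W b x * k x ^+ 2)%:E))%E.
  move=> e0 mk; rewrite ge0_integralZl//; first exact: measurable_wsq.
  by move=> x _; exact: wsq_ge0.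
rewrite !Z//.
have wge (e : R) (k : 'rV[R]_n -> R) x : 0 <= e -> (0 <= e%:E * (W b x * k x ^+ 2)%:E)%E.
  by move=> e0; apply: mule_ge0; [rewrite lee_fin|exact: wsq_ge0].
have mwe (e : R) (k : 'rV[R]_n -> R) : measurable_fun setT k ->
    measurable_fun setT (fun x : 'rV[R]_n => (e%:E * (W b x * k x ^+ 2)%:E)%E).
  by move=> mk; apply: emeasurable_funM => //; exact: measurable_wsq.
rewrite -ge0_integralD//; first last.
- exact: mwe.
- by move=> x _; exact: wge.
- exact: mwe.
- by move=> x _; exact: wge.
apply: ge0_le_integral => //.
- by move=> x _; exact: wsq_ge0.
- exact: measurable_wsq.
- by apply: emeasurable_funD; exact: mwe.
move=> x _; rewrite -!EFinM -EFinD lee_fin.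
rewrite (mulrCA c) (mulrCA d) -mulrDr; apply: ler_wpM2l => //; exact: W_ge0.
Qed.

Lemma sqr_split (t a c : R) : 0 < t -> a ^+ 2 <= (1 + t) * c ^+ 2 + (1 + t^-1) * (a - c) ^+ 2.
Proof.
move=> t0; rewrite -subr_ge0.
rewrite (_ : _ - _ = t^-1 * (t * c - (a - c)) ^+ 2).
  by rewrite mulr_ge0 ?sqr_ge0// invr_ge0 ltW.
by field; rewrite gt_eqF.
Qed.

(** Convergence of test functions in L^2(|x|^b dx). It serves the approximants (b = a - 4), their
    partial derivatives (b = a - 2) and their Laplacians (b = a) alike. *)
Definition wlim b (f : nat -> 'rV[R]_n -> R) g :=
  (forall k, test_fun0 (f k)) /\ measurable_fun setT g /\
  (fun k => wL2_sq b (f k \- g)%R) @ \oo --> 0%E.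

Lemma wlim_near b (f : nat -> 'rV[R]_n -> R) g (e : R) : wlim b f g -> 0 < e ->
  \forall k \near \oo, (wL2_sq b (f k \- g)%R < e%:E)%E.
Proof.
move=> [_ [_ /fine_cvgP[fin /cvgr0Pnorm_lt h]]] e0.
apply: filterS2 fin (h e e0) => k /= fk; rewrite ger0_norm.
  by rewrite -lte_fin fineK.
by rewrite fine_ge0// wL2_sq_ge0.
Qed.

Lemma wlim_fin b (f : nat -> 'rV[R]_n -> R) g : wlim b f g -> (wL2_sq b g < +oo)%E.
Proof.
move=> fg; have [tf [mg _]] := fg.
have [k _ /(_ k (leqnn k)) /= hk] := wlim_near fg ltr01.
have mf := test_fun0_measurable (tf k).
have h2 : (wL2_sq b g <= 2%:E * wL2_sq b (f k) + 2%:E * wL2_sq b (f k \- g)%R)%E.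
  apply: wL2_sq_le => //; first exact: measurable_funB.
  by move=> x /=; have := sqr_ge0 (g x - 2 * f k x); rewrite !expr2; lra.
apply: le_lt_trans h2 _; rewrite wL2_sq_test//.
rewrite lte_add_pinfty// ?ltry//; apply: lte_mul_pinfty => //.
by apply: lt_trans hk _; rewrite ltry.
Qed.

(** [sqr_split] takes the place of Minkowski's inequality: t is chosen so that t times the squared
    norm of g is at most e/2, and then k so large that the term with factor 1 + 1/t is below e/2. *)
Lemma wlim_upper b (f : nat -> 'rV[R]_n -> R) g (e : R) : wlim b f g -> 0 < e ->
  \forall k \near \oo, Int (fun x => W b x * f k x ^+ 2) <= fine (wL2_sq b g) + e.
Proof.
move=> fg e0; have [tf [mg _]] := fg; have gfin := wlim_fin fg.
have g0 : 0 <= fine (wL2_sq b g) by rewrite fine_ge0// wL2_sq_ge0.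
set D := fine (wL2_sq b g) in g0 *.
have gD : wL2_sq b g = D%:E by rewrite fineK// ge0_fin_numE// wL2_sq_ge0.
pose t := e / (2 * (D + 1)).
have D1 : 0 < 2 * (D + 1) by rewrite mulr_gt0// ltr_wpDl.
have t0 : 0 < t by rewrite divr_gt0.
have tD : t * D <= e / 2.
  rewrite /t mulrAC ler_pdivrMr//.
  rewrite (_ : e / 2 * (2 * (D + 1)) = e * D + e); last by field.
  by rewrite lerDl ltW.
have s0 : 0 < 1 + t^-1 by rewrite addr_gt0// invr_gt0.
have := wlim_near fg (_ : 0 < e / 2 / (1 + t^-1)).
move=> /(_ _)[|N _ NP]; first by rewrite !divr_gt0.
exists N => // k /= /NP hk; rewrite -lee_fin -wL2_sq_test//.
have mf := test_fun0_measurable (tf k).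
apply: (@le_trans _ _ ((1 + t)%:E * wL2_sq b g + (1 + t^-1)%:E * wL2_sq b (f k \- g)%R)%E).
  apply: wL2_sq_le => //; try by rewrite ltW// addr_gt0.
    exact: measurable_funB.
  by move=> x; exact: sqr_split.
rewrite gD; apply: (@le_trans _ _ ((1 + t)%:E * D%:E + (1 + t^-1)%:E * (e / 2 / (1 + t^-1))%:E)%E).
  by apply: leeD => //; apply: lee_wpmul2l; [rewrite lee_fin ltW|exact: ltW].
rewrite -!EFinM -EFinD lee_fin.
have -> : (1 + t^-1) * (e / 2 / (1 + t^-1)) = e / 2 by rewrite mulrC divfK// gt_eqF.
lra.
Qed.

Lemma locint_mul_integrable g phi : locally_integrable0 g -> test_fun0 phi ->
  mu.-integrable setT (EFin \o (fun x => g x * phi x)).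
Proof.
move=> lg tp; have [_ [r [s [r0 rs sub]]]] := (test_fun0P phi).1 tp.
have mK := @measurable_annulus R n r s.
have iK : mu.-integrable (annulus r s) (EFin \o g).
  by apply: lg; [exact: compact_annulus|exact: annulus_not0].
have [C C0 pC] := test_fun0_bounded tp.
have -> : EFin \o (fun x => g x * phi x) =
    (EFin \o (fun x => g x * phi x)) \_ (annulus r s).
  apply/funext => x; rewrite patchE; case: ifPn => // /negP; rewrite inE => nx /=.
  rewrite (_ : phi x = 0) ?mulr0//.
  by apply/eqP; apply: contra_notT nx; exact: sub.
apply/(integrable_mkcond _ mK).
apply: (le_integrable mK _ _ (integrableZl mK C iK)).
  apply/measurable_EFinP; apply: measurable_funM.
    by apply/measurable_EFinP; exact: measurable_int iK.
  by apply: measurable_funTS; exact: test_fun0_measurable.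
move=> x _ /=; rewrite lee_fin !normrM (gtr0_norm C0) mulrC.
exact: ler_wpM2r.
Qed.

(** On a compact set away from the origin the weight is bounded below by some c > 0, and |g| <= 1 +
    g^2 <= 1 + |x|^b g^2 / c. *)
Lemma wlim_locint b (f : nat -> 'rV[R]_n -> R) g : wlim b f g -> locally_integrable0 g.
Proof.
move=> fg K cK K0; have [tf [mg _]] := fg; have gfin := wlim_fin fg.
have [r [s [r0 rs sub]]] := compact_sub_annulus cK K0.
have mK : measurable K.
  by apply: closed_measurable_rV; apply: compact_closed => //; exact: norm_hausdorff.
have iW : mu.-integrable setT (fun x => (W b x * g x ^+ 2)%:E).
  apply/integrableP; split; first exact: measurable_wsq.
  by under eq_integral do rewrite gee0_abs ?wsq_ge0//.
have [c c0 cW] : exists2 c : R, 0 < c & forall x : 'rV[R]_n, annulus r s x -> c <= W b x.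
  have [b0|b0] := leP 0 b.
    exists (r `^ b); first exact: powR_gt0.
    by move=> x /andP[rx _]; apply: ge0_ler_powR => //; rewrite nnegrE ?enorm_ge0//; exact: ltW.
  exists (s `^ b); first by apply: powR_gt0; exact: lt_trans rs.
  move=> x xK; have x0 := annulus_D0 r0 xK; move: xK => /andP[_ xs].
  rewrite /W -(opprK b) !(powRN _ (- b)) lef_pV2 ?posrE ?powR_gt0 ?enorm_gt0//; last first.
    exact: lt_trans rs.
  apply: ge0_ler_powR => //; rewrite ?nnegrE ?enorm_ge0 ?oppr_ge0//; first exact: ltW.
  by apply: ltW; exact: lt_trans rs.
have i1 : mu.-integrable K (EFin \o cst 1).
  apply: measurable_bounded_integrable => //.
    apply: (@le_lt_trans _ _ (mu (cube s))).
      apply: le_measure; rewrite ?inE//; first exact: measurable_cube.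
      by move=> x /sub; exact: annulus_cube.
    by rewrite lebesgue_cube ?ltry// ltW// (lt_trans r0).
  by exists 1; split => // M M1 x _; rewrite /= normr1 ltW.
have iWK : mu.-integrable K (fun x => (W b x * g x ^+ 2)%:E) by exact: integrableS iW.
apply: (le_integrable mK _ _ (integrableD mK i1 (integrableZl mK c^-1 iWK))).
  by apply/measurable_EFinP; exact: measurable_funTS.
move=> x Kx /=; rewrite lee_fin; have xs := sub x Kx.
apply: le_trans (ler_norm _).
have h1 : g x ^+ 2 <= c^-1 * (W b x * g x ^+ 2).
  by rewrite mulrA ler_peMl ?sqr_ge0// ler_pdivlMl// mulr1 cW.
apply: le_trans (lerD (lexx _) h1).
by rewrite -(real_normK (num_real (g x))); have := sqr_ge0 (`|g x| - 1); rewrite !expr2; nra.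
Qed.

(** The weights |x|^b and |x|^-b are in duality. Young's inequality with parameter t = (C + 1) / e
    makes the part in phi at most e/2, and the part in f_k - g follows for large k. *)
Lemma wlim_weak b (f : nat -> 'rV[R]_n -> R) g phi : wlim b f g -> test_fun0 phi ->
  (fun k => Int (fun x => f k x * phi x)) @ \oo --> Int (fun x => g x * phi x).
Proof.
move=> fg tp; have [tf [mg _]] := fg; have lg := wlim_locint fg.
pose C := Int (fun x => W (- b) x * phi x ^+ 2).
have C0 : 0 <= C by apply: Int_ge0 => x; rewrite mulr_ge0 ?W_ge0 ?sqr_ge0.
apply/cvgrPdist_le => e e0.
pose t := (C + 1) / e.
have t0 : 0 < t by rewrite divr_gt0// ltr_wpDl.
have et : 0 < e / t by rewrite divr_gt0.
apply: filterS (wlim_near fg et) => k hk.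
have tfp : test_fun0 (fun x => f k x * phi x) by exact: test_fun0_mul.
have ig := locint_mul_integrable lg tp; have If := test_fun0_integrable tfp.
rewrite -/(Int _) /Int -RintegralB//.
have id : mu.-integrable setT (EFin \o (fun x => g x * phi x - f k x * phi x)).
  by have := integrableB measurableT ig If; apply: eq_integrable.
apply: le_trans (le_normr_Rintegral measurableT id) _.
pose P x := W b x * (f k x - g x) ^+ 2.
pose N x := W (- b) x * phi x ^+ 2.
have mfk := test_fun0_measurable (tf k).
have iP : mu.-integrable setT (EFin \o P).
  apply/integrableP; split.
    by apply: (measurable_wsq b (f := fun x => f k x - g x)); exact: measurable_funB.
  rewrite (eq_integral (EFin \o P)) => [|x _].
    by apply: lt_trans hk _; rewrite ltry.
  by rewrite gee0_abs// lee_fin mulr_ge0 ?W_ge0 ?sqr_ge0.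
have tN : test_fun0 N by apply: test_fun0_W; exact: test_fun0_sqr.
have iN := test_fun0_integrable tN.
have P_e : (\int[mu]_x P x) < e / t.
  by rewrite -lte_fin /Rintegral fineK; [exact: hk|exact: integrable_fin_num iP].
have iP' : mu.-integrable setT (EFin \o (fun x => t / 2 * P x)).
  by have := integrableZl measurableT (t / 2) iP; apply: eq_integrable.
have iN' : mu.-integrable setT (EFin \o (fun x => t^-1 / 2 * N x)).
  by have := integrableZl measurableT (t^-1 / 2) iN; apply: eq_integrable.
have iPN : mu.-integrable setT (EFin \o (fun x => t / 2 * P x + t^-1 / 2 * N x)).
  by have := integrableD measurableT iP' iN'; apply: eq_integrable.
apply: (@le_trans _ _ (\int[mu]_x (t / 2 * P x + t^-1 / 2 * N x))).
  apply: le_Rintegral => //.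
    by have := integrable_abse id; apply: eq_integrable.
  move=> x _ /=; rewrite -mulrBl.
  have [->|x0] := eqVneq x 0.
    rewrite (test_fun0_vanish0 tp) mulr0 normr0 /N /P.
    apply: addr_ge0; apply: mulr_ge0; try by rewrite mulr_ge0 ?W_ge0 ?sqr_ge0.
      by rewrite divr_ge0// ltW.
    by rewrite divr_ge0// invr_ge0 ltW.
  have w0 := W_gt0 b x0.
  have wE : W (- b) x = (W b x)^-1 by rewrite /W powRN.
  rewrite /P /N wE normrM -(real_normK (num_real (phi x))) distrC.
  rewrite -(real_normK (num_real (f k x - g x))).
  move: w0 `|phi x| `|f k x - g x| => w0 p d; set w := W b x in w0 *.
  rewrite -subr_ge0 (_ : _ - _ = (2 * t * w)^-1 * (t * w * d - p) ^+ 2).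
    apply: mulr_ge0; last exact: sqr_ge0.
    by rewrite invr_ge0; apply: ltW; apply: mulr_gt0 => //; exact: mulr_gt0.
  by field; rewrite !gt_eqF.
rewrite RintegralD// !RintegralZl// -/(Int N) -/C.
have hC : t^-1 * C <= e.
  rewrite /t invf_div mulrAC ler_pdivrMr ?ltr_wpDl//.
  by rewrite ler_pM2l// lerDl.
have hP : t * (\int[mu]_x P x) <= e by rewrite mulrC -ler_pdivlMr// ltW.
have -> : e = e / 2 + e / 2 by field.
apply: lerD; first by rewrite mulrAC ler_pM2r ?invr_gt0.
by rewrite mulrAC ler_pM2r ?invr_gt0.
Qed.

End weighted_L2.

Section weak_derivatives.
Context {R : realType} {n : nat}.
Hypothesis n0 : (0 < n)%N.
Notation mu := (lebesgue_rV R n).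
Implicit Types (f g h u : 'rV[R]_n -> R) (b : R).

Lemma test_fun0_locint f : test_fun0 f -> locally_integrable0 f.
Proof.
move=> tf K cK _; apply: integrableS (test_fun0_integrable tf) => //.
by apply: closed_measurable_rV; apply: compact_closed => //; exact: norm_hausdorff.
Qed.

Lemma weak_laplacian_test f : test_fun0 f -> is_weak_laplacian f (laplacian f).
Proof.
move=> tf; split; first by apply: test_fun0_locint; exact: test_fun0_laplacian.
by move=> phi tp; exact: Int_laplacian_sym.
Qed.

Lemma weak_partial_test i f : test_fun0 f -> is_weak_partial i f (partial i f).
Proof.
move=> tf; split; first by apply: test_fun0_locint; exact: test_fun0_partial.
by move=> phi tp; exact: Int_partial_byparts.
Qed.

Lemma locint_ae_unique g h : locally_integrable0 g -> locally_integrable0 h ->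
  (forall phi, test_fun0 phi -> Int (fun x => g x * phi x) = Int (fun x => h x * phi x)) ->
  {ae mu, forall x, g x = h x}.
Proof.
move=> lg lh gh.
have : {ae mu, forall x, g x - h x = 0}.
  apply: (fundamental_lemma (g := fun x => g x - h x)) => //.
    move=> K cK K0; have mK : measurable K.
      by apply: closed_measurable_rV; apply: compact_closed => //; exact: norm_hausdorff.
    by have := integrableB mK (lg K cK K0) (lh K cK K0); apply: eq_integrable.
  move=> phi tp; have ig := locint_mul_integrable lg tp.
  have ih := locint_mul_integrable lh tp.
  transitivity (Int (fun x => g x * phi x) - Int (fun x => h x * phi x)).
    by rewrite /Int -RintegralB//; apply: eq_Int => x; rewrite mulrBl.
  by rewrite gh// subrr.
by apply: filterS => x /subr0_eq.
Qed.

(** [weak_laplacian] is an arbitrary choice by [xget]. The existence of g guarantees that the chosen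
    function is a weak Laplacian and not the default 0, and the fundamental lemma then compares the
    two. *)
Lemma weak_laplacian_ae u g : is_weak_laplacian u g ->
  {ae mu, forall x, weak_laplacian u x = g x}.
Proof.
move=> ug; have [lw uw] : is_weak_laplacian u (weak_laplacian u).
  by apply: (@xgetPex _ (fun=> 0) [set g | is_weak_laplacian u g]); exists g.
have [lg ugg] := ug; apply: locint_ae_unique => // phi tp.
by rewrite -[LHS]uw// -[RHS]ugg.
Qed.

Lemma weak_partial_ae i u g : is_weak_partial i u g ->
  {ae mu, forall x, weak_partial i u x = g x}.
Proof.
move=> ug; have [lw uw] : is_weak_partial i u (weak_partial i u).
  by apply: (@xgetPex _ (fun=> 0) [set g | is_weak_partial i u g]); exists g.
have [lg ugg] := ug; apply: locint_ae_unique => // phi tp.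
by apply: oppr_inj; rewrite -[LHS]uw// -[RHS]ugg.
Qed.

(** Multiplication by |x|^(b/2) reduces the claim to the unweighted L^2; only the origin is lost
    when dividing back. *)
Lemma wlim_complete b (f : nat -> 'rV[R]_n -> R) :
  (forall k, test_fun0 (f k)) ->
  (forall e : R, 0 < e -> exists N : nat, forall k l : nat,
     (N <= k)%N -> (N <= l)%N -> (wL2_sq b (f k \- f l)%R < e%:E)%E) ->
  exists g (s : nat -> nat), [/\ wlim b f g, forall j, (j <= s j)%N &
    {ae mu, forall x, (fun j => f (s j) x) @ \oo --> g x}].
Proof.
move=> tf cf.
pose F k x := W (b / 2) x * f k x.
have mF k : measurable_fun setT (F k).
  by apply: measurable_funM; [exact: measurable_W|exact: test_fun0_measurable].
have FE k l x : (F k x - F l x) ^+ 2 = W b x * (f k x - f l x) ^+ 2.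
  by rewrite /F -mulrBr exprMn W_half.
have [e /cf[N NP]|G [s [mG sj aeG cG]]] := L2_complete (mu := mu) mF.
  exists N => k l Nk Nl; apply: le_lt_trans (NP k l Nk Nl).
  rewrite le_eqVlt; apply/orP; left; apply/eqP.
  by apply: eq_integral => x _; rewrite FE.
pose g x := W (- (b / 2)) x * G x.
have Wg x : x != 0 -> W (b / 2) x * g x = G x.
  by move=> x0; rewrite /g mulrA -WD// subrr W0 mul1r.
have mg : measurable_fun setT g by apply: measurable_funM => //; exact: measurable_W.
exists g, s; split => //.
  split => //; split => //; apply: cvg_trans cG; apply: near_eq_cvg; apply: nearW => k.
  apply: ge0_ae_eq_integral => //.
  - by apply/measurable_EFinP; apply: measurable_funX; exact: measurable_funB.
  - apply: measurable_wsq; apply: measurable_funB => //; exact: test_fun0_measurable.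
  - by move=> x _; rewrite lee_fin sqr_ge0.
  - by move=> x _; exact: wsq_ge0.
  apply: filterS (ae_neq0 R n0) => x x0 _; congr EFin.
  by rewrite -/(W b x) -W_half -exprMn mulrBr Wg.
apply: filterS2 (ae_neq0 R n0) aeG => x x0 Gx.
rewrite (_ : (fun j => _) = fun j => W (- (b / 2)) x * F (s j) x).
  by apply: cvgMr.
by apply/funext => j; rewrite /F mulrA -WD// addNr W0 mul1r.
Qed.

Lemma wlim_test b f : test_fun0 f -> wlim b (fun=> f) f.
Proof.
move=> tf; split => //; split; first exact: test_fun0_measurable.
rewrite (_ : (fun _ => _) = cst 0%E); first exact: cvg_cst.
apply/funext => _ /=; rewrite /wL2_sq integral0_eq// => x _.
by rewrite /= subrr expr0n mulr0.
Qed.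

Lemma D22_test a f : test_fun0 f -> D22 a f.
Proof.
move=> tf; have [_ [mf cf]] := wlim_test (a - 4) tf.
split => //; exists (fun=> f); split => // e e0; exists 0%N => _ _ _ _.
rewrite /wL2_sq integral0_eq ?lte_fin// => x _.
by rewrite laplacianB0// subrr expr0n mulr0.
Qed.

Variables (a gamma : R).
Hypotheses (gammaE : gamma * 2 = n%:R - 4 + a) (gamma0 : 0 < gamma) (a2 : a <= 2).

(** The annuli 1/(k+1) <= |x| <= k+1 exhaust the complement of the origin, and g is measurable on
    each of them. *)
Lemma locint_measurable g : locally_integrable0 g -> measurable_fun setT g.
Proof.
move=> lg.
have D0E : (D0 : set 'rV[R]_n) = \bigcup_k annulus (k.+1%:R^-1) k.+1%:R.
  apply/seteqP; split => [x x0|x [k _ xk]]; last by apply: annulus_D0 xk; rewrite invr_gt0.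
  have e0 := enorm_gt0 x0.
  exists (maxn (Num.bound (enorm x)) (Num.bound (enorm x)^-1)) => //.
  set k := maxn _ _; rewrite /annulus /=; apply/andP; split.
    rewrite invf_ple ?posrE//; apply: le_trans (ltW (archi_boundP _)) _.
      by rewrite invr_ge0 ltW.
    by rewrite ler_nat ltnW// ltnS leq_maxr.
  apply: le_trans (ltW (archi_boundP (ltW e0))) _.
  by rewrite ler_nat ltnW// ltnS leq_maxl.
have mD0 : measurable (D0 : set 'rV[R]_n).
  by apply: open_measurable_rV; exact: open_D0.
have mk k : measurable (@annulus R n k.+1%:R^-1 k.+1%:R) by exact: measurable_annulus.
have m1 : measurable_fun (D0 : set 'rV[R]_n) g.
  rewrite D0E; apply/measurable_fun_bigcup => // k.
  apply/measurable_EFinP; apply: measurable_int (lg _ _ _).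
    exact: compact_annulus.
  by apply: annulus_not0; rewrite invr_gt0.
have -> : [set: 'rV[R]_n] = D0 `|` [set 0].
  apply/seteqP; split => // x _.
  by have [->|x0] := eqVneq x 0; [right|left].
apply/measurable_funU => //.
  have -> : [set (0 : 'rV[R]_n)] = ~` D0.
    apply/seteqP; split => x; rewrite /D0 /=; first by move=> ->; rewrite eqxx.
    by move=> /negP; rewrite negbK => /eqP.
  exact: measurableC.
split => //; exact: measurable_fun_set1.
Qed.

Lemma energy_ae lambda u G (g : 'I_n -> 'rV[R]_n -> R) :
  is_weak_laplacian u G -> (forall i, is_weak_partial i u (g i)) ->
  energy a lambda u = (wL2_sq a G + lambda%:E * \sum_i wL2_sq (a - 2) (g i))%E.
Proof.
move=> uG ug.
have mG := locint_measurable uG.1; have mg i := locint_measurable (ug i).1.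
have wl : is_weak_laplacian u (weak_laplacian u).
  by apply: (@xgetPex _ (fun=> 0) [set g | is_weak_laplacian u g]); exists G.
have wp i : is_weak_partial i u (weak_partial i u).
  by apply: (@xgetPex _ (fun=> 0) [set v | is_weak_partial i u v]); exists (g i); exact: ug.
have ml := locint_measurable wl.1; have mp i := locint_measurable (wp i).1.
rewrite /energy; congr (_ + _ * _)%E.
  apply: ge0_ae_eq_integral => //.
  - exact: measurable_wsq.
  - exact: measurable_wsq.
  - by move=> x _; exact: wsq_ge0.
  - by move=> x _; exact: wsq_ge0.
  by apply: filterS (weak_laplacian_ae uG) => x + _; move=> ->.
transitivity (\int[mu]_x \sum_i (W (a - 2) x * weak_partial i u x ^+ 2)%:E)%E.
  by apply: eq_integral => x _; rewrite sumEFin mulr_sumr.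
rewrite ge0_integral_sum//; last 2 first.
- by move=> i; exact: measurable_wsq.
- by move=> i x _; exact: wsq_ge0.
apply: eq_bigr => i _; apply: ge0_ae_eq_integral => //.
- exact: measurable_wsq.
- exact: measurable_wsq.
- by move=> x _; exact: wsq_ge0.
- by move=> x _; exact: wsq_ge0.
by apply: filterS (weak_partial_ae (ug i)) => x + _; move=> ->.
Qed.

Lemma energy_test lambda f : test_fun0 f ->
  energy a lambda f = (wD a f + lambda * wB a f)%:E.
Proof.
move=> tf; rewrite (energy_ae lambda (weak_laplacian_test tf)
  (fun i => weak_partial_test i tf)).
rewrite EFinD EFinM; congr (_ + _ * _)%E.
  by rewrite wL2_sq_test//; exact: test_fun0_laplacian.
rewrite (eq_bigr (fun i => (Int (fun x => W (a - 2) x * partial i f x ^+ 2))%:E)).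
  rewrite sumEFin -Int_sum => [|i].
    by congr EFin; apply: eq_Int => x; rewrite mulr_sumr.
  by apply: test_fun0_W; apply: test_fun0_sqr; exact: test_fun0_partial.
by move=> i _; rewrite wL2_sq_test//; exact: test_fun0_partial.
Qed.

(** Passage to the limit in the identities that define weak derivatives, with e the sign in the
    integration by parts. *)
Lemma cvg_weak b c (f : nat -> 'rV[R]_n -> R) (h : nat -> 'rV[R]_n -> R) u g
    (phi psi : 'rV[R]_n -> R) (e : R) : wlim b f u -> wlim c h g ->
  test_fun0 phi -> test_fun0 psi ->
  (forall k, Int (fun x => f k x * phi x) = e * Int (fun x => h k x * psi x)) ->
  Int (fun x => u x * phi x) = e * Int (fun x => g x * psi x).
Proof.
move=> fu hg tp ts E; have c1 := wlim_weak fu tp; have c2 := wlim_weak hg ts.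
have c3 : (fun k => e * Int (fun x => h k x * psi x)) @ \oo -->
    e * Int (fun x => g x * psi x) by apply: cvgMr.
rewrite (funext E) in c1.
exact: (cvg_unique _ c1 c3).
Qed.

(** Rellich and Hardy, applied to differences of approximants, give Cauchy sequences in all three
    weighted spaces, so the weak Laplacian and gradient of u are L^2 limits of those of the
    approximants. The conclusion has the form that Fatou's lemma consumes: convergence almost
    everywhere and asymptotic upper bounds for both terms. *)
Lemma D22_energy lambda u : D22 a u -> exists (f : nat -> 'rV[R]_n -> R) (D B : R),
  [/\ forall k, test_fun0 (f k), {ae mu, forall x, (fun k => f k x) @ \oo --> u x},
    forall e, 0 < e -> \forall k \near \oo, wD a (f k) <= D + e /\ wB a (f k) <= B + e &
    energy a lambda u = (D + lambda * B)%:E].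
Proof.
move=> [mu_ [f [tf cf fu]]].
have wu : wlim (a - 4) f u by [].
have tB k l : test_fun0 (f k \- f l)%R by exact: test_fun0B.
have lapB k l : laplacian (f k \- f l) = (laplacian (f k) \- laplacian (f l)).
  by apply/funext => x; exact: laplacianB0.
have parB i k l : partial i (f k \- f l) = (partial i (f k) \- partial i (f l)).
  by apply/funext => x; apply: partialB; exact: test_fun0_diff.
have tl k : test_fun0 (laplacian (f k)) by exact: test_fun0_laplacian.
have tp i k : test_fun0 (partial i (f k)) by exact: test_fun0_partial.
have [G [sG [wG _ _]]] : exists G (s : nat -> nat),
    [/\ wlim a (fun k => laplacian (f k)) G, forall j, (j <= s j)%N &
    {ae mu, forall x, (fun j => laplacian (f (s j)) x) @ \oo --> G x}].
  apply: wlim_complete => // e e0; have [N NP] := cf e e0.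
  by exists N => k l Nk Nl; rewrite -lapB; exact: NP.
have /choice[g wg] : forall i, exists g, wlim (a - 2) (fun k => partial i (f k)) g.
  move=> i; have [||g [s [wg _ _]]] := @wlim_complete (a - 2) (fun k => partial i (f k)) => //.
    move=> e e0; have ge : 0 < gamma ^+ 2 * e by rewrite mulr_gt0// exprn_gt0.
    have [N NP] := cf _ ge; exists N => k l Nk Nl; rewrite -parB.
    have := NP k l Nk Nl; rewrite (wL2_sq_test _ (test_fun0_laplacian (tB k l))).
    rewrite (wL2_sq_test _ (test_fun0_partial i (tB k l))) !lte_fin => h.
    rewrite -(ltr_pM2l (_ : 0 < gamma ^+ 2)) ?exprn_gt0//.
    apply: le_lt_trans h; apply: le_trans (rellich gammaE gamma0 a2 (tB k l)).
    apply: ler_wpM2l; first exact: sqr_ge0.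
    apply: Int_le.
    - by apply: test_fun0_W; apply: test_fun0_sqr; exact: test_fun0_partial.
    - exact: test_fun0_wB.
    move=> x; apply: ler_wpM2l; first exact: W_ge0.
    by rewrite /grad2 (bigD1 i)//= lerDl; apply: sumr_ge0 => j _; exact: sqr_ge0.
  by exists g.
(* Membership in [D22] provides convergence in L^2 only. Completeness supplies a subsequence
   converging almost everywhere, with a limit u' that is then identified with u through test
   functions. *)
have [u' [s [wu' sj aeu']]] : exists u' (s : nat -> nat),
    [/\ wlim (a - 4) f u', forall j, (j <= s j)%N &
    {ae mu, forall x, (fun j => f (s j) x) @ \oo --> u' x}].
  apply: wlim_complete => // e e0.
  have ge : 0 < gamma ^+ 4 * e by rewrite mulr_gt0// exprn_gt0.
  have [N NP] := cf _ ge; exists N => k l Nk Nl.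
  have := NP k l Nk Nl; rewrite (wL2_sq_test _ (test_fun0_laplacian (tB k l))).
  rewrite (wL2_sq_test _ (tB k l)) !lte_fin => h.
  rewrite -(ltr_pM2l (_ : 0 < gamma ^+ 4)) ?exprn_gt0//.
  apply: le_lt_trans h; apply: le_trans (rellich gammaE gamma0 a2 (tB k l)).
  rewrite (exprD _ 2 2) -mulrA; apply: ler_wpM2l; first exact: sqr_ge0.
  exact: (hardy gammaE (tB k l)).
have uu' : {ae mu, forall x, u' x = u x}.
  apply: locint_ae_unique => [||phi tphi]; [exact: wlim_locint wu'|exact: wlim_locint wu|].
  rewrite -[RHS]mul1r; apply: (cvg_weak wu' wu) => // k.
  by rewrite mul1r.
have uG : is_weak_laplacian u G.
  split; first exact: wlim_locint wG.
  move=> phi tphi; rewrite -[RHS]mul1r.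
  apply: (cvg_weak wu wG) => //; first exact: test_fun0_laplacian.
  by move=> k; rewrite mul1r; exact: Int_laplacian_sym.
have ug i : is_weak_partial i u (g i).
  split; first exact: wlim_locint (wg i).
  move=> phi tphi; rewrite -[RHS]mulN1r.
  apply: (cvg_weak wu (wg i)) => //; first exact: test_fun0_partial.
  by move=> k; rewrite mulN1r; exact: Int_partial_byparts.
exists (fun k => f (s k)), (fine (wL2_sq a G)), (\sum_i fine (wL2_sq (a - 2) (g i))).
split => //.
- by apply: filterS2 uu' aeu' => x ->.
- move=> e e0.
  have near_s (P : nat -> Prop) : (\forall k \near \oo, P k) -> \forall k \near \oo, P (s k).
    by move=> [N _ NP]; exists N => // k /= Nk; apply: NP; exact: leq_trans (sj k).
  have hB i : \forall k \near \oo, Int (fun x => W (a - 2) x * partial i (f k) x ^+ 2) <=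
      fine (wL2_sq (a - 2) (g i)) + e / n%:R.
    by apply: (wlim_upper (wg i)); rewrite divr_gt0// ltr0n.
  have hB' : \forall k \near \oo, forall i, Int (fun x => W (a - 2) x * partial i (f k) x ^+ 2) <=
      fine (wL2_sq (a - 2) (g i)) + e / n%:R.
    have : \forall k \near \oo, forall i, i \in enum 'I_n -> Int (fun x => W (a - 2) x * partial i (f k) x ^+ 2) <=
      fine (wL2_sq (a - 2) (g i)) + e / n%:R.
      elim: (enum 'I_n) => [|i r IH]; first by apply: nearW.
      apply: filterS2 (hB i) IH => k h1 h2 j; rewrite inE => /orP[/eqP ->//|]; exact: h2.
    by apply: filterS => k h i; apply: h; rewrite mem_enum.
  apply: (near_s (fun k => wD a (f k) <= fine (wL2_sq a G) + e /\
    wB a (f k) <= \sum_i fine (wL2_sq (a - 2) (g i)) + e)).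
  apply: filterS2 (wlim_upper wG e0) hB' => k h1 h2; split => //.
  have -> : wB a (f k) = \sum_i Int (fun x => W (a - 2) x * partial i (f k) x ^+ 2).
    rewrite -Int_sum => [|i]; last by apply: test_fun0_W; exact: test_fun0_sqr.
    by apply: eq_Int => x; rewrite mulr_sumr.
  apply: le_trans (ler_sum _ (fun i _ => h2 i)) _.
  rewrite big_split/= sumr_const card_ord -[X in _ + X <= _]mulr_natr divfK//.
  by rewrite pnatr_eq0 -lt0n.
rewrite (energy_ae lambda uG ug) EFinD EFinM -sumEFin fineK; last first.
  by rewrite ge0_fin_numE ?wL2_sq_ge0// (wlim_fin wG).
congr (_ + _ * _)%E; apply: eq_bigr => i _.
by rewrite fineK// ge0_fin_numE ?wL2_sq_ge0// (wlim_fin (wg i)).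
Qed.

End weak_derivatives.

(** * Radial functions *)

Section compare_lebesgue.
Context {R : realType}.
Local Open Scope ereal_scope.
Notation leb := (@lebesgue_measure R).

(** If A has finite length, cover it by open intervals of total length below leb A + e/C and sum the
    hypothesis over the cover. *)
Lemma le_lebesgue (nu : {measure set (measurableTypeR R) -> \bar R}) (C : R) :
  (0 < C)%R ->
  (forall a b : R, (a < b)%R -> nu `]a, b[%classic <= (C * (b - a))%:E) ->
  forall A : set (measurableTypeR R), measurable A -> nu A <= C%:E * leb A.
Proof.
move=> C0 nuC A mA.
have [Aoo|Afin] := eqVneq (leb A) +oo.
  by rewrite Aoo gt0_muley ?lte_fin// leey.
have Af : leb A \is a fin_num by rewrite ge0_fin_numE// lt_neqAle Afin leey.
apply/lee_addgt0Pr => e e0.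
have eC : (0 < e / C)%R by rewrite divr_gt0.
have [F AF Fe] : exists2 F, open_itv_cover A F &
    \sum_(0 <= k <oo) wlength idfun (F k) < leb A + (e / C)%:E.
  have hA : leb A = ((wlength idfun)^* A)%mu by [].
  move: Af; rewrite hA outer_measure_open_itv_cover.
  by move=> /lb_ereal_inf_adherent-/(_ _ eC)[_/= [F]] AF <- Fe; exists F.
have [Fi Fc] := AF.
have mF k : @measurable _ (measurableTypeR R) (F k).
  by have [[a b] ->] := Fi k; exact: measurable_itv.
apply: (@le_trans _ _ (\sum_(0 <= k <oo) nu (F k))).
  by apply: (measure_sigma_subadditive nu).
apply: (@le_trans _ _ (\sum_(0 <= k <oo) (C%:E * wlength idfun (F k)))).
  apply: lee_nneseries => // k _.
  have [[a b] Fk] := Fi k; rewrite Fk /= wlength_itv/= lte_fin.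
  case: ltP => ab; first by have := nuC a b ab; rewrite EFinM EFinB.
  by rewrite set_itv_ge ?bnd_simp -?leNgt// measure0 mule0.
rewrite nneseriesZl => [|k _]; last first.
  have [[a b] Fk] := Fi k; rewrite Fk /= wlength_itv/= lte_fin.
  by case: ltP => // ab; rewrite -EFinB lee_fin subr_ge0 ltW.
apply: (@le_trans _ _ (C%:E * (leb A + (e / C)%:E))).
  by apply: lee_wpmul2l; [rewrite lee_fin ltW|exact: ltW].
have Ce : (C * (e / C) = e)%R by rewrite mulrC divfK// gt_eqF.
by rewrite -[in leRHS]Ce EFinM muleDr// fin_num_adde_defl.
Qed.

End compare_lebesgue.

(** * Volume in the variable |x|^n *)

Section polar.
Context {R : realType} {n : nat}.
Hypothesis n0 : (0 < n)%N.
Notation mu := (lebesgue_rV R n).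
Notation leb := (@lebesgue_measure R).

Definition eball (r : R) : set 'rV[R]_n := [set x | enorm x <= r].

Lemma measurable_eball r : measurable (eball r).
Proof.
rewrite (_ : eball r = enorm @^-1` `]-oo, r]%classic); last first.
  by apply/seteqP; split => x; rewrite /eball/= in_itv.
apply: measurable_preim; last exact: measurable_itv.
by apply: continuous_measurable_rV; exact: continuous_enorm.
Qed.

Lemma enormZ (r : R) (x : 'rV[R]_n) : 0 <= r -> enorm (r *: x) = r * enorm x.
Proof.
move=> r0; rewrite /enorm -{2}(ger0_norm r0) -sqrtr_sqr -sqrtrM ?sqr_ge0//.
by congr Num.sqrt; rewrite mulr_sumr; apply: eq_bigr => i _; rewrite mxE exprMn.
Qed.

Definition kappa : R := fine (mu (eball 1)).

Let eball1_fin : (mu (eball 1) < +oo)%E.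
Proof.
apply: (@le_lt_trans _ _ (mu (cube 1))).
  apply: le_measure; rewrite ?inE; [exact: measurable_eball|exact: measurable_cube|].
  by move=> x x1 i; exact: le_trans (ler_coord_enorm _ _) x1.
by rewrite lebesgue_cube// ltry.
Qed.

Lemma kappa_gt0 : 0 < kappa.
Proof.
have nR : 0 < n%:R :> R by rewrite ltr0n.
apply: fine_gt0; rewrite eball1_fin andbT.
apply: (@lt_le_trans _ _ (mu (cube n%:R^-1))).
  by rewrite lebesgue_cube ?invr_ge0// lte_fin exprn_gt0// mulrn_wgt0// invr_gt0.
apply: le_measure; rewrite ?inE; [exact: measurable_cube|exact: measurable_eball|].
move=> x xc; rewrite /eball /= -sqrtr1 ler_sqrt ?ler01//.
apply: (@le_trans _ _ (\sum_(i < n) n%:R^-1)).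
  apply: ler_sum => i _; rewrite -(real_normK (num_real (x 0 i))).
  apply: (@le_trans _ _ (n%:R^-1 ^+ 2)); first by rewrite lerXn2r ?nnegrE// xc.
  by rewrite expr2 ler_piMr ?invr_ge0// invf_le1// ler1n.
by rewrite sumr_const card_ord -[leLHS]mulr_natr mulVf// gt_eqF.
Qed.

Lemma lebesgue_eball r : 0 < r -> mu (eball r) = (kappa * r ^+ n)%:E.
Proof.
move=> r0; rewrite (lebesgue_affine 0 r0 (measurable_eball r)).
rewrite (_ : _ @^-1` _ = eball 1); last first.
  have E (e : R) : (r * e <= r) = (e <= 1) by rewrite -[leRHS]mulr1 ler_pM2l.
  by apply/seteqP; split => x; rewrite /eball /= addr0 (enormZ _ (ltW r0)) E.
by rewrite mulrC EFinM fineK// ge0_fin_numE.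
Qed.

Lemma lebesgue_shell r s : 0 < r -> r <= s ->
  mu [set x | r < enorm x <= s] = (kappa * (s ^+ n - r ^+ n))%:E.
Proof.
move=> r0 rs; have s0 : 0 < s by exact: lt_le_trans rs.
rewrite (_ : [set x | _] = eball s `\` eball r); last first.
  apply/seteqP; split => x; rewrite /eball /=.
    by move=> /andP[h1 h2]; split => //; apply/negP; rewrite -ltNge.
  by move=> [h1 /negP]; rewrite -ltNge h1 => ->.
have es := lebesgue_eball s0; have er := lebesgue_eball r0.
have fs : (mu (eball s) < +oo)%E by rewrite es ltry.
transitivity (mu (eball s) - mu (eball r))%E; last by rewrite es er -EFinB mulrBr.
rewrite measureD; [|exact: measurable_eball|exact: measurable_eball|exact: fs].
by rewrite setIidr// => x; rewrite /eball /= => /le_trans; apply.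
Qed.

(** A substitute for polar coordinates: in this variable the volume of R^n becomes [kappa] times
    Lebesgue measure on the half-line. *)
Definition enormn (x : 'rV[R]_n) : measurableTypeR R := enorm x ^+ n.

Lemma measurable_enormn : measurable_fun setT enormn.
Proof.
apply: measurable_funX; apply: continuous_measurable_rV; exact: continuous_enorm.
Qed.

Lemma root_exp (a : R) : 0 <= a -> exists2 r : R, 0 <= r & r ^+ n = a.
Proof.
move=> a0; exists (a `^ n%:R^-1); first exact: powR_ge0.
by rewrite -powR_mulrn ?powR_ge0// -powRrM mulVf ?powRr1// pnatr_eq0 -lt0n.
Qed.

Lemma lebesgue_enormn_shell a b : 0 < a -> a <= b ->
  mu (enormn @^-1` `]a, b]%classic) = (kappa * (b - a))%:E.
Proof.
move=> a0 ab; have [r r0 ra] := root_exp (ltW a0).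
have [s s0 sb] := root_exp (le_trans (ltW a0) ab).
have r1 : 0 < r by rewrite lt_neqAle r0 andbT; apply/eqP => rE; move: a0;
  rewrite -ra -rE expr0n gtn_eqF//= ltxx.
have rs : r <= s by rewrite -(ler_pXn2r n0) ?nnegrE// ra sb.
rewrite -ra -sb -lebesgue_shell//; congr (mu _).
apply/seteqP; split => x; rewrite /enormn /= in_itv/=.
  by rewrite ltr_pXn2r ?nnegrE ?enorm_ge0// ler_pXn2r ?nnegrE ?enorm_ge0.
by rewrite ltr_pXn2r ?nnegrE ?enorm_ge0// ler_pXn2r ?nnegrE ?enorm_ge0.
Qed.

Lemma le_enormn_law (A : set (measurableTypeR R)) : measurable A ->
  (mu (enormn @^-1` A) <= kappa%:E * leb A)%E.
Proof.
move=> mA.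
pose nu : {measure set (measurableTypeR R) -> \bar R} := pushforward mu enormn.
suff : (nu measurable_enormn A <= kappa%:E * leb A)%E by [].
apply: le_lebesgue mA; first exact: kappa_gt0.
move=> a b ab; have k0 := kappa_gt0.
rewrite -[leLHS]/(mu (enormn @^-1` `]a, b[%classic)).
have [b0|b0] := leP b 0.
  rewrite (_ : mu _ = 0%E); first by rewrite lee_fin mulr_ge0 ?ltW// subr_gt0.
  rewrite -[RHS](measure0 mu); congr (mu _); apply/seteqP; split => // x.
  rewrite /enormn /= in_itv/= => /andP[_ /lt_le_trans/(_ b0)].
  by rewrite ltNge exprn_ge0// enorm_ge0.
have [a0|a0] := leP a 0.
  have [s s0 sb] := root_exp (ltW b0).
  have s1 : 0 < s by rewrite lt_neqAle s0 andbT; apply/eqP => sE; move: b0;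
    rewrite -sb -sE expr0n gtn_eqF//= ltxx.
  apply: (@le_trans _ _ (mu (eball s))).
    apply: le_measure; rewrite ?inE; last 1 first.
    - move=> x; rewrite /enormn /eball /= in_itv/= -sb => /andP[_ xs].
      by rewrite -(ler_pXn2r n0) ?nnegrE ?enorm_ge0// ltW.
    - by apply: measurable_preim; [exact: measurable_enormn|exact: measurable_itv].
    - exact: measurable_eball.
  by rewrite lebesgue_eball// lee_fin sb ler_pM2l// lerBrDr gerDl.
apply: (@le_trans _ _ (mu (enormn @^-1` `]a, b]%classic))).
  apply: le_measure; rewrite ?inE.
  - by apply: measurable_preim; [exact: measurable_enormn|exact: measurable_itv].
  - by apply: measurable_preim; [exact: measurable_enormn|exact: measurable_itv].
  - by move=> x; rewrite /= !in_itv/= => /andP[-> /ltW].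
by rewrite lebesgue_enormn_shell// ltW.
Qed.

(** On the whole of ]a, T] there is equality, by the volume of a shell; the lower bound for A is the
    upper bound of [le_enormn_law] for its complement in ]a, T]. *)
Lemma ge_enormn_law (a T : R) (A : set (measurableTypeR R)) : 0 < a -> a <= T ->
  measurable A -> A `<=` `]a, T]%classic ->
  (kappa%:E * leb A <= mu (enormn @^-1` A))%E.
Proof.
move=> a0 aT mA sub; have k0 := kappa_gt0.
have mI : measurable (`]a, T]%classic : set (measurableTypeR R)) by exact: measurable_itv.
pose B : set (measurableTypeR R) := `]a, T]%classic `\` A.
have mB : measurable B by exact: measurableD.
have IE : `]a, T]%classic = A `|` B by rewrite /B setDUK.
have dAB : A `&` B = set0 by rewrite /B setDIK.
have lI : leb `]a, T]%classic = (T - a)%:E.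
  rewrite lebesgue_measure_itv/= lte_fin; case: ltP => [_|]; first by rewrite -EFinB.
  by move=> Ta; rewrite (_ : T = a) ?subrr//; apply/eqP; rewrite eq_le Ta aT.
have lAB : (leb A + leb B = (T - a)%:E)%E by rewrite -lI IE measureU.
have mt := measurable_preim measurable_enormn.
have muI : (mu (enormn @^-1` A) + mu (enormn @^-1` B) = (kappa * (T - a))%:E)%E.
  rewrite -(lebesgue_enormn_shell a0 aT) IE preimage_setU measureU//; try exact: mt.
  by rewrite -preimage_setI dAB preimage_set0.
have fA : (leb A <= (T - a)%:E)%E by rewrite -lAB leeDl.
have fB : (leb B <= (T - a)%:E)%E by rewrite -lAB leeDr.
have finA : leb A \is a fin_num by rewrite ge0_fin_numE// (le_lt_trans fA)// ltry.
have finB : leb B \is a fin_num by rewrite ge0_fin_numE// (le_lt_trans fB)// ltry.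
have hB := le_enormn_law mB.
have gA : (mu (enormn @^-1` A) <= (kappa * (T - a))%:E)%E by rewrite -muI leeDl.
have gB : (mu (enormn @^-1` B) <= (kappa * (T - a))%:E)%E by rewrite -muI leeDr.
have finmA : mu (enormn @^-1` A) \is a fin_num.
  by rewrite ge0_fin_numE// (le_lt_trans gA)// ltry.
have finmB : mu (enormn @^-1` B) \is a fin_num.
  by rewrite ge0_fin_numE// (le_lt_trans gB)// ltry.
move: lAB muI hB; rewrite -(fineK finA) -(fineK finB) -(fineK finmA) -(fineK finmB).
rewrite -!EFinD -!EFinM !lee_fin => -[lAB] [muI] hB.
have : kappa * (T - a) = kappa * fine (leb A) + kappa * fine (leb B).
  by rewrite -lAB mulrDr.
by rewrite -muI; move: hB; lra.
Qed.

End polar.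

Section sections.
Context {R : realType}.
Notation leb := (@lebesgue_measure R).

(** By Tonelli almost every section of Z is null, and a small cube around the origin has positive
    measure, so it contains a suitable y. *)
Lemma good_section (m : nat) (Z : set 'rV[R]_m.+1) (delta : R) :
  measurable Z -> lebesgue_rV R m.+1 Z = 0%E -> 0 < delta ->
  exists y : 'rV[R]_m, enorm y < delta /\ leb (ysection (consv @^-1` Z) y) = 0%E.
Proof.
move=> mZ Z0 d0.
pose A : set (measurableTypeR R * 'rV[R]_m) := consv @^-1` Z.
have mA : measurable A by apply: measurable_preim mZ; exact: measurable_consv.
have iG : (\int[lebesgue_rV R m]_y (leb \o ysection A) y = 0)%E.
  rewrite -indic_fubini_tonelli_GE// -indic_fubini_tonelli//.
  by rewrite indic_fubini_tonelli_FE//.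
have mG : measurable_fun setT (leb \o ysection A) by exact: measurable_fun_ysection.
have : ae_eq (lebesgue_rV R m) setT (leb \o ysection A) (cst 0%E).
  apply/ae_eq_integral_abs => //; rewrite -[RHS]iG.
  by apply: eq_integral => y _; rewrite gee0_abs.
move=> [N [mN N0 NP]].
(* A point of the cube of half-side e has squared norm at most m e^2 < (m+1)^2 e^2 = delta^2, also
   for m = 0. *)
pose e := delta / m.+1%:R.
have e0 : 0 < e by rewrite divr_gt0.
have [cN|] := pselect (@cube R m e `<=` N).
  have : (lebesgue_rV R m (cube e) <= lebesgue_rV R m N)%E.
    by apply: le_measure; rewrite ?inE//; exact: measurable_cube.
  rewrite N0 (lebesgue_cube _ (ltW e0)) lee_fin leNgt.
  by rewrite exprn_gt0// mulrn_wgt0.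
move=> /existsNP[y /not_implyP[yc yN]]; exists y; split; last first.
  by apply: contrapT => h; apply: yN; apply: NP => /(_ I).
rewrite -(gtr0_norm d0) -sqrtr_sqr ltr_sqrt ?exprn_gt0//.
apply: (@le_lt_trans _ _ (\sum_(i < m) e ^+ 2)).
  apply: ler_sum => i _; rewrite -(real_normK (num_real (y 0 i))).
  by apply: lerXn2r; rewrite ?nnegrE ?normr_ge0 ?(ltW e0)//; exact: yc.
rewrite sumr_const card_ord -mulr_natl.
have dE : delta = e * m.+1%:R by rewrite /e divfK// pnatr_eq0.
have e20 : 0 < e ^+ 2 by rewrite exprn_gt0.
have -> : delta ^+ 2 = m.+1%:R ^+ 2 * e ^+ 2 by rewrite dE exprMn mulrC.
rewrite (ltr_pM2r e20) -natrX ltr_nat.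
by rewrite expnS expn1 mulSn ltnS leq_addr.
Qed.

End sections.

Section radial_functions.
Context {R : realType} {n : nat}.
Hypothesis n0 : (0 < n)%N.
Notation mu := (lebesgue_rV R n).
Notation leb := (@lebesgue_measure R).
Let k0 : 0 < @kappa R n := kappa_gt0 n0.

Lemma lerX_sub (r s K : R) : 0 <= r -> r <= s -> s <= K ->
  s ^+ n - r ^+ n <= n%:R * K ^+ n.-1 * (s - r).
Proof.
move=> r0 rs sK; have s0 : 0 <= s by exact: le_trans rs.
rewrite subrXX mulrC; apply: ler_wpM2r; first by rewrite subr_ge0.
apply: (@le_trans _ _ (\sum_(i < n) K ^+ n.-1)).
  apply: ler_sum => i _.
  have -> : n.-1 = (n.-1 - i + i)%N by rewrite subnK// -ltnS prednK// ltn_ord.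
  rewrite addnK exprD; have K0 : 0 <= K by exact: le_trans sK.
  apply: ler_pM; rewrite ?exprn_ge0//.
    by rewrite /= lerXn2r ?nnegrE.
  by apply: lerXn2r; rewrite ?nnegrE//; exact: le_trans sK.
by rewrite sumr_const card_ord -[leLHS]mulr_natl.
Qed.

(* The first coordinate of the point at distance |x| from 0 on a line R x {y}, |y| = c. *)
Definition leg (c : R) (x : 'rV[R]_n) : measurableTypeR R := Num.sqrt (enorm x ^+ 2 - c ^+ 2).

Lemma measurable_leg c : measurable_fun setT (leg c).
Proof.
apply: continuous_measurable_rV => x.
apply: (@continuous_comp _ _ _ (fun x => enorm x ^+ 2 - c ^+ 2) Num.sqrt).
  apply: continuousB; last exact: cst_continuous.
  by apply: continuousM; exact: continuous_enorm.
exact: sqrt_continuous.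
Qed.

Definition shell (d K : R) : set 'rV[R]_n := [set x | d < enorm x <= K].

Lemma measurable_shell d K : measurable (shell d K).
Proof.
rewrite (_ : shell d K = enorm @^-1` `]d, K]%classic); last first.
  by apply/seteqP; split => x; rewrite /shell /= in_itv.
apply: measurable_preim; last exact: measurable_itv.
by apply: continuous_measurable_rV; exact: continuous_enorm.
Qed.

(** On the shell the law of [leg] has density at most C: inverting, |x| = sqrt(t^2 + c^2) is a
    1-Lipschitz function of t = [leg] c x, and the volume [kappa] |x|^n is Lipschitz in |x| <= K
    with constant n K^(n-1) [kappa]. *)
Lemma null_leg (c d K : R) (N : set (measurableTypeR R)) : 0 <= c -> c < d -> d < K ->
  measurable N -> leb N = 0%E -> mu (leg c @^-1` N `&` shell d K) = 0%E.
Proof.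
move=> c0 cd dK mN N0; have d0 : 0 < d by exact: le_lt_trans cd.
have mD := measurable_shell d K.
pose nu : {measure set (measurableTypeR R) -> \bar R} := pushforward (mrestr mu mD) (leg c).
have K0 : 0 < K by exact: lt_trans dK.
pose C := @kappa R n * (n%:R * K ^+ n.-1).
have C0 : 0 < C by rewrite !mulr_gt0 ?ltr0n ?exprn_gt0.
have : (nu (measurable_leg c) N <= C%:E * leb N)%E.
  apply: le_lebesgue mN => // a b ab.
  rewrite -[leLHS]/(mu (leg c @^-1` `]a, b[%classic `&` shell d K)).
  have [b0|b0] := ltP b 0.
    rewrite (_ : _ `&` _ = set0) ?measure0; first by rewrite lee_fin mulr_ge0 ?ltW// subr_gt0.
    apply/seteqP; split => // x [/=]; rewrite in_itv/= => /andP[_ xb] _.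
    by move: (lt_trans xb b0); rewrite ltNge sqrtr_ge0.
  pose a' := Num.max a 0.
  have a'0 : 0 <= a' by rewrite le_max lexx orbT.
  pose r1 := Num.sqrt (a' ^+ 2 + c ^+ 2); pose r2 := Num.sqrt (b ^+ 2 + c ^+ 2).
  pose r := Num.max d r1; pose s := Num.min K r2.
  have sub : leg c @^-1` `]a, b[%classic `&` shell d K `<=` [set x | r < enorm x <= s].
    move=> x [/=]; rewrite in_itv/= => /andP[ax xb] /andP[dx xK].
    have e0 := enorm_ge0 x.
    have ec : c ^+ 2 < enorm x ^+ 2 by rewrite ltr_pXn2r ?nnegrE//; exact: lt_trans dx.
    have tE : leg c x ^+ 2 = enorm x ^+ 2 - c ^+ 2 by rewrite sqr_sqrtr// subr_ge0 ltW.
    have t0 : 0 < leg c x by rewrite sqrtr_gt0 subr_gt0.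
    have eE : enorm x = Num.sqrt (leg c x ^+ 2 + c ^+ 2).
      by rewrite tE subrK sqrtr_sqr ger0_norm.
    have at' : a' < leg c x by rewrite /a' gt_max ax t0.
    rewrite gt_max le_min dx xK /= eE; apply/andP; split.
      rewrite ltr_sqrt; last by rewrite ltr_pwDl ?exprn_gt0// sqr_ge0.
      by rewrite ltrD2r ltr_pXn2r ?nnegrE// ltW.
    apply: ler_wsqrtr; rewrite lerD2r; apply: lerXn2r; rewrite ?nnegrE//; exact: ltW.
  have [rs|sr] := leP r s; last first.
    rewrite (_ : mu _ = 0%E); first by rewrite lee_fin mulr_ge0 ?ltW// subr_gt0.
    rewrite -[RHS](measure0 mu); congr (mu _); apply/seteqP; split => // x.
    by move=> /sub /andP[h1 h2]; move: (lt_le_trans h1 h2); rewrite ltNge ltW.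
  have r0 : 0 < r by rewrite lt_max d0.
  have sK : s <= K by rewrite ge_min lexx.
  apply: (@le_trans _ _ (mu [set x | r < enorm x <= s])).
    apply: le_measure; rewrite ?inE//.
      by apply: measurableI => //; apply: measurable_preim => //; exact: measurable_leg.
    exact: measurable_shell.
  rewrite (lebesgue_shell r0 rs) lee_fin /C -mulrA ler_pM2l//.
  apply: le_trans (lerX_sub (ltW r0) rs sK) _.
  rewrite ler_pM2l; last by rewrite mulr_gt0 ?ltr0n ?exprn_gt0.
  have ar1 : r1 <= r by rewrite le_max lexx orbT.
  have sr2 : s <= r2 by rewrite ge_min lexx orbT.
  have r10 : 0 <= r1 := sqrtr_ge0 _.
  have r1E : r1 ^+ 2 = a' ^+ 2 + c ^+ 2 by rewrite sqr_sqrtr// addr_ge0 ?sqr_ge0.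
  have r2E : r2 ^+ 2 = b ^+ 2 + c ^+ 2 by rewrite sqr_sqrtr// addr_ge0 ?sqr_ge0.
  have aa' : a <= a' by rewrite le_max lexx.
  have a'r1 : a' <= r1.
    by rewrite -(ler_pXn2r (ltn0Sn 1)) ?nnegrE// r1E lerDl sqr_ge0.
  have br2 : b <= r2.
    by rewrite -(ler_pXn2r (ltn0Sn 1)) ?nnegrE ?sqrtr_ge0// r2E lerDl sqr_ge0.
  have a'b : a' <= b by rewrite /a' ge_max b0 ltW.
  apply: (@le_trans _ _ (b - a')); last by lra.
  apply: (@le_trans _ _ (r2 - r1)); first by lra.
  have [r12|r12] := leP r2 r1; first lra.
  have : (r2 - r1) * (r2 + r1) = (b - a') * (b + a') by move: r1E r2E; nra.
  nra.
by rewrite N0 mule0 => h; apply/eqP; rewrite -measure_le0.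
Qed.

End radial_functions.

Lemma sqr_enorm_consv (R : realType) (m : nat) (t : R) (y : 'rV[R]_m) :
  enorm (consv (t, y)) ^+ 2 = t ^+ 2 + enorm y ^+ 2.
Proof.
rewrite !sqr_enorm /sqn big_ord_recl consv0; congr (_ + _).
by apply: eq_bigr => i _; rewrite consv_lift.
Qed.

(* The profile of a radial function need not be measurable. It is replaced by the values
   of u on a line R x {y}, |y| < delta, that meets the exceptional set in a null set. *)
Lemma radial_measurable (R : realType) (n : nat) (u : 'rV[R]_n -> R) (delta : R) :
  (0 < n)%N -> measurable_fun setT u -> radial u -> 0 < delta ->
  exists2 g : measurableTypeR R -> R, measurable_fun setT g &
    {ae lebesgue_rV R n, forall x, delta < enorm x -> u x = g (enorm x)}.
Proof.
case: n u => // m u _ mu [g [Z [mZ Z0 ZP]]] d0.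
have [y [yd yZ]] := good_section mZ Z0 d0.
set N := ysection _ y in yZ.
have mN : measurable N.
  apply: measurable_ysection; apply: measurable_preim mZ; exact: measurable_consv.
pose c := enorm y; have c0 : 0 <= c := enorm_ge0 y.
pose h (s : measurableTypeR R) : R := u (consv (Num.sqrt (s ^+ 2 - c ^+ 2), y)).
have mh : measurable_fun setT h.
  apply: (measurableT_comp mu); apply: (measurableT_comp measurable_consv).
  apply/measurable_fun_pairP; split => /=; last exact: measurable_cst.
  apply: continuous_measurable_fun => s.
  apply: (@continuous_comp _ _ _ (fun s : R => s ^+ 2 - c ^+ 2) Num.sqrt).
    by apply: continuousB; [exact: exprn_continuous|exact: cst_continuous].
  exact: sqrt_continuous.
exists h => //.
(* If |x| > delta and x is in neither Z nor B, then the point of the line at the same distance from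
   0 is outside Z too, and u takes the value g(|x|) at both points. The shells exhaust |x| >
   delta. *)
pose B := \bigcup_k (leg c @^-1` N `&` shell delta (delta + k.+1%:R)) : set 'rV[R]_m.+1.
have mL k : measurable (leg c @^-1` N `&` shell delta (delta + k.+1%:R) : set 'rV[R]_m.+1).
  apply: measurableI; last exact: measurable_shell.
  apply: measurable_preim mN; exact: measurable_leg.
have nB : (lebesgue_rV R m.+1).-negligible B.
  apply: negligible_bigcup => k; exists (leg c @^-1` N `&` shell delta (delta + k.+1%:R)).
  by split => //; apply: null_leg => //; rewrite ltrDl.
have nZ : (lebesgue_rV R m.+1).-negligible Z by exists Z; split.
apply: negligibleS (negligibleU nZ nB).
move=> x hx; apply: contrapT => /not_orP[xZ xB]; apply: hx => dx.
have ec : c ^+ 2 <= enorm x ^+ 2.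
  by apply: lerXn2r; rewrite ?nnegrE ?enorm_ge0// ltW// (lt_trans yd).
have legE : leg c x ^+ 2 = enorm x ^+ 2 - c ^+ 2 by rewrite sqr_sqrtr// subr_ge0.
have xN : ~ N (leg c x).
  move=> Nx; apply: xB; exists (Num.bound (enorm x - delta)) => //; split => //.
  rewrite /shell /= dx -lerBlDl; apply/ltW/(lt_le_trans (archi_boundP _)).
    by rewrite subr_ge0 ltW.
  by rewrite ler_nat.
have -> : u x = g (enorm x) by apply: contrapT => h'; apply: xZ; apply: ZP.
have E : enorm (consv (leg c x, y)) = enorm x.
  apply/eqP; rewrite -(eqrXn2 (ltn0Sn 1)) ?enorm_ge0//.
  by rewrite sqr_enorm_consv legE subrK.
rewrite /h -/(leg c x) -E; apply/esym; apply: contrapT => h'; apply: xN.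
by rewrite /N ysectionE /=; apply: ZP.
Qed.

Lemma measurable_bump (R : realType) (n : nat) (m L : R) :
  measurable_fun setT (bump m L : 'rV[R]_n -> R).
Proof.
apply: (@measurableT_comp _ _ _ _ _ _ (fun t : R => (1 + t ^+ 2)^-1)
  _ (fun x : 'rV[R]_n => (W n%:R x - m) / L)); last first.
  apply: measurable_funM => //; apply: measurable_funB => //; exact: measurable_W.
apply: continuous_measurable_fun => t.
apply: (@continuousV _ _ (fun t : R => 1 + t ^+ 2)).
  by rewrite gt_eqF// ltr_pwDl// sqr_ge0.
by apply: continuousD; [exact: cst_continuous|exact: exprn_continuous].
Qed.

(** * From slab integrals to a pointwise bound *)

Section radial_sup.
Context {R : realType} {n : nat}.
Hypothesis n0 : (0 < n)%N.
Notation mu := (lebesgue_rV R n).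
Notation leb := (@lebesgue_measure R).
Variables (b K : R) (u : 'rV[R]_n -> R).
Hypotheses (K0 : 0 < K) (mu_ : measurable_fun setT u) (ru : radial u).

Let w x : \bar R := (W b x * u x ^+ 2)%:E.

Let mw : measurable_fun setT w.
Proof. exact: measurable_wsq. Qed.

Let w0 x : (0 <= w x)%E.
Proof. exact: wsq_ge0. Qed.

Hypothesis slab : forall m L : R, 0 < L ->
  (\int[mu]_x (W b x * bump m L x * u x ^+ 2)%:E <= (K * L)%:E)%E.

Let k0 : 0 < @kappa R n := kappa_gt0 n0.

Let law (A : set (measurableTypeR R)) : measurable A ->
  (\int[mu]_(x in enormn @^-1` A) w x <= (5 / 4 * K)%:E * leb A)%E.
Proof.
move=> mA.
pose nu : {measure set (measurableTypeR R) -> \bar R} :=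
  pushforward (density_measure mu mw w0) enormn.
have C0 : 0 < 5 / 4 * K by rewrite mulr_gt0// divr_gt0.
apply: (@le_lebesgue R (nu measurable_enormn) (5 / 4 * K) C0 _ A mA) => c d cd.
rewrite -[leLHS]/(\int[mu]_(x in enormn @^-1` `]c, d[%classic) w x)%E.
have mI : measurable (enormn @^-1` `]c, d[%classic : set 'rV[R]_n).
  by apply: measurable_preim; [exact: measurable_enormn|exact: measurable_itv].
(* With these values ((|x|^n - m)/L)^2 <= 1/4 on the interval, so the bump is at least 4/5 there;
   hence the factor 5/4. *)
pose m := (c + d) / 2; pose L := d - c.
have L0 : 0 < L by rewrite subr_gt0.
pose h (x : 'rV[R]_n) : \bar R := (5 / 4 * (W b x * bump m L x * u x ^+ 2))%:E.
have bump0 x : 0 <= W b x * bump m L x * u x ^+ 2.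
  by apply: mulr_ge0; [apply: mulr_ge0; [exact: W_ge0|exact: bump_ge0]|exact: sqr_ge0].
have mbump : measurable_fun setT (fun x : 'rV[R]_n => W b x * bump m L x * u x ^+ 2).
  apply: measurable_funM; last exact: measurable_funX.
  by apply: measurable_funM; [exact: measurable_W|exact: measurable_bump].
have mh : measurable_fun setT h by apply/measurable_EFinP; exact: measurable_funM.
apply: (@le_trans _ _ (\int[mu]_x h x)%E); last first.
  rewrite /h; under eq_integral do rewrite EFinM.
  rewrite ge0_integralZl//; [|exact/measurable_EFinP|by move=> x _; rewrite lee_fin].
  rewrite (_ : 5 / 4 * K * (d - c) = 5 / 4 * (K * L)); last by rewrite mulrA.
  by rewrite [leRHS]EFinM; apply: lee_wpmul2l; [rewrite lee_fin divr_ge0|exact: slab].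
apply: (@le_trans _ _ (\int[mu]_(x in enormn @^-1` `]c, d[%classic) h x)%E).
  apply: ge0_le_integral => //.
  - exact: measurable_funTS.
  - exact: measurable_funTS.
  move=> x; rewrite /= in_itv/= => /andP[xc xd].
  rewrite /h /w lee_fin.
  have wu : 0 <= W b x * u x ^+ 2 by rewrite mulr_ge0 ?W_ge0 ?sqr_ge0.
  suff hb : 4 / 5 <= bump m L x.
    rewrite [W b x * _ * _]mulrAC; move: hb wu.
    by set p := bump _ _ _; set z := W b x * _; nra.
  rewrite /bump /W powR_mulrn ?enorm_ge0// -/(enormn x).
  have t2 : ((enormn x - m) / L) ^+ 2 <= 1 / 4.
    rewrite expr_div_n ler_pdivrMr ?exprn_gt0// /m /L.
    by move: xc xd; set t := enormn x; nra.
  rewrite -[leLHS]invrK lef_pV2 ?posrE ?ltr_pwDl ?sqr_ge0// ?invf_div.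
  by move: t2; lra.
apply: ge0_subset_integral => //.
by move=> x _; rewrite /h lee_fin mulr_ge0// divr_ge0.
Qed.

(** In the variable |x|^n the measure |x|^b u^2 dx has density at most 5K/4, while dx has density
    [kappa]. Since |x|^b u^2 is itself a function of |x|^n, the set A of radii where it exceeds
    2K/[kappa] satisfies 2K leb A <= (5K/4) leb A and is null. *)
Lemma radial_sup : {ae mu, forall x, W b x * u x ^+ 2 <= 2 * K / @kappa R n}.
Proof.
pose t := 2 * K / @kappa R n.
pose E (k : nat) : set 'rV[R]_n := [set x | k.+1%:R^-1 < enorm x <= k.+1%:R /\
  t < W b x * u x ^+ 2].
have nE k : mu.-negligible (E k).
  pose d : R := k.+1%:R^-1; have d0 : 0 < d by rewrite invr_gt0 ltr0n.
  have [g mg [N [mN N0 NP]]] := radial_measurable n0 mu_ ru d0.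
  (* The density as a function of r = |x|^n, with the measurable profile g. Restricting A to a
     bounded interval away from 0 makes its length finite. *)
  pose h (r : measurableTypeR R) : R := (r `^ (b / n%:R)) * g (r `^ n%:R^-1) ^+ 2.
  have mh : measurable_fun setT h.
    apply: measurable_funM; first exact: measurable_powR.
    apply: measurable_funX; apply: (measurableT_comp mg); exact: measurable_powR.
  pose A : set (measurableTypeR R) :=
    `]d ^+ n, k.+1%:R ^+ n]%classic `&` h @^-1` `]t, +oo[%classic.
  have mA : measurable A.
    apply: measurableI; first exact: measurable_itv.
    by apply: measurable_preim mh _; exact: measurable_itv.
  have dn0 : 0 < d ^+ n by rewrite exprn_gt0.
  have dk : d ^+ n <= k.+1%:R ^+ n.
    apply: lerXn2r; rewrite ?nnegrE ?(ltW d0)//.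
    by apply: (@le_trans _ _ 1); rewrite ?invf_le1 ?ltr0n// ler1n.
  have hE x : ~ N x -> d < enorm x -> h (enormn x) = W b x * u x ^+ 2.
    move=> xN dx; rewrite /h /enormn.
    have -> : enorm x ^+ n = enorm x `^ n%:R by rewrite powR_mulrn// enorm_ge0.
    rewrite -!powRrM.
    have nn0 : n%:R != 0 :> R by rewrite pnatr_eq0 -lt0n.
    have -> : n%:R * (b / n%:R) = b by rewrite mulrC divfK.
    rewrite divff// powRr1 ?enorm_ge0//.
    by congr (_ * _ ^+ 2); apply/esym; apply: contrapT => H; apply: xN; apply: NP => /(_ dx).
  have m1 : measurable (enormn @^-1` A : set 'rV[R]_n).
    by apply: measurable_preim => //; exact: measurable_enormn.
  have k_0 : (0 <= (@kappa R n)%:E)%E by rewrite lee_fin ltW.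
  have t0 : 0 < t by rewrite divr_gt0// mulr_gt0.
  have lA : leb A = 0%E.
    have sub : A `<=` `]d ^+ n, k.+1%:R ^+ n]%classic by move=> r [].
    have h1 := ge_enormn_law n0 dn0 dk mA sub.
    have h2 := law mA.
    have h3 : (t%:E * mu (enormn @^-1` A) <= \int[mu]_(x in enormn @^-1` A) w x)%E.
      rewrite -integral_cst//.
      apply: ae_ge0_le_integral => //.
      - by move=> x _; rewrite lee_fin ltW.
      - exact: measurable_funTS.
      exists N; split => // x; rewrite /= => /not_implyP[[]]; rewrite /= !in_itv/= andbT.
      move=> /andP[xd _] tx xw; apply: contrapT => xN; apply: xw.
      rewrite /w -hE//; first by rewrite lee_fin ltW.
      by move: xd; rewrite /enormn ltr_pXn2r ?nnegrE ?enorm_ge0// ltW.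
    have fA : leb A \is a fin_num.
      rewrite ge0_fin_numE//; apply: (@le_lt_trans _ _ (leb `]d ^+ n, k.+1%:R ^+ n]%classic)).
        by apply: le_measure; rewrite ?inE//; exact: measurable_itv.
      by rewrite lebesgue_measure_itv/=; case: ifP => _; rewrite -?EFinB ltry.
    have : ((t * @kappa R n)%:E * leb A <= (5 / 4 * K)%:E * leb A)%E.
      rewrite EFinM -muleA; apply: le_trans h2; apply: le_trans h3.
      by apply: lee_wpmul2l => //; rewrite lee_fin ltW.
    rewrite /t divfK ?gt_eqF// -(fineK fA) -!EFinM lee_fin => hK; congr EFin.
    have : 0 <= fine (leb A) by rewrite fine_ge0.
    by move: hK K0; set z := fine _; nra.
  have nA : mu.-negligible (enormn @^-1` A : set 'rV[R]_n).
    exists (enormn @^-1` A); split => //; apply/eqP; rewrite -measure_le0.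
    by have := le_enormn_law n0 mA; rewrite lA mule0.
  have nN : mu.-negligible N by exists N; split.
  apply: negligibleS (negligibleU nA nN).
  move=> x [/andP[dx xk] tx]; have [|xN] := pselect (N x); [by right|left].
  split; rewrite /= in_itv/=; last by rewrite andbT hE.
  rewrite /enormn ltr_pXn2r ?nnegrE ?enorm_ge0 ?(ltW d0)// dx /=.
  by apply: lerXn2r => //; rewrite nnegrE ?enorm_ge0.
have := ae_neq0 R n0; move=> h0.
apply: negligibleS (negligibleU (negligible_bigcup nE) h0).
move=> x /negP; rewrite -ltNge => tx.
have [x0|] := pselect (x != 0); [left|by right].
have ex : 0 < enorm x by rewrite enorm_gt0.
exists (maxn (Num.bound (enorm x)) (Num.bound (enorm x)^-1)) => //; split => //.
set M := maxn _ _.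
have hM (y : R) : 0 < y -> (Num.bound y <= M)%N -> y < M.+1%:R.
  move=> y0 yM; apply: lt_le_trans (archi_boundP (ltW y0)) _.
  by rewrite ler_nat; exact: leqW.
apply/andP; split; last by apply/ltW/hM => //; exact: leq_maxl.
rewrite -[ltRHS]invrK ltf_pV2 ?posrE ?invr_gt0//.
by apply: hM; rewrite ?invr_gt0//; exact: leq_maxr.
Qed.

End radial_sup.

Section radial_lower.
Context {R : realType} {n : nat}.
Hypothesis n0 : (0 < n)%N.
Notation mu := (lebesgue_rV R n).

Lemma EFin_Int (f : 'rV[R]_n -> R) : test_fun0 f ->
  (\int[mu]_x (f x)%:E)%E = (Int f)%:E.
Proof.
move=> tf; rewrite /Int /Rintegral fineK//.
by have := test_fun0_integrable tf => /integrable_fin_num => /(_ measurableT).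
Qed.

Definition wpow (b q : R) (u : 'rV[R]_n -> R) : \bar R :=
  (\int[mu]_x (W b x * `|u x| `^ q)%:E)%E.

Lemma measurable_wpow (b q : R) (u : 'rV[R]_n -> R) : measurable_fun setT u ->
  measurable_fun setT (fun x => (W b x * `|u x| `^ q)%:E).
Proof.
move=> mf; apply/measurable_EFinP; apply: measurable_funM; first exact: measurable_W.
by apply: (measurableT_comp (measurable_powR q)); exact: measurableT_comp.
Qed.

Lemma wpow_integrand_ge0 (b q : R) (u : 'rV[R]_n -> R) x : (0 <= (W b x * `|u x| `^ q)%:E)%E.
Proof. by rewrite lee_fin mulr_ge0 ?W_ge0 ?powR_ge0. Qed.

Lemma wpow_ge0 (b q : R) (u : 'rV[R]_n -> R) : (0 <= wpow b q u)%E.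
Proof. by apply: integral_ge0 => x _; exact: wpow_integrand_ge0. Qed.

Lemma wpow_gt0 (b q : R) (u : 'rV[R]_n -> R) : measurable_fun setT u -> nontrivial u -> (0 < wpow b q u)%E.
Proof.
move=> mf nt; rewrite lt_neqAle wpow_ge0 andbT; apply/eqP => E; apply: nt.
have : ae_eq mu setT (fun x => (W b x * `|u x| `^ q)%:E) (cst 0%E).
  apply/(ae_eq_integral_abs _ measurableT (measurable_wpow b q mf)).
  by rewrite E; apply: eq_integral => x _; rewrite gee0_abs// wpow_integrand_ge0.
apply: filterS2 (ae_neq0 R n0) => x x0 /(_ I) [] /eqP.
rewrite mulf_eq0 gt_eqF ?W_gt0//= powR_eq0 normr_eq0 => /andP[/eqP].
done.
Qed.

Variables (a gamma : R) (u : 'rV[R]_n -> R) (f : nat -> 'rV[R]_n -> R) (B : R).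
Hypotheses (gammaE : gamma * 2 = n%:R - 4 + a) (gamma_ge : 1 / 4 <= gamma).
Hypotheses (mu_ : measurable_fun setT u) (ru : radial u).
Hypothesis tf : forall k, test_fun0 (f k).
Hypothesis fu : {ae mu, forall x, f k x @[k --> \oo] --> u x}.
Hypothesis fB : forall e, 0 < e -> \forall k \near \oo, wB a (f k) <= B + e.

Let gamma0 : 0 < gamma. Proof. by apply: lt_le_trans gamma_ge. Qed.

Let fatou_sq (w : 'rV[R]_n -> R) (c : R) : measurable_fun setT w -> (forall x, 0 <= w x) ->
  (forall k, test_fun0 (fun x => w x * f k x ^+ 2)) ->
  (\forall k \near \oo, Int (fun x => w x * f k x ^+ 2) <= c) ->
  (\int[mu]_x (w x * u x ^+ 2)%:E <= c%:E)%E.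
Proof.
move=> mw w0 tw wc.
apply: (@fatou_ae _ _ _ mu (fun k x => (w x * f k x ^+ 2)%:E)).
- by move=> k; apply/measurable_EFinP; exact: test_fun0_measurable.
- by apply/measurable_EFinP; apply: measurable_funM => //; exact: measurable_funX.
- by move=> k x; rewrite lee_fin mulr_ge0// sqr_ge0.
- by move=> x; rewrite lee_fin mulr_ge0// sqr_ge0.
- apply: filterS fu => x hx; apply: cvg_EFin; first by near=> k.
  by apply: cvgM; [exact: cvg_cst|apply: cvgM].
by apply: filterS wc => k wc; rewrite EFin_Int// lee_fin.
Unshelve. all: by end_near. Qed.

(** The pointwise bound costs 4 pi / (n [kappa] gamma) <= 16 pi / (n [kappa]) and Hardy costs
    1/gamma^2 <= 16. Both use gamma >= 1/4, so the constant depends on n alone. *)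
Definition radial_const : R := Num.max 1 (16 * pi / (n%:R * @kappa R n)).

Let nR : 0 < n%:R :> R. Proof. by rewrite ltr0n. Qed.

Lemma radial_const_ge1 : 1 <= radial_const.
Proof. by rewrite le_max lexx. Qed.

Lemma radial_wB_ge0 : 0 <= B.
Proof.
rewrite leNgt; apply/negP => B0.
have e0 : 0 < - B / 2 by rewrite divr_gt0// oppr_gt0.
have [k _ /(_ k (leqnn k))] := fB e0.
have : 0 <= wB a (f k) by apply: Int_ge0 => x; rewrite mulr_ge0 ?W_ge0 ?grad2_ge0.
by move: B0; lra.
Qed.

Lemma radial_lower (q : R) : 2 < q ->
  (wpow (- n%:R + q * gamma) q u `^ (2 / q) <= (16 * radial_const * B)%:E)%E.
Proof.
move=> q2.
(* The room e makes B + e positive, as [radial_sup] asks for K > 0 while B may vanish. *)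
suff H (e : R) : 0 < e -> (wpow (- n%:R + q * gamma) q u `^ (2 / q) <=
    (16 * radial_const * (B + e))%:E)%E.
  have M0 : 0 < 16 * radial_const by rewrite mulr_gt0// (lt_le_trans _ radial_const_ge1).
  apply/lee_addgt0Pr => e e0.
  have e1 : 0 < e / (16 * radial_const) by rewrite divr_gt0.
  rewrite -EFinD (_ : _ + e = 16 * radial_const * (B + e / (16 * radial_const))).
    exact: H.
  by rewrite mulrDr [_ * (e / _)]mulrC divfK ?gt_eqF.
move=> e0; set X := 16 * radial_const * (B + e).
have Be : 0 < B + e by rewrite ltr_wpDl// radial_wB_ge0.
have k0 : 0 < @kappa R n := kappa_gt0 n0.
pose K := 2 * pi / (n%:R * gamma) * (B + e).
have K0 : 0 < K by rewrite mulr_gt0// divr_gt0 ?mulr_gt0 ?pi_gt0.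
have sup : {ae mu, forall x, W (a - 4 + n%:R) x * u x ^+ 2 <= 2 * K / @kappa R n}.
  apply: radial_sup => // m L L0.
  apply: fatou_sq => //.
  - by apply: measurable_funM; [exact: measurable_W|exact: measurable_bump].
  - by move=> x; rewrite mulr_ge0 ?W_ge0 ?bump_ge0.
  - by move=> k; exact: test_fun0_bump.
  apply: filterS (fB e0) => k hk.
  apply: le_trans (radial_slab gammaE gamma0 m n0 L0 (tf k)) _.
  rewrite /K -[leRHS]mulrA [X in _ <= _ * X]mulrC mulrA.
  rewrite (_ : 2 * pi * L / (n%:R * gamma) = 2 * pi / (n%:R * gamma) * L); last by rewrite mulrAC.
  apply: ler_wpM2l hk; apply: mulr_ge0; last exact: ltW.
  by apply: divr_ge0; rewrite mulr_ge0 ?pi_ge0 ?ltW.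
have hA : (\int[mu]_x (W (a - 4) x * u x ^+ 2)%:E <= ((B + e) / gamma ^+ 2)%:E)%E.
  apply: fatou_sq => //.
  - exact: measurable_W.
  - by move=> x; exact: W_ge0.
  - by move=> k; exact: test_fun0_wA.
  apply: filterS (fB e0) => k hk.
  rewrite ler_pdivlMr ?exprn_gt0// mulrC; exact: le_trans (hardy gammaE (tf k)) hk.
have X0 : 0 < X by rewrite mulr_gt0// mulr_gt0// (lt_le_trans _ radial_const_ge1).
have KX : 2 * K / @kappa R n <= X.
  rewrite /X /K.
  rewrite (_ : 2 * _ / _ = 4 * pi / (n%:R * @kappa R n) / gamma * (B + e)); last first.
    by field; rewrite !gt_eqF.
  apply: ler_wpM2r; first exact: ltW.
  apply: (@le_trans _ _ (16 * pi / (n%:R * @kappa R n))).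
    rewrite ler_pdivrMr//.
    rewrite (_ : 16 * pi / _ * gamma = 4 * pi / (n%:R * @kappa R n) * (4 * gamma)); last first.
      by field; rewrite !gt_eqF.
    rewrite ler_peMr//; last by move: gamma_ge; lra.
    by apply: divr_ge0; rewrite mulr_ge0 ?pi_ge0 ?ltW.
  have : 16 * pi / (n%:R * @kappa R n) <= radial_const by rewrite le_max lexx orbT.
  by have := radial_const_ge1; set z := radial_const; lra.
have AX : (B + e) / gamma ^+ 2 <= X.
  have g2 : 1 / 16 <= gamma ^+ 2 by move: gamma_ge; nra.
  rewrite ler_pdivrMr ?exprn_gt0// /X.
  have := radial_const_ge1; set z := radial_const => z1.
  have : 1 <= 16 * z * gamma ^+ 2 by nra.
  by move: Be; nra.
have q20 : 0 <= (q - 2) / 2 by lra.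
suff H : (wpow (- n%:R + q * gamma) q u <= (X `^ (q / 2))%:E)%E.
  have -> : X%:E = ((X `^ (q / 2))%:E `^ (2 / q))%E.
    rewrite poweR_EFin -powRrM (_ : q / 2 * (2 / q) = 1) ?powRr1 ?ltW//.
    by field; rewrite gt_eqF//; lra.
  apply: gt0_ler_poweR => //; first by rewrite divr_ge0//; lra.
  - by rewrite in_itv/= wpow_ge0 leey.
  - by rewrite in_itv/= lee_fin powR_ge0 leey.
have -> : X `^ (q / 2) = X `^ ((q - 2) / 2) * X.
  have {3}-> : X = X `^ 1 by rewrite powRr1// ltW.
  rewrite -powRD; last by rewrite (gt_eqF X0) implybT.
  by congr (_ `^ _); field.
apply: (@le_trans _ _ ((X `^ ((q - 2) / 2))%:E * \int[mu]_x (W (a - 4) x * u x ^+ 2)%:E)%E);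
  last first.
  rewrite EFinM; apply: lee_wpmul2l; first by rewrite lee_fin powR_ge0.
  by apply: le_trans hA _; rewrite lee_fin.
rewrite -ge0_integralZl//; last 3 first.
- exact: measurable_wsq.
- by move=> x _; exact: wsq_ge0.
- by rewrite lee_fin powR_ge0.
apply: ae_ge0_le_integral => //.
- by move=> x _; exact: wpow_integrand_ge0.
- exact: measurable_wpow.
- by move=> x _; rewrite mule_ge0// ?wsq_ge0// lee_fin powR_ge0.
- by apply: measurable_funeM; exact: measurable_wsq.
apply: filterS2 (ae_neq0 R n0) sup => x x0 sx _; rewrite -EFinM lee_fin.
have [ux0|ux0] := eqVneq (u x) 0.
  by rewrite ux0 normr0 powR0 ?gt_eqF//; [rewrite mulr0 expr0n/= mulr0 mulr0|lra].
have un : 0 < `|u x| by rewrite normr_gt0.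
(* The first factor is bounded pointwise by [radial_sup], the second is integrated with Hardy;
   together they contribute X^((q-2)/2) X = X^(q/2). *)
have -> : W (- n%:R + q * gamma) x * `|u x| `^ q =
   (W (a - 4 + n%:R) x * u x ^+ 2) `^ ((q - 2) / 2) * (W (a - 4) x * u x ^+ 2).
  rewrite -(real_normK (num_real (u x))) -!powR_mulrn ?normr_ge0//.
  rewrite powRM ?W_ge0 ?powR_ge0// /W -!powRrM.
  have ex : 0 < enorm x by rewrite enorm_gt0.
  rewrite mulrACA -powRD; last by rewrite (gt_eqF ex) implybT.
  rewrite -powRD; last by rewrite (gt_eqF un) implybT.
  congr (_ `^ _ * _ `^ _); last by field.
  have -> : a = gamma * 2 - n%:R + 4 by rewrite gammaE; ring.
  by field.
apply: ler_wpM2r; first by rewrite mulr_ge0 ?W_ge0 ?sqr_ge0.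
apply: ge0_ler_powR => //; rewrite ?nnegrE ?(ltW X0)//.
  by rewrite mulr_ge0 ?W_ge0 ?sqr_ge0.
exact: le_trans sx KX.
Qed.

End radial_lower.

(** * Comparison with the unweighted critical quotient *)

Section weight_shift.
Context {R : realType} {n : nat}.
Implicit Types (phi : 'rV[R]_n -> R) (x : 'rV[R]_n).

Lemma laplacian_W (b : R) x : x != 0 ->
  laplacian (W b) x = b * (n%:R + b - 2) * W (b - 2) x.
Proof.
move=> x0; rewrite /laplacian.
transitivity (\sum_i (b * W (b - 2) x + b * (b - 2) * W (b - 4) x * (x 0 i * x 0 i))).
  apply: eq_bigr => i _.
  have -> : partial i (partial i (W b)) x = partial i (fun y => b * y 0 i * W (b - 2) y) x.
    apply: partial_near; apply: (open_near_eq open_D0) => // y; exact: partial_W.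
  have dc : differentiable (fun y : 'rV[R]_n => y 0 i) x by exact: differentiable_coord.
  have db : differentiable (fun _ : 'rV[R]_n => b) x by exact: differentiable_cst.
  rewrite partialM; last 2 first.
  - exact: differentiableM.
  - exact: (Ck_diff (W_smooth (b - 2) 0%N)).
  rewrite partialM// partial_cst partial_coord eqxx partial_W//.
  rewrite (_ : b - 2 - 2 = b - 4); last by ring.
  by rewrite mul0r add0r mulr1; ring.
rewrite big_split/= sumr_const card_ord -mulr_sumr -[X in X + _]mulr_natr.
rewrite (W2E b x0) /sqn.
set S := \sum_i _; have -> : S = \sum_i x 0 i ^+ 2 by apply: eq_bigr => i _; rewrite expr2.
ring.
Qed.

(** Grouped so that the commutator carries the factor a: moving the weight inside the Laplacian then
    costs O(|a|). *)
Lemma laplacian_W_mul (a : R) phi x : x != 0 -> test_fun0 phi ->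
  laplacian (fun y => W (a / 2) y * phi y) x = W (a / 2) x * laplacian phi x +
    a * (W (a / 2 - 2) x * (xgrad phi x + (n%:R + a / 2 - 2) / 2 * phi x)).
Proof.
move=> x0 tf; rewrite laplacianM0//; last exact: W_smooth.
rewrite laplacian_W//.
have -> : \sum_i partial i (W (a / 2)) x * partial i phi x =
    a / 2 * W (a / 2 - 2) x * xgrad phi x.
  by rewrite /xgrad mulr_sumr; apply: eq_bigr => i _; rewrite partial_W//; ring.
by field.
Qed.

(** Expand the square of [laplacian_W_mul] with Young's inequality of parameter t = |a|. The
    commutator is controlled by [wB] <= 16 [wD] and [wA] <= 256 [wD], and t^2 + t <= 2t, so the
    factor of t is 1 + 2 . 2 . 16 + 2 . 2 n^2 . 256 = 65 + 1024 n^2. *)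
Lemma wD_shift (a gamma : R) phi : (0 < n)%N -> gamma * 2 = n%:R - 4 + a ->
  1 / 4 <= gamma -> `|a| <= 1 / 2 -> test_fun0 phi ->
  wD 0 (fun x => W (a / 2) x * phi x) <= (1 + (65 + 1024 * n%:R ^+ 2) * `|a|) * wD a phi.
Proof.
move=> n0 gammaE gamma_ge ha tf.
have gamma0 : 0 < gamma by apply: lt_le_trans gamma_ge.
have a2 : a <= 2 by move: ha; rewrite ler_norml => /andP[_]; lra.
have hB := rellich gammaE gamma0 a2 tf; have hA := hardy gammaE tf.
have tA := test_fun0_wA a tf; have tB := test_fun0_wB a tf; have tD := test_fun0_wD a tf.
have A0 : 0 <= wA a phi by exact: wA_ge0.
have B0 : 0 <= wB a phi by exact: wB_ge0.
have D0' : 0 <= wD a phi by exact: wD_ge0.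
pose t := `|a|; have t0 : 0 <= t := normr_ge0 _.
have nR : 1 <= n%:R :> R by rewrite ler1n.
have key : wD 0 (fun x => W (a / 2) x * phi x) <=
    (1 + t) * wD a phi + ((t ^+ 2 + t) * 2) * wB a phi +
    ((t ^+ 2 + t) * (2 * n%:R ^+ 2)) * wA a phi.
  have tZ1 := test_fun0Z (1 + t) tD.
  have tZ2 := test_fun0Z ((t ^+ 2 + t) * 2) tB.
  have tZ3 := test_fun0Z ((t ^+ 2 + t) * (2 * n%:R ^+ 2)) tA.
  rewrite /wD /wB /wA -!IntZ// -IntD// -IntD//; last exact: test_fun0D.
  apply: Int_le => [||x].
  - by apply: test_fun0_wD; exact: test_fun0_W.
  - by apply: test_fun0D => //; exact: test_fun0D.
  have [->|x0] := eqVneq x 0.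
    rewrite (test_fun0_vanish0 (test_fun0_laplacian (test_fun0_W _ tf))) expr0n/= mulr0.
    by repeat (apply: sqr_ge0 || apply: addr_ge0 || apply: mulr_ge0 || apply: W_ge0 ||
      apply: grad2_ge0 || by []).
  rewrite [W 0 x]powRr0 mul1r laplacian_W_mul//.
  set c := (n%:R + a / 2 - 2) / 2; set X := xgrad phi x; set l := laplacian phi x.
  set p := phi x; set g := grad2 phi x.
  have c2 : c ^+ 2 <= n%:R ^+ 2.
    by rewrite /c; move: ha nR; rewrite ler_norml => /andP[]; nra.
  have WE : W (a / 2) x ^+ 2 = W a x by exact: W_half.
  have WE2 : W (a / 2 - 2) x ^+ 2 = W (a - 4) x.
    by rewrite -[RHS]W_half; congr (W _ _ ^+ 2); field.
  have w4 : 0 <= W (a - 4) x by exact: W_ge0.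
  set z := W (a / 2 - 2) x * _.
  have z2 : z ^+ 2 <= 2 * (W (a - 2) x * g) + 2 * n%:R ^+ 2 * (W (a - 4) x * p ^+ 2).
    rewrite exprMn WE2 (W2E a x0).
    have hX : X ^+ 2 <= sqn x * g by exact: xgrad_sqr.
    have h1 : (X + c * p) ^+ 2 <= 2 * (sqn x * g) + 2 * n%:R ^+ 2 * p ^+ 2.
      have h2 : c ^+ 2 * p ^+ 2 <= n%:R ^+ 2 * p ^+ 2 by rewrite ler_wpM2r// sqr_ge0.
      have h3 : 0 <= (X - c * p) ^+ 2 by exact: sqr_ge0.
      have -> : (X + c * p) ^+ 2 = 2 * X ^+ 2 + 2 * (c ^+ 2 * p ^+ 2) - (X - c * p) ^+ 2 by ring.
      by move: h3 hX h2; lra.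
    apply: le_trans (ler_wpM2l w4 h1) _.
    by rewrite le_eqVlt; apply/orP; left; apply/eqP; ring.
  have h4 : (W (a / 2) x * l + a * z) ^+ 2 <=
      (1 + t) * (W a x * l ^+ 2) + (t ^+ 2 + t) * z ^+ 2.
    rewrite -WE -exprMn; set y := W (a / 2) x * l.
    have -> : t ^+ 2 = a ^+ 2 by rewrite /t real_normK// num_real.
    suff : 2 * (a * (y * z)) <= t * (y ^+ 2 + z ^+ 2) by lra.
    have at1 : a <= t by exact: ler_norm.
    have at2 : - t <= a by exact: lerNnormlW.
    have s1 : 0 <= (y - z) ^+ 2 by exact: sqr_ge0.
    have s2 : 0 <= (y + z) ^+ 2 by exact: sqr_ge0.
    have e1 : 0 <= (t + a) * (y - z) ^+ 2 by rewrite mulr_ge0//; lra.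
    have e2 : 0 <= (t - a) * (y + z) ^+ 2 by rewrite mulr_ge0//; lra.
    by move: (addr_ge0 e1 e2); lra.
  apply: le_trans h4 _.
  have tt0 : 0 <= t ^+ 2 + t by rewrite addr_ge0// sqr_ge0.
  have := ler_wpM2l tt0 z2; lra.
apply: le_trans key _.
have Bl : wB a phi <= 16 * wD a phi.
  have : 1 / 16 * wB a phi <= wD a phi; last lra.
  apply: le_trans hB; apply: ler_wpM2r => //; move: gamma_ge; nra.
have Al : wA a phi <= 256 * wD a phi.
  have : 1 / 16 * wA a phi <= wB a phi; last lra.
  apply: le_trans hA; apply: ler_wpM2r => //; move: gamma_ge; nra.
have tt : t ^+ 2 + t <= 2 * t by move: ha; rewrite -/t; nra.
have tt0 : 0 <= t ^+ 2 + t by rewrite addr_ge0// sqr_ge0.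
have h1 : (t ^+ 2 + t) * 2 * wB a phi <= 2 * t * 2 * (16 * wD a phi).
  apply: ler_pM => //; first by rewrite mulr_ge0.
  by rewrite ler_pM2r.
have h2 : (t ^+ 2 + t) * (2 * n%:R ^+ 2) * wA a phi <=
    2 * t * (2 * n%:R ^+ 2) * (256 * wD a phi).
  apply: ler_pM => //; first by rewrite !mulr_ge0// sqr_ge0.
  by rewrite ler_wpM2r// mulr_ge0// sqr_ge0.
by move: h1 h2; rewrite -/t; lra.
Qed.

End weight_shift.

(** * Hölder interpolation of weighted integrals *)

Section interpolation.
Context d (T : measurableType d) {R : realType} (mu : {measure set T -> \bar R}).

Lemma powR_young (s x y : R) : 0 <= s <= 1 -> 0 <= x -> 0 <= y ->
  x `^ (1 - s) * y `^ s <= (1 - s) * x + s * y.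
Proof.
move=> /andP[s0 s1] x0 y0.
have [->|sn0] := eqVneq s 0.
  by rewrite subr0 powRr1// powRr0 !mul1r mul0r mulr1 addr0.
have [->|sn1] := eqVneq s 1.
  by rewrite subrr powRr0 powRr1// mul0r add0r.
have sp : 0 < s by rewrite lt_neqAle eq_sym sn0.
have sp' : 0 < 1 - s by rewrite subr_gt0 lt_neqAle sn1.
have := @conjugate_powR R (x `^ (1 - s)) (y `^ s) (1 - s)^-1 s^-1
  (powR_ge0 _ _) (powR_ge0 _ _).
rewrite !invr_gt0 => /(_ sp' sp); rewrite !invrK subrK => /(_ erefl).
rewrite -!powRrM !divff// ?(gt_eqF sp')// !powRr1//.
by rewrite [x * _]mulrC [y * _]mulrC.
Qed.

(** Hölder's inequality with exponents 1/(1-s) and 1/s, by Young's inequality for the normalised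
    functions x/A and y/N; in this form s = 0 and s = 1 are included. *)
Lemma interpolation (x y : T -> R) (s A N : R) : 0 <= s <= 1 -> 0 < A -> 0 < N ->
  measurable_fun setT x -> measurable_fun setT y ->
  (forall t, 0 <= x t) -> (forall t, 0 <= y t) ->
  (\int[mu]_t (x t)%:E <= A%:E)%E -> (\int[mu]_t (y t)%:E <= N%:E)%E ->
  (\int[mu]_t (x t `^ (1 - s) * y t `^ s)%:E <= (A `^ (1 - s) * N `^ s)%:E)%E.
Proof.
move=> s01 A0 N0 mx my x0 y0 xA yN; have /andP[s0 s1] := s01.
pose c := A `^ (1 - s) * N `^ s.
have c0 : 0 <= c by rewrite mulr_ge0 ?powR_ge0.
have s1' : 0 <= 1 - s by rewrite subr_ge0.
have mX : measurable_fun setT (fun t => ((1 - s) / A * x t)%:E).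
  by apply/measurable_EFinP; exact: measurable_funM.
have mY : measurable_fun setT (fun t => (s / N * y t)%:E).
  by apply/measurable_EFinP; exact: measurable_funM.
have cx0 : 0 <= (1 - s) / A by rewrite divr_ge0// ltW.
have cy0 : 0 <= s / N by rewrite divr_ge0// ltW.
apply: (@le_trans _ _ (\int[mu]_t (c%:E * (((1 - s) / A * x t)%:E + (s / N * y t)%:E)))%E).
  apply: ge0_le_integral => //.
  - by move=> t _; rewrite lee_fin mulr_ge0 ?powR_ge0.
  - apply/measurable_EFinP; apply: measurable_funM.
      exact: (measurableT_comp (measurable_powR _) mx).
    exact: (measurableT_comp (measurable_powR _) my).
  - by apply: measurable_funeM; exact: emeasurable_funD.
  move=> t _; rewrite -EFinD -EFinM lee_fin.
  have xE : x t = A * (x t / A) by rewrite mulrC divfK// gt_eqF.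
  have yE : y t = N * (y t / N) by rewrite mulrC divfK// gt_eqF.
  have xA0 : 0 <= x t / A by rewrite divr_ge0// ltW.
  have yN0 : 0 <= y t / N by rewrite divr_ge0// ltW.
  have A0' := ltW A0; have N0' := ltW N0.
  rewrite {1}xE {1}yE powRM// [in _ `^ s]powRM// mulrACA -/c.
  apply: ler_wpM2l => //; apply: le_trans (powR_young s01 xA0 yN0) _.
  by rewrite ![_ * x t]mulrAC ![_ * y t]mulrAC !mulrA.
rewrite ge0_integralZl//; last 2 first.
- exact: emeasurable_funD.
- by move=> t _; rewrite -EFinD lee_fin addr_ge0// mulr_ge0.
rewrite -[leRHS]mule1; apply: lee_wpmul2l; first by rewrite lee_fin.
rewrite ge0_integralD//; last 2 first.
- by move=> t _; rewrite lee_fin mulr_ge0.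
- by move=> t _; rewrite lee_fin mulr_ge0.
under eq_integral do rewrite EFinM.
rewrite ge0_integralZl//; last 2 first.
- exact/measurable_EFinP.
- by move=> t _; rewrite lee_fin.
under [X in (_ + X)%E]eq_integral do rewrite EFinM.
rewrite ge0_integralZl//; last 2 first.
- exact/measurable_EFinP.
- by move=> t _; rewrite lee_fin.
apply: (@le_trans _ _ (((1 - s) / A)%:E * A%:E + (s / N)%:E * N%:E)%E).
  by apply: leeD; apply: lee_wpmul2l => //; rewrite lee_fin.
by rewrite -!EFinM -EFinD lee_fin !divfK ?gt_eqF// subrK.
Qed.

End interpolation.

Lemma abs_powR_continuous (R : realType) (q : R) : 0 < q ->
  continuous (fun t : R => `|t| `^ q).
Proof.
move=> q0 t; have [->|t0] := eqVneq t 0.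
  apply/cvgrPdist_lt => e e0.
  have h : \forall x \near (0 : R), `|x| < e `^ q^-1 by apply: nbhs0_lt; exact: powR_gt0.
  apply: filterS h => x xe.
  rewrite normr0 powR0 ?gt_eqF// sub0r normrN ger0_norm ?powR_ge0//.
  rewrite -[ltRHS]powRr1 ?(ltW e0)// -(mulVf (lt0r_neq0 q0)) powRrM.
  by apply: gt0_ltr_powR => //; rewrite ?nnegrE ?powR_ge0.
apply: (@continuous_comp _ _ _ (fun t : R => `|t|) (fun t => t `^ q)).
  exact: norm_continuous.
apply: differentiable_continuous; apply/derivable1_diffP.
by apply: derivable_powR; rewrite in_itv/= andbT normr_gt0.
Qed.

Section subcritical.
Context {R : realType} {n : nat}.
Hypothesis n5 : (5 <= n)%N.
Notation mu := (lebesgue_rV R n).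

Definition crit : R := 2 * n%:R / (n%:R - 4).

Let n0 : (0 < n)%N. Proof. exact: leq_trans n5. Qed.

Let nR : 5 <= n%:R :> R. Proof. by rewrite ler_nat. Qed.

Lemma crit_gt2 : 2 < crit.
Proof. by rewrite /crit ltr_pdivlMr; move: nR; lra. Qed.

Lemma wpow_root (b q X : R) (u : 'rV[R]_n -> R) : 0 < q -> 0 <= X ->
  (wpow b q u <= (X `^ (q / 2))%:E)%E -> (wpow b q u `^ (2 / q) <= X%:E)%E.
Proof.
move=> q0 X0 H.
have -> : X%:E = ((X `^ (q / 2))%:E `^ (2 / q))%E.
  rewrite poweR_EFin -powRrM (_ : q / 2 * (2 / q) = 1) ?powRr1//.
  by field; rewrite gt_eqF.
apply: gt0_ler_poweR => //; first by rewrite divr_ge0// ltW.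
- by rewrite in_itv/= wpow_ge0 leey.
- by rewrite in_itv/= lee_fin powR_ge0 leey.
Qed.

Lemma wpow_unroot (b q X : R) (u : 'rV[R]_n -> R) : 0 < q -> 0 <= X ->
  (wpow b q u `^ (2 / q) <= X%:E)%E -> (wpow b q u <= (X `^ (q / 2))%:E)%E.
Proof.
move=> q0 X0 H.
have -> : wpow b q u = ((wpow b q u `^ (2 / q)) `^ (q / 2))%E.
  rewrite -poweRrM (_ : 2 / q * (q / 2) = 1) ?poweRe1 ?wpow_ge0//.
  by field; rewrite gt_eqF.
rewrite -poweR_EFin; apply: gt0_ler_poweR => //; first by rewrite divr_ge0// ltW.
- by rewrite in_itv/= poweR_ge0 leey.
- by rewrite in_itv/= lee_fin X0 leey.
Qed.

Variable S : R.
Hypothesis S0 : 0 < S.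
Hypothesis sobolev : forall phi : 'rV[R]_n -> R, test_fun0 phi ->
  (S%:E * wpow 0 crit phi `^ (2 / crit) <= (wD 0 phi)%:E)%E.

Variable K : R.
Hypothesis K0 : 0 <= K.
Hypothesis shiftK : forall (a gamma : R) (phi : 'rV[R]_n -> R),
  gamma * 2 = n%:R - 4 + a -> 1 / 4 <= gamma -> `|a| <= 1 / 2 -> test_fun0 phi ->
  wD 0 (fun x => W (a / 2) x * phi x) <= (1 + K * `|a|) * wD a phi.

Let shift_gt0 (t : R) : 0 < 1 + K * `|t|.
Proof. by rewrite ltr_pwDl// mulr_ge0. Qed.

(* The exponent is 1 - s, where q = 2 (1 - s) + crit s. *)
Definition subcrit_const (a q : R) : R :=
  Num.max 1 (16 * S) `^ (1 - (q - 2) * (n%:R - 4) / 8) * (1 + K * `|a|).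

Variables (a gamma q : R).
Hypothesis gammaE : gamma * 2 = n%:R - 4 + a.
Hypothesis ha : `|a| <= 1 / 2.
Hypotheses (q2 : 2 < q) (qcrit : q <= crit).

Let s : R := (q - 2) * (n%:R - 4) / 8.

Let gamma_ge : 1 / 4 <= gamma.
Proof. by move: ha nR gammaE; rewrite ler_norml => /andP[]; lra. Qed.

Let s01 : 0 <= s <= 1.
Proof.
apply/andP; split; first by rewrite divr_ge0// mulr_ge0//; move: q2 nR; lra.
move: qcrit; rewrite /crit ler_pdivlMr; last by move: nR; lra.
by rewrite /s ler_pdivrMr//; move: nR; lra.
Qed.

Let critE : crit * s = n%:R * (q - 2) / 4.
Proof. by rewrite /crit /s; field; rewrite gt_eqF//; move: nR; lra. Qed.

Lemma subcrit_const_gt0 : 0 < subcrit_const a q.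
Proof.
apply: mulr_gt0; last exact: shift_gt0.
by rewrite powR_gt0// lt_max ltr01.
Qed.

Let g0_gt0 : 0 < (n%:R - 4) / 2 :> R. Proof. by move: nR; lra. Qed.

Let g0_sqr : 1 / 4 <= ((n%:R - 4) / 2) ^+ 2 :> R. Proof. by move: nR; nra. Qed.

Let le16 (A B D E g : R) : 1 / 4 <= g -> 0 <= A -> 0 <= B ->
  g * A <= B -> g * B <= D -> D <= E -> A <= 16 * E.
Proof.
move=> g4 A0 B0; have := ler_wpM2r A0 g4; have := ler_wpM2r B0 g4; lra.
Qed.

Let crit0 : 0 < crit. Proof. by apply: lt_trans crit_gt2. Qed.

Let q0 : 0 < q. Proof. by apply: lt_trans q2. Qed.

Let sE : 1 - s + crit / 2 * s = q / 2.
Proof.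
rewrite (_ : crit / 2 * s = crit * s / 2); last by rewrite mulrAC.
by rewrite critE /s; field.
Qed.

Let s_gt0 : 0 < s.
Proof. by rewrite divr_gt0// mulr_gt0//; move: q2 nR; lra. Qed.

Let q2_ge1 : 1 <= q / 2. Proof. by move: q2; lra. Qed.

(** The exponent of |x| in (|x|^-4 v^2)^(1-s) (|v|^crit)^s for v = |x|^(a/2) phi. *)
Let exp_enorm : - n%:R + q * gamma =
  (0 - 4) * (1 - s) + a / 2 * (2 * (1 - s)) + a / 2 * (crit * s).
Proof.
rewrite critE /s.
have -> : a = gamma * 2 - n%:R + 4 by rewrite gammaE; ring.
by field.
Qed.

Let exp_abs : q = 2 * (1 - s) + crit * s.
Proof. by rewrite critE /s; field. Qed.

Lemma wpow_test_le (phi : 'rV[R]_n -> R) (D : R) : test_fun0 phi -> 0 < D ->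
  wD a phi <= D ->
  (wpow (- n%:R + q * gamma) q phi <= ((subcrit_const a q / S * D) `^ (q / 2))%:E)%E.
Proof.
move=> tf D0 hD; have /andP[s0 s1] := s01.
pose E := (1 + K * `|a|) * D.
have F0 := shift_gt0 a.
have E0 : 0 < E by apply: mulr_gt0.
pose v x := W (a / 2) x * phi x; have tv : test_fun0 v by exact: test_fun0_W.
have vE : wD 0 v <= E.
  apply: le_trans (shiftK gammaE gamma_ge ha tf) _.
  by rewrite ler_pM2l.
have g0E : ((n%:R - 4) / 2) * 2 = n%:R - 4 + 0 :> R by rewrite divfK// addr0.
(* Hardy and Rellich at a = 0, where gamma^2 = ((n-4)/2)^2 >= 1/4: each costs a factor 4. *)
have A16 : wA 0 v <= 16 * E.
  apply: (le16 g0_sqr (wA_ge0 0 v) (wB_ge0 0 v) _ _ vE); first exact: hardy g0E _ tv.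
  exact: (rellich g0E g0_gt0 (ler0n _ 2) tv).
have N16 : (wpow 0 crit v <= ((E / S) `^ (crit / 2))%:E)%E.
  apply: wpow_unroot => //; first by rewrite divr_ge0// ltW.
  have := sobolev tv; case: (wpow 0 crit v `^ (2 / crit))%E => [r| |].
  - rewrite -EFinM !lee_fin => h; rewrite ler_pdivlMr// mulrC; exact: le_trans vE.
  - by rewrite gt0_muley ?lte_fin.
  - by rewrite leNye.
have E16 : 0 < 16 * E by rewrite mulr_gt0.
have N0 : 0 < (E / S) `^ (crit / 2) by rewrite powR_gt0// divr_gt0.
have mv := test_fun0_measurable tv.
have main := @interpolation _ _ R mu (fun x => W (0 - 4) x * v x ^+ 2)
  (fun x => W 0 x * `|v x| `^ crit) s (16 * E) ((E / S) `^ (crit / 2)) s01 E16 N0.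
apply: (@le_trans _ _ ((16 * E) `^ (1 - s) * ((E / S) `^ (crit / 2)) `^ s)%:E); last first.
  rewrite lee_fin -powRrM.
  have ES0 : 0 < E / S by rewrite divr_gt0.
  (* Both factors become powers of E/S, with total exponent q/2. What remains is (16 S)^(1-s), close
     to 1 for q near [crit] since then s is near 1. The maximum with 1 yields M >= 1, so that M <=
     M^(q/2) can be taken inside the power. *)
  rewrite (_ : 16 * E = 16 * S * (E / S)); last by field; rewrite gt_eqF.
  rewrite (powRM _ _ (ltW ES0)); last by rewrite mulr_ge0// ltW.
  rewrite -mulrA -powRD; last by rewrite (gt_eqF ES0) implybT.
  rewrite sE.
  set M := Num.max 1 (16 * S) `^ (1 - s).
  rewrite (_ : _ / S * D = M * (E / S)); last by rewrite /subcrit_const -/s -/M /E; ring.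
  rewrite (powRM _ (powR_ge0 _ _) (ltW ES0)).
  apply: ler_wpM2r; first exact: powR_ge0.
  have M1 : 1 <= Num.max 1 (16 * S) by rewrite le_max lexx.
  apply: (@le_trans _ _ M).
    apply: ge0_ler_powR; rewrite ?subr_ge0 ?nnegrE//; last by rewrite le_max lexx orbT.
      by rewrite mulr_ge0// ltW.
    exact: le_trans M1.
  have M1' : 1 <= M by rewrite -(powRr0 (Num.max 1 (16 * S))) ler_powR// subr_ge0.
  rewrite -[leLHS]powRr1; last exact: le_trans M1'.
  exact: ler_powR.
apply: le_trans (main _ _ _ _ _ _) => //.
- rewrite le_eqVlt; apply/orP; left; apply/eqP; apply: eq_integral => x _; congr EFin.
  have [fx0|fx0] := eqVneq (phi x) 0.
    rewrite fx0 /v fx0 mulr0 expr0n/= normr0 (powR0 (lt0r_neq0 q0)) (powR0 (lt0r_neq0 crit0)) !mulr0.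
    by rewrite (powR0 (lt0r_neq0 s_gt0)) mulr0.
  have x0 : x != 0 by apply: contraNneq fx0 => ->; rewrite test_fun0_vanish0.
  have ex : 0 < enorm x by rewrite enorm_gt0.
  have un : 0 < `|phi x| by rewrite normr_gt0.
  rewrite -(real_normK (num_real (v x))) /v normrM (ger0_norm (W_ge0 _ _)).
  rewrite [W 0 x]powRr0 mul1r -powR_mulrn ?mulr_ge0 ?W_ge0//.
  rewrite !powRM ?mulr_ge0 ?W_ge0 ?powR_ge0// /W -!powRrM.
  have Re (y z : R) : enorm x `^ y * enorm x `^ z = enorm x `^ (y + z).
    by rewrite -powRD// (gt_eqF ex) implybT.
  have Ru (y z : R) : `|phi x| `^ y * `|phi x| `^ z = `|phi x| `^ (y + z).
    by rewrite -powRD// (gt_eqF un) implybT.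
  rewrite [X in _ = X * _]mulrA Re mulrACA Re Ru.
  by rewrite -exp_enorm -exp_abs.
- apply: measurable_funM; [exact: measurable_W|exact: measurable_funX].
- by have := measurable_wpow 0 crit mv => /measurable_EFinP.
- by move=> x; rewrite mulr_ge0 ?W_ge0 ?sqr_ge0.
- by move=> x; rewrite mulr_ge0 ?W_ge0 ?powR_ge0.
- by rewrite EFin_Int ?lee_fin//; exact: test_fun0_wA.
Qed.

Lemma wpow_lim_le (u : 'rV[R]_n -> R) (f : nat -> 'rV[R]_n -> R) (D : R) :
  measurable_fun setT u -> (forall k, test_fun0 (f k)) ->
  {ae mu, forall x, f k x @[k --> \oo] --> u x} ->
  (forall e, 0 < e -> \forall k \near \oo, wD a (f k) <= D + e) ->
  (wpow (- n%:R + q * gamma) q u `^ (2 / q) <= (subcrit_const a q / S * D)%:E)%E.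
Proof.
move=> mu_ tf fu fD.
have D0 : 0 <= D.
  rewrite leNgt; apply/negP => D0.
  have e0 : 0 < - D / 2 by rewrite divr_gt0// oppr_gt0.
  have [k _ /(_ k (leqnn k))] := fD _ e0.
  by have := wD_ge0 a (f k); move: D0; lra.
have C0 : 0 < subcrit_const a q / S by rewrite divr_gt0// subcrit_const_gt0.
suff H (e : R) : 0 < e -> (wpow (- n%:R + q * gamma) q u `^ (2 / q) <=
    (subcrit_const a q / S * (D + e))%:E)%E.
  apply/lee_addgt0Pr => e e0.
  rewrite -EFinD (_ : _ + e = subcrit_const a q / S * (D + e / (subcrit_const a q / S))).
    by apply: H; rewrite divr_gt0.
  by rewrite [RHS]mulrDr; congr (_ + _); rewrite [RHS]mulrC divfK ?gt_eqF.
move=> e0; have De : 0 < D + e by rewrite ltr_wpDl.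
apply: wpow_root; [exact: q0|by rewrite ltW// mulr_gt0|].
apply: (@fatou_ae _ _ _ mu (fun k x => (W (- n%:R + q * gamma) x * `|f k x| `^ q)%:E)).
- by move=> k; apply: measurable_wpow; exact: test_fun0_measurable.
- exact: measurable_wpow.
- by move=> k x; exact: wpow_integrand_ge0.
- by move=> x; exact: wpow_integrand_ge0.
- apply: filterS fu => x hx; apply: cvg_EFin; first by near=> k.
  apply: cvgM; first exact: cvg_cst.
  apply: (@continuous_cvg _ _ _ _ _ _ (fun t : R => `|t| `^ q)) => //.
  exact: abs_powR_continuous.
by apply: filterS (fD _ e0) => k hk; apply: wpow_test_le.
Unshelve. all: by end_near. Qed.

End subcritical.

(** * Trial functions *)

Section translation.
Context {R : realType} {n : nat}.
Notation mu := (lebesgue_rV R n).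
Implicit Types (f phi : 'rV[R]_n -> R) (b x : 'rV[R]_n).

Lemma partial_translate i f b x :
  partial i (fun y => f (y + b)) x = partial i f (x + b).
Proof.
rewrite /partial /derive.
by have -> : (fun y => f (y + b)) \o shift x = f \o shift (x + b)
  by apply/funext => h; rewrite /= addrA.
Qed.

Lemma laplacian_translate f b x :
  laplacian (fun y => f (y + b)) x = laplacian f (x + b).
Proof.
apply: eq_bigr => i _.
have -> : partial i (fun y => f (y + b)) = fun y => partial i f (y + b).
  by apply/funext => y; exact: partial_translate.
exact: (partial_translate i (partial i f) b x).
Qed.

Lemma grad2_translate f b x : grad2 (fun y => f (y + b)) x = grad2 f (x + b).
Proof. by apply: eq_bigr => i _; rewrite (partial_translate i f b x). Qed.

Lemma smooth_translate f b : smooth_on setT f -> smooth_on setT (fun x => f (x + b)).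
Proof.
move=> sf k; have := sf k; clear sf; elim: k f => [|k IH] f /= [df pf]; split => //.
- move=> x _; apply: (@differentiable_comp _ _ _ _ (fun y => y + b) f); last exact: df.
  by apply: differentiableD.
- move=> x _; apply: (@differentiable_comp _ _ _ _ (fun y => y + b) f); last exact: df.
  by apply: differentiableD.
move=> i; have := IH _ (pf i); congr (Ck _ _ _).
by apply/funext => x; rewrite (partial_translate i f b x).
Qed.

Lemma sqn_leD x b : sqn (x + b) <= 2 * sqn x + 2 * sqn b.
Proof.
rewrite /sqn !mulr_sumr -big_split/=; apply: ler_sum => i _; rewrite mxE.
by have := sqr_ge0 (x 0 i - b 0 i); rewrite sqrrB sqrrD; lra.
Qed.

Lemma lebesgue_translate_ge0 f b : measurable_fun setT f -> (forall x, 0 <= f x) ->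
  (\int[mu]_x (f (x + b))%:E = \int[mu]_x (f x)%:E)%E.
Proof.
move=> mf f0; have mt := measurable_translate b.
rewrite -(@ge0_integral_pushforward _ _ _ _ _ _ mt mu setT (fun x => (f x)%:E))//.
- by apply: eq_measure_integral => A mA _;
    first [exact: lebesgue_translate|exact/esym/lebesgue_translate].
- exact/measurable_EFinP.
- by move=> x _; rewrite lee_fin.
Qed.

Lemma wpow_translate q f b : measurable_fun setT f ->
  wpow 0 q (fun x => f (x + b)) = wpow 0 q f.
Proof.
move=> mf; rewrite -[RHS](lebesgue_translate_ge0 b); first 1 last.
- by have := measurable_wpow 0 q mf => /measurable_EFinP.
- by move=> x; rewrite mulr_ge0 ?W_ge0 ?powR_ge0.
by apply: eq_integral => x _; rewrite /W !powRr0.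
Qed.

End translation.

Section far_translates.
Context {R : realType} {n : nat}.
Hypothesis n0 : (0 < n)%N.
Variables (phi : 'rV[R]_n -> R) (r s : R).
Hypotheses (r0 : 0 < r) (rs : r < s) (tf : test_fun0 phi).
Hypothesis supp : forall x, phi x != 0 -> annulus r s x.

Let e1 : 'rV[R]_n := \row_i (i == Ordinal n0)%:R.

Let far (t : R) x := phi (x + - t *: e1).

Let far_support t x : s < t -> annulus r s (x + - t *: e1) -> t - s <= enorm x.
Proof.
move=> st /andP[_ xs].
have := le_trans (ler_coord_enorm (x + - t *: e1) (Ordinal n0)) xs.
rewrite !mxE eqxx mulr1 ler_norml => /andP[h _].
apply: le_trans (ler_coord_enorm x (Ordinal n0)); apply: le_trans (ler_norm _).
by move: h; lra.
Qed.

Lemma test_fun0_far t : s < t -> test_fun0 (far t).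
Proof.
move=> st; apply/test_fun0P; split.
  have st' : smooth_on setT phi.
    by apply: smooth_smooth_on; case: tf => -[].
  by move=> k; apply: (@Ck_sub _ _ D0 setT) => //; exact: smooth_translate st' k.
pose b := Num.sqrt (2 * s ^+ 2 + 2 * sqn (t *: e1)).
have s0 : 0 < s by exact: lt_trans rs.
have c0 : 0 <= 2 * s ^+ 2 + 2 * sqn (t *: e1).
  by rewrite addr_ge0// mulr_ge0 ?sqr_ge0 ?sqn_ge0.
exists (t - s), (t - s + b + 1); split; first by rewrite subr_gt0.
  by have := sqrtr_ge0 (2 * s ^+ 2 + 2 * sqn (t *: e1)); rewrite -/b; lra.
move=> x /supp h; have h1 := far_support st h.
apply/andP; split => //.
suff : enorm x <= b by move: st; lra.
have /andP[_ xs] := h.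
rewrite /enorm ler_sqrt//.
have -> : \sum_i x 0 i ^+ 2 = sqn ((x + - t *: e1) + t *: e1).
  by apply: eq_bigr => i _; congr (_ ^+ 2); rewrite !mxE; ring.
apply: le_trans (sqn_leD _ _) _; rewrite lerD2r ler_pM2l// -sqr_enorm.
by apply: lerXn2r; rewrite ?nnegrE ?enorm_ge0// ltW.
Qed.

Lemma wD_far t : wD 0 (far t) = wD 0 phi.
Proof.
rewrite /wD /Int -[RHS](Rintegral_translate (- t *: e1)); last first.
  exact/test_fun0_integrable/test_fun0_wD.
by apply: eq_Int => x; rewrite laplacian_translate /W !powRr0.
Qed.

Lemma wB_far t : s < t -> wB 0 (far t) <= (t - s) ^- 2 * Int (grad2 phi).
Proof.
move=> st; have ts0 : 0 < t - s by rewrite subr_gt0.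
have tg : test_fun0 (grad2 (far t)) by apply: test_fun0_grad2; exact: test_fun0_far.
have -> : Int (grad2 phi) = Int (grad2 (far t)).
  rewrite {1}/Int -[LHS](Rintegral_translate (- t *: e1)); last first.
    exact/test_fun0_integrable/test_fun0_grad2.
  by apply: eq_Int => x; rewrite grad2_translate.
rewrite -IntZ//; apply: Int_le => [||x].
- by apply: test_fun0_wB; exact: test_fun0_far.
- exact: test_fun0Z.
have [->|gx] := eqVneq (grad2 (far t) x) 0; first by rewrite !mulr0.
apply: ler_wpM2r; first exact: grad2_ge0.
have ex : t - s <= enorm x.
  apply: far_support => //; move: gx; rewrite grad2_translate.
  rewrite psumr_eq0 => [/allPn[i _]|i _]; last exact: sqr_ge0.
  rewrite /= expf_eq0 /= => gi; exact: (partial_support r0 supp gi).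
have ex0 : 0 < enorm x by exact: lt_le_trans ex.
rewrite /W sub0r powRN powR_mulrn ?(ltW ex0)// lef_pV2 ?posrE ?exprn_gt0//.
by apply: lerXn2r; rewrite ?nnegrE ?(ltW ts0) ?(ltW ex0).
Qed.

Lemma far_translate (e : R) : 0 < e -> exists psi : 'rV[R]_n -> R,
  [/\ test_fun0 psi, forall q, wpow 0 q psi = wpow 0 q phi,
      wD 0 psi = wD 0 phi & wB 0 psi <= e].
Proof.
move=> e0; have G0 : 0 <= Int (grad2 phi) by apply: Int_ge0 => x; exact: grad2_ge0.
(* With G the integral of |grad phi|^2 one has t - s = 1 + G/e, and G <= e (1 + G/e)^2. *)
pose t := s + 1 + Int (grad2 phi) / e.
have Ge : 0 <= Int (grad2 phi) / e by rewrite divr_ge0// ltW.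
have st : s < t by rewrite /t; lra.
exists (far t); split.
- exact: test_fun0_far.
- by move=> q; apply: wpow_translate; exact: test_fun0_measurable.
- exact: wD_far.
apply: le_trans (wB_far st) _.
rewrite mulrC ler_pdivrMr; last by rewrite exprn_gt0// subr_gt0.
have -> : t - s = 1 + Int (grad2 phi) / e by rewrite /t; ring.
have : Int (grad2 phi) = e * (Int (grad2 phi) / e) by rewrite mulrC divfK// gt_eqF.
set G := Int _ in G0 Ge *; set g := G / e in Ge * => GE; rewrite GE.
rewrite ler_pM2l//; nra.
Qed.

End far_translates.

Section trial_bound.
Context {R : realType} {n : nat}.
Notation mu := (lebesgue_rV R n).

Lemma W_le (M b : R) (x : 'rV[R]_n) : annulus M^-1 M x -> 1 <= M ->
  M `^ (- `|b|) <= W b x <= M `^ `|b|.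
Proof.
move=> /andP[h1 h2] M1; have M0 : 0 < M by exact: lt_le_trans M1.
have ex : 0 < enorm x by apply: lt_le_trans h1; rewrite invr_gt0.
have up (c : R) : 0 <= c -> M `^ (- c) <= enorm x `^ c <= M `^ c.
  move=> c0; apply/andP; split.
    rewrite (_ : M `^ (- c) = M^-1 `^ c); last first.
      by rewrite -powR_inv1 ?(ltW M0)// -powRrM mulN1r.
    by apply: ge0_ler_powR; rewrite ?nnegrE ?invr_ge0 ?(ltW M0) ?(ltW ex).
  by apply: ge0_ler_powR; rewrite ?nnegrE ?(ltW M0) ?(ltW ex).
rewrite /W; have [b0|b0] := leP 0 b; first by rewrite ger0_norm// up.
have c0 : 0 <= - b by rewrite oppr_ge0 ltW.
rewrite ltr0_norm//; move: c0; rewrite -[in enorm x `^ b](opprK b); move: (- b) => c c0.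
have /andP[] := up _ c0; rewrite !powRN => u1 u2; apply/andP; split.
  by rewrite lef_pV2 ?posrE ?powR_gt0.
by rewrite -[leRHS]invrK lef_pV2 ?posrE ?invr_gt0 ?powR_gt0.
Qed.

End trial_bound.

Section normalized_test_functions.
Context {R : realType} {n : nat}.
Hypothesis n0 : (0 < n)%N.
Notation mu := (lebesgue_rV R n).
Implicit Types phi : 'rV[R]_n -> R.

Lemma annulus_bound phi : test_fun0 phi -> exists2 M : R, 1 <= M &
  forall x, phi x != 0 -> annulus M^-1 M x.
Proof.
move=> /test_fun0P[_ [r [s [r0 rs sub]]]].
pose M := Num.max 1 (Num.max r^-1 s).
have M1 : 1 <= M by rewrite le_max lexx.
have M0 : 0 < M by exact: lt_le_trans M1.
exists M => // x /sub /andP[h1 h2]; apply/andP; split.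
  apply: le_trans h1; rewrite -[leRHS]invrK lef_pV2 ?posrE ?invr_gt0//.
  by rewrite /M !le_max lexx orbT.
by apply: le_trans h2 _; rewrite /M !le_max lexx !orbT.
Qed.

Lemma wpow_test_fin (b q : R) phi : 0 < q -> test_fun0 phi -> (wpow b q phi < +oo)%E.
Proof.
move=> q0 tf; have [M M1 sub] := annulus_bound tf.
have M0 : 0 < M by exact: lt_le_trans M1.
have [C C0 hC] := test_fun0_bounded tf.
have mf := test_fun0_measurable tf.
have : mu.-integrable setT (EFin \o (fun x => W b x * `|phi x| `^ q)).
  apply: (@bounded_support_integrable _ _ _ M (M `^ `|b| * C `^ q)).
  - by have := measurable_wpow b q mf => /measurable_EFinP.
  - move=> x; rewrite ger0_norm ?mulr_ge0 ?W_ge0 ?powR_ge0//.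
    have [->|fx] := eqVneq (phi x) 0.
      by rewrite normr0 powR0 ?gt_eqF// mulr0 mulr_ge0 ?powR_ge0.
    have /andP[_ h] := W_le b (sub x fx) M1.
    apply: ler_pM; rewrite ?W_ge0 ?powR_ge0//.
    by apply: ge0_ler_powR; rewrite ?nnegrE ?(ltW q0) ?(ltW C0).
  move=> x fx; apply: annulus_cube (sub x _); apply: contraNneq fx => ->.
  by rewrite normr0 powR0 ?mulr0// gt_eqF.
move=> /integrableP[_]; apply: le_lt_trans; apply: ge0_le_integral => //.
- by move=> x _; exact: wpow_integrand_ge0.
- exact: measurable_wpow.
- by apply: measurableT_comp => //; exact: measurable_wpow.
- by move=> x _ /=; rewrite lee_fin ler_norm.
Qed.

Lemma wpow_scale (b q c : R) phi : 0 < c -> measurable_fun setT phi ->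
  wpow b q (fun x => c * phi x) = ((c `^ q)%:E * wpow b q phi)%E.
Proof.
move=> c0 mf; rewrite /wpow -ge0_integralZl//; first last.
- by rewrite lee_fin powR_ge0.
- by move=> x _; exact: wpow_integrand_ge0.
- exact: measurable_wpow.
apply: eq_integral => x _; rewrite -EFinM normrM powRM// (gtr0_norm c0); congr EFin.
by rewrite mulrCA.
Qed.

Lemma wD_scale (a c : R) phi : test_fun0 phi ->
  wD a (fun x => c * phi x) = c ^+ 2 * wD a phi.
Proof.
move=> tf; rewrite -IntZ; last exact: test_fun0_wD.
apply: eq_Int => x; rewrite laplacianM0//; last first.
  by apply: smooth_on_cst; exact: open_D0.
have pc i : partial i (fun _ : 'rV[R]_n => c) = fun=> 0 by exact: partial_cst.
rewrite [laplacian (fun _ => c) x]big1 => [|i _]; last by rewrite !pc partial_cst.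
rewrite big1 => [|i _]; last by rewrite pc mul0r.
by ring.
Qed.

Lemma normalize (q : R) phi : 0 < q -> test_fun0 phi -> (0 < wpow 0 q phi)%E ->
  exists2 c : R, 0 < c & wpow 0 q (fun x => c * phi x) = 1%E /\
    (wpow 0 q phi `^ (2 / q) = (c ^- 2)%:E)%E.
Proof.
move=> q0 tf N0; have Nfin := wpow_test_fin 0 q0 tf.
have [N NE] : exists N, wpow 0 q phi = N%:E.
  by exists (fine (wpow 0 q phi)); rewrite fineK// ge0_fin_numE ?wpow_ge0.
rewrite NE lte_fin in N0; exists (N `^ (- q^-1)); first exact: powR_gt0.
split.
  rewrite wpow_scale ?powR_gt0//; last exact: test_fun0_measurable.
  rewrite NE -EFinM -powRrM mulNr mulVf ?gt_eqF// powR_inv1 ?(ltW N0)//.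
  by rewrite mulVf ?gt_eqF.
rewrite NE poweR_EFin; congr EFin.
rewrite -powR_mulrn ?powR_ge0// -powRrM -powRN; congr (_ `^ _).
by rewrite mulNr opprK mulrC.
Qed.

(** If all test functions vanished almost everywhere, the constant 1 would be orthogonal to them,
    and the fundamental lemma would give 1 = 0 almost everywhere. *)
Lemma test_fun0_nonzero (q : R) : exists2 phi : 'rV[R]_n -> R, test_fun0 phi & (0 < wpow 0 q phi)%E.
Proof.
apply: contrapT => h.
have z phi : test_fun0 phi -> {ae mu, forall x, phi x = 0}.
  move=> tf; apply: contrapT => nt; apply: h; exists phi => //.
  by apply: wpow_gt0 => //; exact: test_fun0_measurable.
have l1 : locally_integrable0 (fun _ : 'rV[R]_n => 1 : R).
  move=> A cA A0; have [r [s [r0 rs sub]]] := compact_sub_annulus cA A0.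
  have mA : measurable A.
    by apply: closed_measurable_rV; apply: compact_closed => //; exact: norm_hausdorff.
  apply: measurable_bounded_integrable => //; last by exists 1; split => // M M1 x _ /=;
    rewrite normr1 ltW.
  apply: (@le_lt_trans _ _ (mu (@cube R n s))).
    apply: le_measure; rewrite ?inE//; first exact: measurable_cube.
    by move=> x /sub; exact: annulus_cube.
  by rewrite (lebesgue_cube _ (ltW (lt_trans r0 rs))) ltry.
have : {ae mu, forall x, (1 : R) = 0}.
  apply: (fundamental_lemma l1) => // phi tf.
  rewrite /Int /Rintegral (ae_eq_integral (cst 0%E))//.
  - by rewrite integral0.
  - by apply/measurable_EFinP; apply: measurable_funM => //; exact: test_fun0_measurable.
  - by apply: filterS (z phi tf) => x -> _; rewrite mulr0.
move=> [N [mN N0 NP]].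
have : (mu (@cube R n 1) <= mu N)%E.
  apply: le_measure; rewrite ?inE//; first exact: measurable_cube.
  by move=> x _; apply: NP => /= /eqP; rewrite oner_eq0.
rewrite N0 (lebesgue_cube _ ler01) lee_fin leNgt exprn_gt0//.
Qed.

End normalized_test_functions.

(** * Dependence of the quotient on alpha and q for a fixed trial function *)

Section trial_quotient.
Context {R : realType} {n : nat}.
Hypothesis n5 : (5 <= n)%N.
Notation mu := (lebesgue_rV R n).
Notation p := (@crit R n).

Let n0 : (0 < n)%N. Proof. exact: leq_trans n5. Qed.

Let nR : 5 <= n%:R :> R. Proof. by rewrite ler_nat. Qed.

Let p2 : 2 < p := crit_gt2 n5.

Lemma betaE (a q gamma : R) : gamma * 2 = n%:R - 4 + a ->
  - @beta R n a q = - n%:R + q * gamma.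
Proof.
move=> gE; rewrite /beta (_ : n%:R - 4 + a = gamma * 2)//.
by field.
Qed.

(** Since beta = (p - q)(n - 4)/2 - q a/2, the weight of the denominator disappears at a = 0, q = p,
    and its exponent is small nearby. *)
Lemma beta_le (a q : R) : 2 < q -> q <= p ->
  `|@beta R n a q| <= (n%:R + p) * (`|a| + (p - q)).
Proof.
move=> q2 qp.
have -> : @beta R n a q = (p - q) * (n%:R - 4) / 2 - q * a / 2.
  by rewrite /beta /crit; field; rewrite gt_eqF//; move: nR; lra.
apply: le_trans (ler_normB _ _) _.
have -> : `|(p - q) * (n%:R - 4) / 2| = (p - q) * (n%:R - 4) / 2.
  rewrite ger0_norm// divr_ge0// mulr_ge0//; first by rewrite subr_ge0.
  by move: nR; lra.
have -> : `|q * a / 2| = q * `|a| / 2.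
  rewrite normrM normrM (ger0_norm (_ : 0 <= 2^-1)) ?invr_ge0// ger0_norm//.
  by move: q2; lra.
have h1 : 0 <= p - q by rewrite subr_ge0.
have a0 : 0 <= `|a| := normr_ge0 a.
have e1 : q * `|a| <= p * `|a| by rewrite ler_wpM2r.
have e2 : 0 <= p * (p - q) by rewrite mulr_ge0//; move: p2; lra.
have e3 : 0 <= n%:R * `|a| by rewrite mulr_ge0.
have e4 : 0 <= n%:R * (p - q) by rewrite mulr_ge0.
have e5 : 0 <= p * `|a| by rewrite mulr_ge0//; move: p2; lra.
by lra.
Qed.

(** On the support of psi one has 1/M <= |x| <= M, so changing the weights costs M^|a| in the
    numerator and M^|beta| in the denominator; lowering the exponent from p to q costs m^(p-q),
    where m bounds |psi|. By [beta_le] all of this is at most X^(|a| + (p - q)) with X depending on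
    psi only. *)
Lemma trial_quotient (psi : 'rV[R]_n -> R) : test_fun0 psi -> wpow 0 p psi = 1%E ->
  exists2 X : R, 1 <= X & forall a q lambda : R, 2 < q -> q <= p -> 0 <= lambda ->
    (Q a q lambda psi <=
     (X `^ (`|a| + (p - q)) * (wD 0 psi + lambda * wB 0 psi))%:E)%E.
Proof.
move=> tf N1; have [M M1 sub] := annulus_bound tf.
have M0 : 0 < M by exact: lt_le_trans M1.
have [C C0 hC] := test_fun0_bounded tf.
pose m := Num.max 1 C; have m1 : 1 <= m by rewrite le_max lexx.
have m0 : 0 < m by exact: lt_le_trans m1.
pose X := M `^ (1 + (n%:R + p)) * m.
have p0 : 0 < p by apply: lt_trans p2.
have np : 0 <= n%:R + p by rewrite addr_ge0// ltW.
have MX1 : 1 <= M `^ (1 + (n%:R + p)) by rewrite -[leLHS](powRr0 M) ler_powR// addr_ge0.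
exists X; first by rewrite -[leLHS]mulr1; apply: ler_pM.
move=> a q lambda q2 qp l0.
have q0 : 0 < q by apply: lt_trans q2.
have h0 : 0 <= `|a| + (p - q) by rewrite addr_ge0// subr_ge0.
set h := `|a| + (p - q) in h0 *.
pose Y := M `^ `|@beta R n a q| * m `^ (p - q).
have Y0 : 0 < Y by rewrite mulr_gt0 ?powR_gt0.
have MbY : 1 <= M `^ `|@beta R n a q| by rewrite -(powRr0 M) ler_powR.
have mpq : 1 <= m `^ (p - q) by rewrite -(powRr0 m) ler_powR// subr_ge0.
have Y1 : 1 <= Y by rewrite -[leLHS]mulr1; apply: ler_pM.
have mf := test_fun0_measurable tf.
have hI : (1 <= Y%:E * wpow (- @beta R n a q) q psi)%E.
  rewrite -N1 /wpow -ge0_integralZl//; first last.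
  - by rewrite lee_fin ltW.
  - by move=> x _; exact: wpow_integrand_ge0.
  - exact: measurable_wpow.
  apply: ge0_le_integral => //.
  - by move=> x _; exact: wpow_integrand_ge0.
  - exact: measurable_wpow.
  - by apply: measurable_funeM; exact: measurable_wpow.
  move=> x _; rewrite -EFinM lee_fin [W 0 x]powRr0 mul1r.
  have [->|fx] := eqVneq (psi x) 0.
    by rewrite normr0 !powR0 ?gt_eqF// !mulr0.
  have un : 0 < `|psi x| by rewrite normr_gt0.
  have /andP[w _] := W_le (- @beta R n a q) (sub x fx) M1.
  rewrite normrN in w.
  have -> : `|psi x| `^ p = `|psi x| `^ (p - q) * `|psi x| `^ q.
    by rewrite -powRD ?subrK// (gt_eqF un) implybT.
  rewrite mulrA; apply: ler_wpM2r; first exact: powR_ge0.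
  have um : `|psi x| `^ (p - q) <= m `^ (p - q).
    apply: ge0_ler_powR; rewrite ?subr_ge0 ?nnegrE ?(ltW m0)//.
    by apply: le_trans (hC x) _; rewrite le_max lexx orbT.
  apply: le_trans um _; rewrite /Y mulrAC; apply: ler_peMl; first exact: powR_ge0.
  have Mb0 : 0 < M `^ `|@beta R n a q| by rewrite powR_gt0.
  rewrite -(mulfV (lt0r_neq0 Mb0)); apply: ler_wpM2l; first exact: ltW.
  by rewrite -powRN.
have MaE (g : 'rV[R]_n -> R) (c : R) : (forall x, 0 <= g x) -> (forall x, g x != 0 -> annulus M^-1 M x) ->
    test_fun0 g ->
    Int (fun x => W (a - c) x * g x) <= M `^ `|a| * Int (fun x => W (0 - c) x * g x).
  move=> g0 gs tg; rewrite -IntZ; last exact: test_fun0_W.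
  apply: Int_le => [||x].
  - exact: test_fun0_W.
  - by apply: test_fun0Z; exact: test_fun0_W.
  have [->|gx] := eqVneq (g x) 0; first by rewrite !mulr0.
  have an := gs x gx.
  have x0 : x != 0 by apply: annulus_D0 an; rewrite invr_gt0.
  rewrite mulrA ler_wpM2r// sub0r WD// ler_wpM2r ?W_ge0//.
  by have /andP[_ ->] := W_le a an M1.
have Mi0 : 0 < M^-1 by rewrite invr_gt0.
have hD : wD a psi <= M `^ `|a| * wD 0 psi.
  have := @MaE (fun x => laplacian psi x ^+ 2) 0; rewrite !subr0; apply.
  - by move=> x; exact: sqr_ge0.
  - move=> x; rewrite expf_eq0 /= => lx; apply: contrapT => nx; move/eqP: lx; apply.
    rewrite /laplacian big1// => i _; apply: contrapT => /eqP H; apply: nx.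
    exact: (partial_support Mi0 (partial_support Mi0 sub (i:=i))) H.
  - by apply: test_fun0_sqr; exact: test_fun0_laplacian.
have hB : wB a psi <= M `^ `|a| * wB 0 psi.
  apply: MaE; first exact: grad2_ge0.
  - move=> x; rewrite psumr_eq0 => [/allPn[i _]|i _]; last exact: sqr_ge0.
    rewrite /= expf_eq0 /= => gi; exact: (partial_support Mi0 sub gi).
  - exact: test_fun0_grad2.
have D0' : 0 <= wD 0 psi := wD_ge0 _ _.
have B0' : 0 <= wB 0 psi := wB_ge0 _ _.
have Ma0 : 0 <= M `^ `|a| := powR_ge0 _ _.
have hE : wD a psi + lambda * wB a psi <= M `^ `|a| * (wD 0 psi + lambda * wB 0 psi).
  rewrite mulrDr; apply: lerD => //; rewrite mulrCA; exact: ler_wpM2l.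
have hX : M `^ `|a| * Y <= X `^ h.
  rewrite /X powRM ?powR_ge0 ?(ltW m0)// -powRrM /Y mulrA.
  apply: ler_pM; rewrite ?mulr_ge0 ?powR_ge0//.
    rewrite -powRD; last by rewrite (gt_eqF M0) implybT.
    apply: ler_powR => //; rewrite mulrDl mul1r; apply: lerD; last exact: beta_le.
    by rewrite /h lerDl subr_ge0.
  by apply: ler_powR => //; rewrite /h lerDr.
have E0 : 0 <= wD 0 psi + lambda * wB 0 psi by rewrite addr_ge0// mulr_ge0.
rewrite /Q (energy_test n0)// -/(wpow (- @beta R n a q) q psi).
have fin := wpow_test_fin (- @beta R n a q) q0 tf.
have [J JE] : exists J, wpow (- @beta R n a q) q psi = J%:E.
  by exists (fine (wpow (- @beta R n a q) q psi)); rewrite fineK// ge0_fin_numE ?wpow_ge0.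
rewrite JE poweR_EFin; rewrite JE -EFinM lee_fin in hI.
have YJ : Y^-1 <= J by rewrite -[leLHS]mulr1 mulrC ler_pdivrMr// mulrC.
have J0 : 0 < J by apply: lt_le_trans YJ; rewrite invr_gt0.
(* Since Y^-1 <= 1 and 2/q <= 1, raising Y^-1 to the power 2/q does not decrease it. *)
have J2 : Y^-1 <= J `^ (2 / q).
  apply: (@le_trans _ _ (Y^-1 `^ (2 / q))); last first.
    by apply: ge0_ler_powR; rewrite ?nnegrE ?invr_ge0 ?(ltW Y0) ?(ltW J0)// divr_ge0// ltW.
  rewrite -powR_inv1 ?(ltW Y0)// -powRrM; apply: ler_powR => //.
  rewrite mulN1r lerN2 ler_pdivrMr// mul1r ltW//.
have J20 : 0 < J `^ (2 / q) by rewrite powR_gt0.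
rewrite inver (gt_eqF J20) -EFinM lee_fin ler_pdivrMr//.
apply: le_trans hE _; rewrite mulrAC; apply: ler_wpM2r => //.
have YY : 1 <= Y * J `^ (2 / q).
  by have := ler_wpM2l (ltW Y0) J2; rewrite (mulfV (lt0r_neq0 Y0)).
apply: (@le_trans _ _ (M `^ `|a| * Y * J `^ (2 / q))).
  by rewrite -mulrA ler_peMr.
by apply: ler_wpM2r => //; exact: ltW.
Qed.

End trial_quotient.

(** * Comparison of the infima *)

Section constants.
Context {R : realType} {n : nat}.
Hypothesis n5 : (5 <= n)%N.
Notation mu := (lebesgue_rV R n).
Notation p := (@crit R n).

Let n0 : (0 < n)%N. Proof. exact: leq_trans n5. Qed.

Let nR : 5 <= n%:R :> R. Proof. by rewrite ler_nat. Qed.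

Let p2 : 2 < p := crit_gt2 n5.

Let p0 : 0 < p. Proof. by apply: lt_trans p2. Qed.

Lemma sobolev_constant : exists S : R, [/\ 0 <= S,
  forall phi : 'rV[R]_n -> R, test_fun0 phi ->
    (S%:E * wpow 0 p phi `^ (2 / p) <= (wD 0 phi)%:E)%E &
  forall e : R, 0 < e -> exists psi : 'rV[R]_n -> R,
    [/\ test_fun0 psi, wpow 0 p psi = 1%E & wD 0 psi < S + e] ].
Proof.
pose E : set R := [set d | exists phi : 'rV[R]_n -> R,
  [/\ test_fun0 phi, wpow 0 p phi = 1%E & d = wD 0 phi]].
have lb0 : lbound E 0 by move=> _ [phi [_ _ ->]]; exact: wD_ge0.
have E0 : E !=set0.
  have [phi tf N0] := @test_fun0_nonzero R n n0 p.
  have [c c0 [cN _]] := normalize p0 tf N0.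
  exists (wD 0 (fun x => c * phi x)); exists (fun x => c * phi x); split => //.
  exact: test_fun0Z.
exists (inf E); split.
- exact: lb_le_inf.
- move=> phi tf; have [N0|N0] := eqVneq (wpow 0 p phi) 0%E.
    rewrite N0 poweR0r ?mule0 ?lee_fin; first exact: wD_ge0.
    by rewrite mulf_neq0// invr_neq0// gt_eqF.
  have N1 : (0 < wpow 0 p phi)%E by rewrite lt_neqAle eq_sym N0 wpow_ge0.
  have [c c0 [cN ->]] := normalize p0 tf N1.
  rewrite -EFinM lee_fin ler_pdivrMr ?exprn_gt0// mulrC -wD_scale//.
  apply: ge_inf; first by exists 0.
  by exists (fun x => c * phi x); split => //; exact: test_fun0Z.
- move=> e e0; have Se : inf E < inf E + e by rewrite ltrDl.
  have [_ [psi [tf N1 ->]] h] := inf_lt E0 Se.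
  by exists psi.
Qed.

Variables (S K lambda : R).
Hypotheses (S0 : 0 <= S) (lambda0 : 0 < lambda) (K0 : 0 <= K).
Hypothesis sobolev : forall phi : 'rV[R]_n -> R, test_fun0 phi ->
    (S%:E * wpow 0 p phi `^ (2 / p) <= (wD 0 phi)%:E)%E.
Hypothesis shiftK : forall (a gamma : R) (phi : 'rV[R]_n -> R),
  gamma * 2 = n%:R - 4 + a -> 1 / 4 <= gamma -> `|a| <= 1 / 2 -> test_fun0 phi ->
  wD 0 (fun x => W (a / 2) x * phi x) <= (1 + K * `|a|) * wD a phi.

Lemma radial_quotient (a q : R) (u : 'rV[R]_n -> R) : `|a| <= 1 / 2 -> 2 < q -> q <= p ->
  D22_rad a u -> nontrivial u ->
  ((S / @subcrit_const R n S K a q + lambda / (16 * @radial_const R n))%:E <=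
   Q a q lambda u)%E.
Proof.
move=> ha q2 qp [Du ru] nt; have mf := Du.1.
pose gamma := (n%:R - 4 + a) / 2.
have gammaE : gamma * 2 = n%:R - 4 + a by rewrite divfK.
have /andP[ha1 ha2] : - (1 / 2) <= a <= 1 / 2 by rewrite -ler_norml.
have gamma_ge : 1 / 4 <= gamma by rewrite /gamma; move: nR ha1; lra.
have gamma0 : 0 < gamma by apply: lt_le_trans gamma_ge.
have a2 : a <= 2 by move: ha2; lra.
have [f [D [B [tf fu fDB EE]]]] := D22_energy n0 gammaE gamma0 a2 lambda Du.
have fD (e : R) : 0 < e -> \forall k \near \oo, wD a (f k) <= D + e.
  by move=> e0; apply: filterS (fDB e e0) => k [].
have fB (e : R) : 0 < e -> \forall k \near \oo, wB a (f k) <= B + e.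
  by move=> e0; apply: filterS (fDB e e0) => k [].
have q0 : 0 < q by apply: lt_trans q2.
rewrite /Q EE (betaE q gammaE).
rewrite -/(wpow (- n%:R + q * gamma) q u).
have lowB := radial_lower n0 gammaE gamma_ge mf ru tf fu fB q2.
have I0 := wpow_gt0 n0 (- n%:R + q * gamma) q mf nt.
have J0 := poweR_gt0 (2 / q) I0.
(* [lowB] excludes an infinite denominator and [J0] a zero one, so the extended quotient is an
   ordinary one. *)
case JE: (wpow (- n%:R + q * gamma) q u `^ (2 / q))%E lowB J0 => [J| |]//.
rewrite lee_fin lte_fin => lowB J0.
rewrite inver (gt_eqF J0) -EFinM lee_fin ler_pdivlMr//.
have rc0 : 0 < 16 * @radial_const R n.
  by rewrite mulr_gt0// (lt_le_trans _ (radial_const_ge1)).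
have F0 := subcrit_const_gt0 S K0 a q.
rewrite mulrDl; apply: lerD; last first.
  by rewrite mulrAC -mulrA; apply: ler_wpM2l; [exact: ltW|rewrite ler_pdivrMr// mulrC].
have Dge0 : 0 <= D.
  rewrite leNgt; apply/negP => D0.
  have e0 : 0 < - D / 2 by rewrite divr_gt0// oppr_gt0.
  have [k _ /(_ k (leqnn k))] := fD _ e0.
  by apply/negP; rewrite -ltNge; apply: lt_le_trans (wD_ge0 a (f k)); move: D0; lra.
(* [wpow_lim_le] divides by S; for S = 0 the bound on the Laplacian term is just D >= 0. *)
have [S00|Sn0] := eqVneq S 0; first by rewrite S00 !mul0r.
have Sp : 0 < S by rewrite lt_neqAle eq_sym Sn0.
have := wpow_lim_le n5 Sp sobolev K0 shiftK gammaE ha q2 qp mf tf fu fD.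
rewrite JE lee_fin => h.
have SF0 : 0 <= S / @subcrit_const R n S K a q by apply: divr_ge0 => //; exact: ltW.
apply: le_trans (ler_wpM2l SF0 h) _; rewrite -[leRHS]mul1r mulrA; apply: ler_wpM2r; first exact: Dge0.
by rewrite mulrA divfK ?gt_eqF// mulfV ?gt_eqF.
Qed.

End constants.

Lemma powR_near1 (R : realType) (Z eta : R) : 1 <= Z -> 0 < eta ->
  exists2 d : R, 0 < d & forall t, 0 <= t -> t <= d -> Z `^ t <= 1 + eta.
Proof.
move=> Z1 e0; have Z0 : 0 < Z by exact: lt_le_trans Z1.
have l0 : 0 <= ln Z by exact: ln_ge0.
have le0 : 0 < ln (1 + eta) by apply: ln_gt0; rewrite ltrDl.
exists (ln (1 + eta) / (1 + ln Z)); first by rewrite divr_gt0// ltr_pwDl.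
move=> t t0 td; rewrite /powR gt_eqF// -[leRHS]lnK ?posrE ?ltr_pwDl ?(ltW e0)//.
rewrite ler_expR; apply: (@le_trans _ _ (t * (1 + ln Z))).
  by apply: ler_wpM2l => //; rewrite lerDr.
by rewrite -ler_pdivlMr// ltr_pwDl.
Qed.

(** The bound on eta gives eta S <= c/8. The left side is then at most S + c/8 + c/2, and the right
    side at least S (1 - 2 eta) + c >= S + 3c/4. *)
Lemma gap_arith (R : realFieldType) (S c eta F : R) : 0 <= S -> 0 < c ->
  0 < eta -> eta <= 1 -> eta <= c / (8 * (S + 1)) -> 0 < F -> F <= (1 + eta) ^+ 2 ->
  (1 + eta) * (S + c / 4) < S / F + c.
Proof.
move=> S0 c0 e0 e1 ec F0 Fe.
have Sc : eta * (8 * (S + 1)) <= c by rewrite -ler_pdivlMr// mulr_gt0// ltr_wpDl.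
have SF : S * (1 - 2 * eta) <= S / F.
  apply: ler_wpM2l => //.
  rewrite -[leRHS]mul1r ler_pdivlMr//.
  have [h|h] := leP 0 (1 - 2 * eta); last by nra.
  apply: le_trans (ler_wpM2l h Fe) _; nra.
have h1 : eta * S <= c / 8 by nra.
by nra.
Qed.

Lemma wpow_nontrivial (R : realType) (n : nat) (b q : R) (u : 'rV[R]_n -> R) :
  0 < q -> measurable_fun setT u -> (0 < wpow b q u)%E -> nontrivial u.
Proof.
move=> q0 mf + z; apply/negP; rewrite -leNgt le_eqVlt; apply/orP; left; apply/eqP.
rewrite /wpow (ae_eq_integral (cst 0%E))//.
- by rewrite integral0.
- exact: measurable_wpow.
- by apply: filterS z => x -> _; rewrite normr0 powR0 ?mulr0// gt_eqF.
Qed.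

Theorem theorem1p3 (R : realType) (n : nat) (lambda : R)
    (hn : (5 <= n)%N) (hlambda : 0 < lambda) :
  exists alphabar qbar : R,
    [/\ 0 < alphabar,
        2 < qbar < 2 * n%:R / (n%:R - 4),
        forall alpha q : R,
          qbar < q <= 2 * n%:R / (n%:R - 4) ->
          4 - n%:R < alpha < n%:R -> `|alpha| < alphabar ->
          (S_inf R n alpha q lambda < S_rad R n alpha q lambda)%E
      & forall alpha q : R,
          qbar < q < 2 * n%:R / (n%:R - 4) ->
          4 - n%:R < alpha < n%:R -> `|alpha| < alphabar ->
          forall u : 'rV[R]_n -> R,
            ground_state alpha q lambda u -> ~ radial u].
Proof.
have n0 : (0 < n)%N by exact: leq_trans hn.
have nR : 5 <= n%:R :> R by rewrite ler_nat.
rewrite -/(@crit R n); set p := crit.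
have p2 : 2 < p := crit_gt2 hn.
have p0 : 0 < p by apply: lt_trans p2.
have [S [S0 sob trial]] := @sobolev_constant R n hn.
have rc0 : 0 < 16 * @radial_const R n.
  by rewrite mulr_gt0// (lt_le_trans _ radial_const_ge1).
pose c := lambda / (16 * @radial_const R n); have c0 : 0 < c by rewrite divr_gt0.
have [K K0 shK] : exists2 K : R, 0 <= K & forall (a gamma : R) (phi : 'rV[R]_n -> R),
    gamma * 2 = n%:R - 4 + a -> 1 / 4 <= gamma -> `|a| <= 1 / 2 -> test_fun0 phi ->
    wD 0 (fun x => W (a / 2) x * phi x) <= (1 + K * `|a|) * wD a phi.
  exists (65 + 1024 * n%:R ^+ 2).
    by apply: addr_ge0; [exact: ler0n|apply: mulr_ge0; [exact: ler0n|exact: sqr_ge0]].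
  by move=> a gamma phi; exact: wD_shift.
have [psi [tf N DB]] : exists psi : 'rV[R]_n -> R, [/\ test_fun0 psi, wpow 0 p psi = 1%E &
    wD 0 psi + lambda * wB 0 psi <= S + c / 4].
  (* The allowance c/4 is shared equally: c/8 for the near optimality of [phi], c/8 for the gradient
     term of its far translate. *)
  have c8 : 0 < c / 8 by rewrite divr_gt0.
  have [phi [tphi Nphi Dphi]] := trial _ c8.
  have [_ [r [s [r0 rs supp]]]] := (test_fun0P phi).1 tphi.
  have l8 : 0 < c / 8 / lambda by rewrite divr_gt0.
  have [psi [tpsi Npsi Dpsi Bpsi]] := far_translate n0 r0 rs tphi supp l8.
  exists psi; split; [exact: tpsi|by rewrite Npsi; exact: Nphi|].
  have hB : lambda * wB 0 psi <= c / 8.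
    by rewrite mulrC; move: Bpsi; rewrite (ler_pdivlMr _ _ hlambda).
  apply: le_trans (lerD (ltW (_ : wD 0 psi < S + c / 8)) hB) _; first by rewrite Dpsi; exact: Dphi.
  by rewrite -addrA lerD2l; move: c0; clear; lra.
have [X X1 HX] := trial_quotient hn tf N.
pose eta := Num.min 1 (c / (8 * (S + 1))).
have eta0 : 0 < eta by rewrite lt_min ltr01/= divr_gt0// mulr_gt0// ltr_wpDl.
have eta1 : eta <= 1 by rewrite ge_min lexx.
have etac : eta <= c / (8 * (S + 1)) by rewrite ge_min lexx orbT.
pose M := Num.max 1 (16 * S); have M1 : 1 <= M by rewrite le_max lexx.
(* A common base for the two factors that must be close to 1: the power of X in the upper bound and
   the power of M in [subcrit_const]. *)
pose Z := Num.max X M.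
have XZ : X <= Z by rewrite le_max lexx.
have MZ : M <= Z by rewrite le_max lexx orbT.
have [d d0 Hd] := powR_near1 (le_trans X1 XZ) eta0.
(* The value 1/2 admits the weight shift. The second entry makes both exponents of Z, |a| + (p - q)
   and (p - q)(n - 4)/8, at most d. The third gives K |a| <= eta. *)
pose delta := Num.min (1 / 2) (Num.min (d / (n%:R + 2)) (eta / (K + 1))).
have n2 : 0 < n%:R + 2 :> R by move: nR; lra.
have K1 : 0 < K + 1 by rewrite ltr_wpDl.
have delta0 : 0 < delta by rewrite !lt_min !divr_gt0.
have delta_half : delta <= 1 / 2 by rewrite ge_min lexx.
have deltad : delta * (n%:R + 2) <= d.
  by rewrite -ler_pdivlMr// /delta !ge_min lexx !orbT.
have deltaK : delta * (K + 1) <= eta.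
  by rewrite -ler_pdivlMr// /delta !ge_min lexx !orbT.
(* The midpoint of 2 and p keeps [qbar] above 2 even when [delta] exceeds p - 2. *)
pose qbar := Num.max ((p + 2) / 2) (p - delta).
have gap (a q : R) : qbar < q <= p -> `|a| < delta ->
    (S_inf R n a q lambda < S_rad R n a q lambda)%E.
  rewrite gt_max => /andP[/andP[hq1 hq2] qp] ha.
  have q2 : 2 < q by move: hq1 p2; lra.
  have pq0 : 0 <= p - q by rewrite subr_ge0.
  have pqd : p - q < delta by move: hq2; lra.
  have a0 : 0 <= `|a| := normr_ge0 a.
  have ha2 : `|a| <= 1 / 2 by apply/ltW/(lt_le_trans ha).
  have upper : (S_inf R n a q lambda <= ((1 + eta) * (S + c / 4))%:E)%E.
    apply: (@le_trans _ _ (Q a q lambda psi)).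
      apply: ereal_inf_lbound; exists psi => //; split; first exact: D22_test.
      apply: (wpow_nontrivial (b := 0) p0 (test_fun0_measurable tf)).
      by rewrite N lte_fin.
    apply: le_trans (HX a q lambda q2 qp (ltW hlambda)) _; rewrite lee_fin.
    apply: ler_pM => //; first exact: powR_ge0.
      by rewrite addr_ge0 ?wD_ge0// mulr_ge0 ?wB_ge0// ltW.
    apply: (@le_trans _ _ (Z `^ (`|a| + (p - q)))).
      apply: ge0_ler_powR => //; rewrite ?nnegrE; first exact: addr_ge0.
        exact: le_trans X1.
      exact: le_trans (le_trans X1 XZ).
    by apply: Hd; [exact: addr_ge0|move: ha pqd deltad nR delta0; nra].
  pose F := @subcrit_const R n S K a q.
  have F0 : 0 < F := subcrit_const_gt0 S K0 a q.
  have FE : F <= (1 + eta) ^+ 2.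
    rewrite /F /subcrit_const -/M expr2.
    have s0 : 0 <= 1 - (q - 2) * (n%:R - 4) / 8.
      move: qp; rewrite /p /crit ler_pdivlMr; last by move: nR; lra.
      by move: nR; lra.
    apply: ler_pM; first exact: powR_ge0.
    - by rewrite addr_ge0// mulr_ge0.
    - apply: (@le_trans _ _ (Z `^ (1 - (q - 2) * (n%:R - 4) / 8))).
        apply: ge0_ler_powR => //; rewrite ?nnegrE; first exact: le_trans M1.
        exact: le_trans (le_trans M1 MZ).
      apply: Hd => //.
      have -> : 1 - (q - 2) * (n%:R - 4) / 8 = (p - q) * (n%:R - 4) / 8.
        by rewrite /p /crit; field; rewrite gt_eqF//; move: nR; lra.
      by move: deltad pqd pq0 nR delta0; nra.
    by rewrite lerD2l; move: deltaK ha K0 a0; nra.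
  apply: (le_lt_trans upper).
  apply: (@lt_le_trans _ _ (S / F + c)%:E); first by rewrite lte_fin; exact: gap_arith.
  apply: le_ereal_inf_tmp => _ [u [Du nt] <-].
  exact: radial_quotient.
exists delta, qbar; split => //.
- rewrite lt_max gt_max; apply/andP; split; last by apply/andP; split; move: p2; lra.
  by apply/orP; left; move: p2; lra.
- by move=> a q hq _; exact: gap.
move=> a q /andP[hq1 hq2] _ ha u [Du nt _ Qu] ru.
(* A radial ground state would compete for [S_rad], forcing S_rad <= Q u = S_inf. *)
have := gap a q; rewrite hq1 (ltW hq2) => /(_ isT ha); apply/negP; rewrite -leNgt -Qu.
by apply: ereal_inf_lbound; exists u.
Qed.
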